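(* Let $\lambda>0$ and let $F$ be a probability measure on $\mathbb{R}_+=[0,\infty)$ which follows a power law with tail exponent $\alpha>d$, so that $1-F(r)=\ell(r)r^{-\alpha}$ for some slowly varying function $\ell$. Consider the thinning which favors large grains, i.e. the weight kernel is $G_r(dw)=\delta_r(dw)$ for every $r$ (the weight of each grain equals its radius). Then the thinned radius distribution satisfies \[ \bar F_{\rm th}(r)\sim\frac{\lambda}{\lambda_{\rm th}}\,\ell(r)\,r^{-\alpha} \quad\text{as } r\to\infty, \] the covariance function of the thinned grain cover satisfies \[ k_{\rm th}(z)\sim\lambda\,c_{\alpha,d}\,(1-p_{\rm th})^2\,\ell(|z|)\,|z|^{-(\alpha-d)} \quad\text{as } |z|\to\infty, \] and the two-point correlation function of the thinned grain centers satisfies \[ \xi_{\rm th}(z)\sim\lambda\,c_{\alpha,d}\,\ell(|z|)\,|z|^{-(\alpha-d)} \quad\text{as } |z|\to\infty, \] where $c_{\alpha,d}=\int_0^\infty|B_r(o)\cap B_r(e_1)|\,\alpha r^{-\alpha-1}\,dr$.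
   Context: Notation: $d\ge 1$ is the dimension, $o$ the origin and $e_1$ the first standard unit vector of $\mathbb{R}^d$; $B_r(x)$ is the closed Euclidean ball with center $x$ and radius $r$, $B_r=B_r(o)$; $|B|$ is the Lebesgue measure of a Borel set $B\subset\mathbb{R}^d$, and $|z|$ is the Euclidean norm of a vector $z$. $\mathbb{R}_+=[0,\infty)$. For a probability measure $F$ on $\mathbb{R}_+$, $F(r)=F[0,r]$ and $\bar F(r)=1-F(r)$. $f\sim g$ means $f/g\to1$. A measurable $f:\mathbb{R}_+\to\mathbb{R}$ is regularly varying with exponent $\gamma$ if it is positive for all large arguments and $f(at)/f(t)\to a^\gamma$ as $t\to\infty$ for all $a>0$; slowly varying means regularly varying with exponent $0$. $F$ follows a power law with tail exponent $\alpha$ if $\bar F$ is regularly varying with exponent $-\alpha$. Model: $\Phi$ is a Poisson random measure (identified with its random set of points) on $\mathbb{R}^d\times\mathbb{R}_+\times\mathbb{R}_+$ with intensity measure $\lambda\,dx\,F(dr)\,G_r(dw)$, where $\lambda>0$, $\int r^dF(dr)<\infty$ and $G$ is a probability kernel on $\mathbb{R}_+$. A point $(x,r,w)$ is called a grain with center $x$, radius $r$, weight $w$. For a grain configuration $\varphi$, the thinning $T(\varphi)$ is the set of those $(x,r,w)\in\varphi$ such that $w>w'$ for every other grain $(x',r',w')\in\varphi$ with $B_{r'}(x')\cap B_r(x)\ne\emptyset$. The thinned model is $\Phi^{\rm th}=T(\Phi)$, its grain cover is $X^{\rm th}=\bigcup_{(x,r,w)\in\Phi^{\rm th}}B_r(x)$,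 and $\Phi^{\rm th}_g=\{x:(x,r,w)\in\Phi^{\rm th}\}$ is the point configuration of thinned grain centers. Retention probabilities: $h(r,w)=\mathrm{P}\big((x,r,w)\in T(\Phi\cup\{(x,r,w)\})\big)$ (independent of $x$), and $h(r)=\int h(r,w)\,G_r(dw)$. For two reference grains with $|x_1-x_2|=u$, $h_2(u,r_1,w_1,r_2,w_2)=\mathrm{P}\big(\text{both } (x_i,r_i,w_i)\in T(\Phi\cup\{(x_1,r_1,w_1),(x_2,r_2,w_2)\})\big)$, which depends on $x_1,x_2$ only through $u$ (the two reference grains count as different grains), and $h_2(u,r_1,r_2)=\iint h_2(u,r_1,w_1,r_2,w_2)\,G_{r_1}(dw_1)G_{r_2}(dw_2)$. Retention covariance function: $q(u,r_1,r_2)=h_2(u,r_1,r_2)-h(r_1)h(r_2)$. Statistics of the thinned model: density of centers $\lambda_{\rm th}=\lambda\int h(r)F(dr)$; radius distribution of a typical thinned grain $F_{\rm th}(r)=1-\frac{\lambda}{\lambda_{\rm th}}\int_{(r,\infty)}h(s)F(ds)$, with $\bar F_{\rm th}=1-F_{\rm th}$; volume fraction $p_{\rm th}=\mathrm{P}(o\in X^{\rm th})=\lambda\int|B_r|h(r)F(dr)$; covariance function $k_{\rm th}(z)=\mathrm{P}(o\in X^{\rm th},z\in X^{\rm th})-\mathrm{P}(o\in X^{\rm th})\mathrm{P}(z\in X^{\rm th})$; two-point correlation function $\xi_{\rm th}$, a function with $\mathrm{Cov}(\Phi^{\rm th}_g(A),\Phi^{\rm th}_g(B))=\lambda_{\rm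 th}^2\int_A\int_B\xi_{\rm th}(x-y)\,dx\,dy$ for all disjoint bounded measurable $A,B\subset\mathbb{R}^d$, taken in the version $\xi_{\rm th}(z)=\frac{\lambda^2}{\lambda_{\rm th}^2}\iint q(|z|,r_1,r_2)F(dr_1)F(dr_2)$. *)

(* Defs.v *)
From HB Require Import structures.
From mathcomp Require Import all_boot all_order all_algebra.
From mathcomp Require Import all_classical all_reals all_analysis.
From mathcomp Require Import measurable_realfun.

Set Implicit Arguments.
Unset Strict Implicit.
Unset Printing Implicit Defensive.

Import Order.TTheory GRing.Theory Num.Theory.
Import numFieldNormedType.Exports.

Local Open Scope classical_set_scope.
Local Open Scope ring_scope.

(** A point of the d-dimensional Euclidean space is a [d]-tuple of reals:
    tuples carry the product sigma-algebra (generated by the coordinates). *)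
Notation Rd R d := (d.-tuple (measurableTypeR R)).

Section euclidean_space.
Variables (R : realType) (d : nat).
Implicit Types (x y z : Rd R d) (r : R).

Definition edist x y : R :=
  Num.sqrt (\sum_(i < d) (tnth x i - tnth y i) ^+ 2).

Definition origin : Rd R d := [tuple 0 | i < d].

Definition e1 : Rd R d := [tuple (i == 0%N :> nat)%:R | i < d].

Definition scaled_e1 r : Rd R d := [tuple r * tnth e1 i | i < d].

Definition enorm z : R := edist z origin.

(** Empty when [r < 0]. *)
Definition eball x r : set (Rd R d) := [set y | edist x y <= r].

(** The filter of the limits "as |z| tends to infinity". *)
Definition enorm_infty : set_system (Rd R d) :=
  filter_from [set: R] (fun M => [set z | M < enorm z]).

Global Instance enorm_infty_filter : Filter enorm_infty.
Proof.
apply: filter_from_filter; first by exists 0.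
move=> M N _ _; exists (Num.max M N) => // z /=.
by rewrite gt_max => /andP[].
Qed.

End euclidean_space.
Arguments origin {R d}.
Arguments e1 {R d}.
Arguments scaled_e1 {R d}.
Arguments enorm_infty {R d}.

(** Sigma-finite product measures on tuples: [tuple_prod m n] is the n-fold
    product of [m]. *)
Section tuple_prod_step.
Context dT (T : measurableType dT) (R : realType) (n : nat).
Variable m : {sigma_finite_measure set T -> \bar R}.
Variable mu : {sigma_finite_measure set (n.-tuple T) -> \bar R}.

Let consT (p : T * n.-tuple T) : n.+1.-tuple T :=
  [the n.+1.-tuple _ of p.1 :: p.2].

Let mconsT B : measurable B -> measurable (consT @^-1` B).
Proof.
by move=> mB; rewrite -[X in measurable X]setTI; exact: measurable_cons.
Qed.

Definition tuple_prod_step : set (n.+1.-tuple T) -> \bar R :=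
  pushforward (m \x mu)%E consT.

Let step0 : tuple_prod_step set0 = 0%E.
Proof. by rewrite /tuple_prod_step /pushforward preimage_set0 measure0. Qed.

Let step_ge0 A : (0 <= tuple_prod_step A)%E.
Proof. by rewrite /tuple_prod_step /pushforward measure_ge0. Qed.

Let step_sigma_additive : semi_sigma_additive tuple_prod_step.
Proof.
move=> A mA tA mUA; rewrite /tuple_prod_step /pushforward preimage_bigcup.
apply: measure_semi_sigma_additive.
- by move=> k; exact: mconsT.
- apply/trivIsetP => i j _ _ ij; rewrite -preimage_setI.
  by move/trivIsetP : tA => /(_ _ _ Logic.I Logic.I ij) ->; rewrite preimage_set0.
- by rewrite -preimage_bigcup; exact: mconsT.
Qed.

HB.instance Definition _ := isMeasure.Build _ _ _ tuple_prod_step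
  step0 step_ge0 step_sigma_additive.

Let step_sigma_finite : sigma_finite [set: n.+1.-tuple T] tuple_prod_step.
Proof.
have /sigma_finiteP[F [TF ndF Foo]] := sigma_finiteT m.
have /sigma_finiteP[G [TG ndG Goo]] := sigma_finiteT mu.
pose uncons (x : n.+1.-tuple T) : T * n.-tuple T :=
  (thead x, [tuple of behead x]).
have muncons : measurable_fun setT uncons.
  apply: measurable_fun_pair; first exact: measurable_tnth.
  exact: measurable_behead.
have unconsK p : uncons (consT p) = p.
  by case: p => a t; congr pair; apply/val_inj.
exists (fun k => uncons @^-1` (F k `*` G k)).
  apply/esym; rewrite -subTset => x _.
  have [k _ Fk] : (\bigcup_k F k) (uncons x).1 by rewrite -TF.
  have [l _ Gl] : (\bigcup_l G l) (uncons x).2 by rewrite -TG.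
  exists (maxn k l) => //; split.
  - by move: Fk; exact/subsetPset/ndF/leq_maxl.
  - by move: Gl; exact/subsetPset/ndG/leq_maxr.
move=> k; have [mF Fk] := Foo k; have [mG Gk] := Goo k; split.
  rewrite -[X in measurable X]setTI; apply: muncons => //.
  exact: measurableX.
rewrite /tuple_prod_step /pushforward (_ : _ @^-1` _ = F k `*` G k); last first.
  by apply/funext => p; rewrite /preimage /mkset unconsK.
by rewrite product_measure1E// lte_mul_pinfty// ge0_fin_numE.
Qed.

HB.instance Definition _ := Measure_isSigmaFinite.Build _ _ _ tuple_prod_step
  step_sigma_finite.

End tuple_prod_step.

Fixpoint tuple_prod dT (T : measurableType dT) (R : realType)
    (m : {sigma_finite_measure set T -> \bar R}) n :
    {sigma_finite_measure set (n.-tuple T) -> \bar R} :=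
  match n with
  | 0 => dirac [tuple]
  | n.+1 => tuple_prod_step m (tuple_prod m n)
  end.

Definition lebesgue_Rd (R : realType) d :
    {sigma_finite_measure set (Rd R d) -> \bar R} :=
  tuple_prod (@lebesgue_measure R) d.

Lemma lebesgue_Rd_box (R : realType) n (A : 'I_n -> set (measurableTypeR R)) :
  (forall i, measurable (A i)) ->
  lebesgue_Rd R n [set x | forall i, A i (tnth x i)] =
  (\prod_(i < n) lebesgue_measure (A i))%E.
Proof.
rewrite /lebesgue_Rd; elim: n A => [|n IH] A mA.
  rewrite big_ord0 /= diracE mem_set//; by case.
rewrite big_ord_recl /= /tuple_prod_step /pushforward.
rewrite (_ : _ @^-1` _ =
    A ord0 `*` [set x | forall i, A (lift ord0 i) (tnth x i)]).
  rewrite product_measure1E//.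
    by congr mule; apply: (IH (fun i => A (lift ord0 i))) => i; exact: mA.
  rewrite (_ : [set _ | _] =
    \bigcap_(i in setT) (fun x : n.-tuple _ => tnth x i) @^-1` A (lift ord0 i)).
    apply: fin_bigcap_measurable => // i _.
    rewrite -[X in measurable X]setTI. exact: measurable_tnth.
  by apply/seteqP; split => x /= H i; [move=> _|]; exact: H.
apply/seteqP; split => -[a x] /= H.
  split; first by have := H ord0.
  by move=> i; have := H (lift ord0 i); rewrite tnthS.
case: H => H0 H i; case: (unliftP ord0 i) => [j ->|-> //].
by rewrite tnthS.
Qed.

Section regular_variation.
Variable R : realType.
Implicit Types f : R -> R.

Definition regularly_varying f (gamma : R) : Prop :=
  [/\ @measurable_fun _ _ (measurableTypeR R) (measurableTypeR R) `[0, +oo[ f,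
      \forall t \near +oo, 0 < f t &
      forall a, 0 < a -> f (a * t) / f t @[t --> +oo] --> a `^ gamma].

Definition slowly_varying f : Prop := regularly_varying f 0.

Definition tail (F : probability (measurableTypeR R) R) (r : R) : R :=
  1 - fine (F `[0, r]%classic).

Definition power_law F (alpha : R) : Prop :=
  regularly_varying (tail F) (- alpha).

(** [f / g] tends to 1 along the filter [A]; since [x / 0 = 0] this forces [g]
    to be eventually nonzero. *)
Definition asymp_equiv T (A : set_system T) (f g : T -> R) : Prop :=
  f x / g x @[x --> A] --> (1 : R).

End regular_variation.

(** A grain is a triple (center, radius, weight). *)
Notation grain R d := (Rd R d * measurableTypeR R * measurableTypeR R)%type.

Section grains.
Variables (R : realType) (d : nat).
Implicit Types (g : grain R d) (phi : set (grain R d)).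

Definition center g : Rd R d := g.1.1.
Definition radius g : R := g.1.2.
Definition weight g : R := g.2.

Definition gball g : set (Rd R d) := eball (center g) (radius g).

Definition thin phi : set (grain R d) :=
  [set g | phi g /\ forall g', phi g' -> g' <> g ->
     gball g' `&` gball g !=set0 -> weight g' < weight g].

Definition grain_cover phi : set (Rd R d) := \bigcup_(g in phi) gball g.

End grains.

Section poisson.
Context (R : realType) (d : nat).
Variables (dO : measure_display) (Omega : measurableType dO).
Variable P : probability Omega R.
Variable Phi : Omega -> set (grain R d).

Definition npoints (B : set (grain R d)) (omega : Omega) : \bar R :=
  counting (Phi omega `&` B).

Local Open Scope ereal_scope.

(** The Poisson random measure with intensity measure [Lambda] on
    R^d x [0, oo[ x [0, oo[, identified with its set of points. The space of
    grains is [grain R d], so the nonnegativity of radii and weights is part of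
    the definition. The Poisson weights are written out because the library's
    [poisson_pmf 0] is not the point mass at 0. *)
Record poisson_random_measure (Lambda : set (grain R d) -> \bar R) : Prop := {
  prm_ge0 : forall omega g, Phi omega g ->
    (0 <= radius g)%R /\ (0 <= weight g)%R ;
  prm_locally_finite : forall omega (r : R),
    finite_set (Phi omega `&` [set g | (enorm (center g) <= r)%R]) ;
  prm_measurable : forall B, measurable B ->
    measurable_fun [set: Omega] (npoints B) ;
  prm_poisson : forall B, measurable B -> Lambda B < +oo -> forall k : nat,
    P [set omega | npoints B omega = k%:R%:E] =
    (expR (- fine (Lambda B)) * fine (Lambda B) ^+ k / k`!%:R)%:E ;
  prm_infinite : forall B, measurable B -> Lambda B = +oo ->
    P [set omega | npoints B omega = +oo] = 1 ;
  prm_independent : forall n (B : 'I_n -> set (grain R d))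
      (C : 'I_n -> set \bar R),
    (forall i, measurable (B i)) -> trivIset [set: 'I_n] B ->
    (forall i, measurable (C i)) ->
    P [set omega | forall i, C i (npoints (B i) omega)] =
    \prod_(i < n) P [set omega | C i (npoints (B i) omega)]
}.

End poisson.

(** lambda dx F(dr) G_r(dw) *)
Definition intensity (R : realType) (d : nat) (lambda : R)
    (F : probability (measurableTypeR R) R)
    (G : R.-pker measurableTypeR R ~> measurableTypeR R)
    (B : set (grain R d)) : \bar R :=
  (lambda%:E * \int[lebesgue_Rd R d]_x \int[F]_r \int[G r]_w
                 (\1_B (x, r, w) : R)%:E)%E.

(** The weight kernel G_r = dirac at r, which favors large grains. *)
Definition radius_weight (R : realType) :
    R.-pker measurableTypeR R ~> measurableTypeR R :=
  kdirac (@measurable_id _ (measurableTypeR R) setT).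

Section thinned_model.
Context (R : realType) (d : nat).
Variables (dO : measure_display) (Omega : measurableType dO).
Variable P : probability Omega R.
Variable Phi : Omega -> set (grain R d).
Variable lambda : R.
Variable F : probability (measurableTypeR R) R.
Variable G : R.-pker measurableTypeR R ~> measurableTypeR R.
Implicit Types (r s u w : R) (z : Rd R d).

Definition retention (r w : R) : R :=
  let g : grain R d := (origin, r, w) in
  fine (P [set omega | thin (Phi omega `|` [set g]) g]).

Definition mean_retention (r : R) : R := \int[G r]_w retention r w.

(** The reference grains are centered at [origin] and at [u * e1]. They count
    as different grains even when they coincide; two coinciding grains have
    intersecting balls and equal weights, so neither of them is retained, which
    is what [g1 <> g2] encodes. *)
Definition retention2 (u r1 w1 r2 w2 : R) : R :=
  let g1 : grain R d := (origin, r1, w1) in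
  let g2 : grain R d := (scaled_e1 u, r2, w2) in
  fine (P [set omega | [/\ g1 <> g2,
                           thin (Phi omega `|` [set g1; g2]) g1 &
                           thin (Phi omega `|` [set g1; g2]) g2]]).

Definition mean_retention2 (u r1 r2 : R) : R :=
  \int[G r1]_w1 \int[G r2]_w2 retention2 u r1 w1 r2 w2.

Definition retention_cov (u r1 r2 : R) : R :=
  mean_retention2 u r1 r2 - mean_retention r1 * mean_retention r2.

Definition lambda_th : R := lambda * \int[F]_r mean_retention r.

Definition F_th (r : R) : R :=
  1 - lambda / lambda_th * \int[F]_(s in `]r, +oo[) mean_retention s.

Definition tail_th (r : R) : R := 1 - F_th r.

Definition X_th (omega : Omega) : set (Rd R d) := grain_cover (thin (Phi omega)).

Definition covered (z : Rd R d) : set Omega := [set omega | X_th omega z].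

Definition p_th : R := fine (P (covered origin)).

Definition k_th (z : Rd R d) : R :=
  fine (P (covered origin `&` covered z)) -
  fine (P (covered origin)) * fine (P (covered z)).

Definition xi_th (z : Rd R d) : R :=
  lambda ^+ 2 / lambda_th ^+ 2 *
  \int[F]_r1 \int[F]_r2 retention_cov (enorm z) r1 r2.

End thinned_model.

Definition c_alpha (R : realType) (alpha : R) (d : nat) : R :=
  \int[@lebesgue_measure R]_(r in `]0, +oo[)
    (fine (lebesgue_Rd R d (eball origin r `&` eball e1 r)) *
     (alpha * r `^ (- alpha - 1))).

(* Main.v *)
Require Import Defs.
From HB Require Import structures.
From mathcomp Require Import all_boot all_order all_algebra.
From mathcomp Require Import finmap.
From mathcomp Require Import all_classical all_reals all_analysis.
From mathcomp Require Import measurable_realfun.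
From mathcomp Require Import ring lra.

(** Why the theorem holds.

    Since weights equal radii, a grain is removed exactly when a grain of at
    least the same radius meets it. Let [Lam] be the intensity measure, let
    [kills 0 g] be the set of grains that remove [g], and let
    [hprob g = exp (- Lam (kills 0 g))] be the retention probability of [g].
    Everything is compared with [rho u = u ^ d * tail u], which by the
    definition of the slowly varying factor is the decay rate
    [ell u * u ^ (d - alpha)] of the statement.

    Palm calculus. Grains that cover a common point meet each other, so at most
    one of them is retained, and probabilities of covering events are expected
    numbers of retained grains. [P_hits] and [P_hits2] express them as
    integrals: the probability that a retained grain covers o is the integral
    of [hprob] over the grains that cover o, and the probability that two
    different retained grains cover o and y is the double integral of
    [exp (- Lam (kills 0 g1 U kills 0 g2))] over the pairs that do not remove
    each other. The Poisson process being specified by its counts only, these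
    formulas of Mecke type are obtained by discretization ([void_formula]):
    grain space is cut into small cells, within a cell the set of killers is
    replaced by a set depending on the cell alone, independence gives the
    expectation for each cell, and dominated convergence removes the mesh.

    One large grain near two distant points. A grain that comes within a
    bounded distance of both o and z has radius of order |z|. Scaling space by
    u = |z| turns the intensity of such grains into
    [lambda * u ^ d] times the integral over y of the mass that F gives to
    radii above [u * farther y], where [farther y] is the distance from y to
    the farther of o and e1. After division by [tail u] the integrand tends to
    [farther y ^ (- alpha)], under a Potter bound ([potter_bound]) that is
    integrable since alpha > d; and Fubini identifies the integral of the limit
    with [c_alpha] ([c_alphaE]). Hence the intensity is asymptotic to
    [lambda * c * rho u], for every enlargement of the grains by a constant
    ([Lam_lens_cvg], [lens_cvg]).

    Covariance function. With p the volume fraction and S the integral of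
    [hprob] over the grains covering both o and y, [k_thE] is the exact identity
    [k = S * (1 - 2 * p) + S ^ 2 - T + W]. Here W integrates the [gain]
    [hprob g * hprob h * (exp M - 1)] of pairs that do not meet, M being the
    intensity of their common killers, and T integrates [hprob g * hprob h] over
    the pairs that meet although neither grain covers both points. The grains
    covering both points are large, hence retained with probability close to 1,
    so S is equivalent to [lambda * c * rho] ([intersection_cvg]); M has the
    same order for every fixed pair ([overlap_cvg]), so W is equivalent to
    [p ^ 2 * lambda * c * rho] ([gain_over_cvg]); and T is negligible, because
    one of the two grains reaches out to the other point without covering it,
    which is a difference of two lenses of equivalent intensities
    ([intruders_cvg], [collision_cvg]). Altogether
    [k ~ (1 - 2 * p + p ^ 2) * lambda * c * rho].

    Two-point correlation. For grains centered at o and z the retention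
    covariance is the same [gain], minus [hprob g * hprob h] when the grains
    meet ([retention_covE]). Meeting requires a radius of at least |z| / 2,
    which has probability [o (rho |z|)] since d >= 1; the gain contributes
    [lambda * c * rho] times the squared mean of [hprob], and this square
    cancels against the density of the thinned centers.

    Radius distribution. The tail of the thinned radius is
    [lambda / lambda_th] times the integral of [hprob] over larger radii, and
    [hprob] tends to 1 as the radius grows ([retained_tail_cvg]). *)

Set Implicit Arguments.
Unset Strict Implicit.
Unset Printing Implicit Defensive.

Import Order.TTheory GRing.Theory Num.Theory.
Import numFieldNormedType.Exports.

Local Open Scope classical_set_scope.
Local Open Scope ring_scope.

Local Notation edist := Defs.edist.
Local Notation center := Defs.center.
Local Notation radius := Defs.radius.

(** * Euclidean geometry of tuples *)

Section euclid.
Variables (R : realType) (d : nat).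
Implicit Types (x y z : Rd R d) (a r s : R).

Definition tadd x y : Rd R d := [tuple tnth x i + tnth y i | i < d].
Definition topp x : Rd R d := [tuple - tnth x i | i < d].
Definition tscale a x : Rd R d := [tuple a * tnth x i | i < d].
Definition tdot x y : R := \sum_(i < d) tnth x i * tnth y i.

Lemma edistE x y : edist x y = Num.sqrt (tdot (tadd x (topp y)) (tadd x (topp y))).
Proof.
congr (Num.sqrt _); apply: eq_bigr => i _.
by rewrite !tnth_mktuple expr2.
Qed.

Lemma edist_sqr x y : edist x y ^+ 2 = \sum_(i < d) (tnth x i - tnth y i) ^+ 2.
Proof. by rewrite sqr_sqrtr// sumr_ge0// => i _; exact: sqr_ge0. Qed.

Lemma edist_ge0 x y : 0 <= edist x y.
Proof. exact: sqrtr_ge0. Qed.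

Lemma edistC x y : edist x y = edist y x.
Proof.
by congr (Num.sqrt _); apply: eq_bigr => i _; rewrite -sqrrN opprB.
Qed.

Lemma edistxx x : edist x x = 0.
Proof.
by rewrite /edist big1 ?sqrtr0// => i _; rewrite subrr expr0n.
Qed.

Lemma coord_le_edist x y i : `|tnth x i - tnth y i| <= edist x y.
Proof.
rewrite -sqrtr_sqr ler_sqrt ?sumr_ge0// => [|j _]; last exact: sqr_ge0.
by rewrite (bigD1 i)//= lerDl sumr_ge0// => j _; exact: sqr_ge0.
Qed.

Lemma edist_eq0 x y : edist x y <= 0 -> x = y.
Proof.
move=> xy0; apply: eq_from_tnth => i; apply/eqP; rewrite -subr_eq0 -normr_le0.
exact: le_trans (coord_le_edist x y i) xy0.
Qed.

(** Lagrange identity: the defect is half the double sum of the squares of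
    [f i * g j - f j * g i]. *)
Lemma cauchy_schwarz (I : finType) (f g : I -> R) :
  (\sum_i f i * g i) ^+ 2 <= (\sum_i f i ^+ 2) * (\sum_i g i ^+ 2).
Proof.
rewrite -subr_ge0.
have H : 0 <= \sum_i \sum_j (f i * g j - f j * g i) ^+ 2.
  by apply: sumr_ge0 => i _; apply: sumr_ge0 => j _; exact: sqr_ge0.
suff E : \sum_i \sum_j (f i * g j - f j * g i) ^+ 2 =
  (((\sum_i f i ^+ 2) * (\sum_i g i ^+ 2)) - (\sum_i f i * g i) ^+ 2) *+ 2.
  by move: H; rewrite E pmulrn_lge0.
have E1 : \sum_i \sum_j f i ^+ 2 * g j ^+ 2 = (\sum_i f i ^+ 2) * (\sum_i g i ^+ 2).
  by rewrite mulr_suml; apply: eq_bigr => i _; rewrite mulr_sumr.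
have E2 : \sum_i \sum_j (f i * g i) * (f j * g j) = (\sum_i f i * g i) ^+ 2.
  by rewrite expr2 mulr_suml; apply: eq_bigr => i _; rewrite mulr_sumr.
rewrite mulr2n -E1 -E2.
have E3 : \sum_i \sum_j f j ^+ 2 * g i ^+ 2 = \sum_i \sum_j f i ^+ 2 * g j ^+ 2.
  exact: exchange_big.
transitivity (\sum_i \sum_j (f i ^+ 2 * g j ^+ 2 + f j ^+ 2 * g i ^+ 2
   + - ((f i * g i) * (f j * g j) *+ 2))).
  by apply: eq_bigr => i _; apply: eq_bigr => j _; ring.
have -> : \sum_i \sum_j (f i ^+ 2 * g j ^+ 2 + f j ^+ 2 * g i ^+ 2
   + - ((f i * g i) * (f j * g j) *+ 2)) =
  \sum_i \sum_j f i ^+ 2 * g j ^+ 2 + \sum_i \sum_j f j ^+ 2 * g i ^+ 2 +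
  - ((\sum_i \sum_j (f i * g i) * (f j * g j)) *+ 2).
  rewrite -sumrMnl -sumrN -!big_split/=; apply: eq_bigr => i _.
  by rewrite -sumrMnl -sumrN -!big_split.
rewrite E3.
ring.
Qed.

Lemma edist_triangle y x z : edist x z <= edist x y + edist y z.
Proof.
rewrite -(@ler_pXn2r _ 2)// ?nnegrE ?addr_ge0 ?edist_ge0//.
rewrite edist_sqr sqrrD !edist_sqr.
have -> : \sum_(i < d) (tnth x i - tnth z i) ^+ 2 =
   \sum_(i < d) (tnth x i - tnth y i) ^+ 2 +
   (\sum_(i < d) (tnth x i - tnth y i) * (tnth y i - tnth z i)) *+ 2 +
   \sum_(i < d) (tnth y i - tnth z i) ^+ 2.
  rewrite -sumrMnl -!big_split/=; apply: eq_bigr => i _; ring.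
rewrite lerD2r lerD2l lerMn2r/=.
apply: le_trans (ler_norm _) _.
rewrite -(@ler_pXn2r _ 2)// ?nnegrE ?mulr_ge0 ?edist_ge0//.
by rewrite real_normK ?num_real// exprMn !edist_sqr cauchy_schwarz.
Qed.

Lemma edist_le_sum x y : edist x y <= \sum_(i < d) `|tnth x i - tnth y i|.
Proof.
rewrite -(@ler_pXn2r _ 2)// ?nnegrE ?edist_ge0 ?sumr_ge0//.
rewrite edist_sqr expr2 mulr_suml; apply: ler_sum => i _.
rewrite -real_normK ?num_real// expr2 ler_wpM2l//.
by rewrite (bigD1 i)//= lerDl sumr_ge0.
Qed.

Lemma edist_taddr z x y : edist (tadd x z) (tadd y z) = edist x y.
Proof.
congr (Num.sqrt _); apply: eq_bigr => i _; rewrite !tnth_mktuple.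
by congr (_ ^+ 2); ring.
Qed.

Lemma edist_tscale a x y : 0 <= a -> edist (tscale a x) (tscale a y) = a * edist x y.
Proof.
move=> a0; rewrite -[in RHS](ger0_norm a0) -sqrtr_sqr -sqrtrM ?sqr_ge0// mulr_sumr.
congr (Num.sqrt _); apply: eq_bigr => i _; rewrite !tnth_mktuple -exprMn.
by congr (_ ^+ 2); ring.
Qed.

Lemma tadd0 x : tadd x origin = x.
Proof. by apply: eq_from_tnth => i; rewrite !tnth_mktuple addr0. Qed.

Lemma taddC x y : tadd x y = tadd y x.
Proof. by apply: eq_from_tnth => i; rewrite !tnth_mktuple addrC. Qed.

Lemma taddK x y : tadd (tadd x y) (topp y) = x.
Proof. by apply: eq_from_tnth => i; rewrite !tnth_mktuple addrK. Qed.

Lemma toppK x : topp (topp x) = x.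
Proof. by apply: eq_from_tnth => i; rewrite !tnth_mktuple opprK. Qed.

Lemma tscale0 x : tscale 0 x = origin.
Proof. by apply: eq_from_tnth => i; rewrite !tnth_mktuple mul0r. Qed.

Lemma tscaler0 a : tscale a origin = origin :> Rd R d.
Proof. by apply: eq_from_tnth => i; rewrite !tnth_mktuple mulr0. Qed.

Lemma enormE x : enorm x = edist x origin. Proof. by []. Qed.

Lemma enorm_topp x : enorm (topp x) = enorm x.
Proof.
congr (Num.sqrt _); apply: eq_bigr => i _; rewrite !tnth_mktuple.
by rewrite !subr0 sqrrN.
Qed.

Lemma edist_enorm x y : edist x y = enorm (tadd x (topp y)).
Proof.
rewrite /enorm -(edist_taddr (topp y) x y).
by congr edist; apply: eq_from_tnth => i; rewrite !tnth_mktuple subrr.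
Qed.

(** The point dividing the segment from [x] to [y] in the ratio [r : s] lies
    in both balls; the degenerate case [r + s = 0] forces [x = y]. *)
Lemma eball_meet x y r s : 0 <= r -> 0 <= s -> edist x y <= r + s ->
  eball x r `&` eball y s !=set0.
Proof.
move=> r0 s0 xy.
have [rs0|rs0] := eqVneq (r + s) 0.
  have /eqP := rs0; rewrite paddr_eq0// => /andP[/eqP r00 /eqP s00].
  exists x; rewrite /eball /= edistxx; split => //.
  by rewrite s00 edistC -rs0.
have rsp : 0 < r + s by rewrite lt_neqAle eq_sym rs0 addr_ge0.
pose t := r / (r + s).
have t0 : 0 <= t by rewrite divr_ge0// ltW.
have t1 : 0 <= 1 - t.
  by rewrite subr_ge0 ler_pdivrMr// mul1r lerDl.
pose w := tadd (tscale (1 - t) x) (tscale t y).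
have Ew1 : edist x w = t * edist x y.
  rewrite -(edist_tscale _ _ t0) -(edist_taddr (tscale (1 - t) x) (tscale t x)).
  congr edist; last exact: taddC.
  by apply: eq_from_tnth => i; rewrite !tnth_mktuple; ring.
have Ew2 : edist y w = (1 - t) * edist x y.
  rewrite edistC -(edist_tscale _ _ t1) -(edist_taddr (tscale t y) _ (tscale (1 - t) y)).
  congr edist.
  by apply: eq_from_tnth => i; rewrite !tnth_mktuple; ring.
exists w; split; rewrite /eball /= ?Ew1 ?Ew2.
  rewrite (le_trans (ler_wpM2l t0 xy))// /t -mulrA mulVf// mulr1//.
rewrite (le_trans (ler_wpM2l t1 xy))// /t mulrBl mul1r -mulrA mulVf// mulr1.
by rewrite [r + s]addrC addrK.
Qed.

Lemma eball_meetP x y r s : eball x r `&` eball y s !=set0 <->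
  [/\ 0 <= r, 0 <= s & edist x y <= r + s].
Proof.
split=> [[w [xw yw]]|[r0 s0 xy]]; last exact: eball_meet.
split; [exact: le_trans (edist_ge0 _ _) xw|exact: le_trans (edist_ge0 _ _) yw|].
by rewrite (le_trans (edist_triangle w _ _))// lerD// edistC.
Qed.

(** Reflection in the hyperplane orthogonal to [v]; for [v = 0] the
    convention [0^-1 = 0] makes it the identity, so that the lemmas below
    hold without a condition on [v]. *)
Definition householder (v x : Rd R d) : Rd R d :=
  tadd x (tscale (- (2 * tdot x v / tdot v v)) v).

Lemma tdot_eq0 v : tdot v v = 0 -> v = origin.
Proof.
move/eqP; rewrite psumr_eq0 => [/allP v0|i _]; last by rewrite -expr2 sqr_ge0.
apply: eq_from_tnth => i; have /eqP := v0 i (mem_index_enum _).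
by move/eqP; rewrite -expr2 sqrf_eq0 tnth_mktuple => /eqP.
Qed.

Lemma tdotC x y : tdot x y = tdot y x.
Proof. by apply: eq_bigr => i _; rewrite mulrC. Qed.

Lemma tdotDl x y z : tdot (tadd x y) z = tdot x z + tdot y z.
Proof.
by rewrite -big_split/=; apply: eq_bigr => i _; rewrite !tnth_mktuple mulrDl.
Qed.

Lemma tdotZl a x y : tdot (tscale a x) y = a * tdot x y.
Proof. by rewrite mulr_sumr; apply: eq_bigr => i _; rewrite !tnth_mktuple mulrA. Qed.

Lemma tdotNl x y : tdot (topp x) y = - tdot x y.
Proof. by rewrite -sumrN; apply: eq_bigr => i _; rewrite !tnth_mktuple mulNr. Qed.

Lemma householder_add v x y : householder v (tadd x y) = tadd (householder v x) (householder v y).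
Proof.
by apply: eq_from_tnth => i; rewrite !tnth_mktuple tdotDl; ring.
Qed.

Lemma householder_opp v x : householder v (topp x) = topp (householder v x).
Proof.
by apply: eq_from_tnth => i; rewrite !tnth_mktuple tdotNl; ring.
Qed.

Lemma householder_dot v x : tdot (householder v x) (householder v x) = tdot x x.
Proof.
have [v0|v0] := eqVneq (tdot v v) 0.
  congr tdot; rewrite /householder v0 invr0 mulr0 oppr0 tscale0 tadd0//.
rewrite /householder tdotDl tdotZl tdotC tdotDl tdotZl [tdot v (tadd _ _)]tdotC.
rewrite tdotDl tdotZl [tdot v x]tdotC.
by field.
Qed.

Lemma edist_householder v x y :
  edist (householder v x) (householder v y) = edist x y.
Proof.
by rewrite !edistE -householder_opp -householder_add householder_dot.
Qed.

Lemma householderK v : involutive (householder v).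
Proof.
move=> x; apply: eq_from_tnth => i.
have [v0|v0] := eqVneq (tdot v v) 0.
  by rewrite !tnth_mktuple v0 invr0 !mulr0 oppr0 !mul0r !addr0.
rewrite !tnth_mktuple tdotDl tdotZl.
by field.
Qed.

Lemma householder_origin v : householder v origin = origin.
Proof.
apply: eq_from_tnth => i; rewrite !tnth_mktuple /tdot big1 => [|j _].
  by rewrite mulr0 !mul0r oppr0 mul0r addr0.
by rewrite tnth_mktuple mul0r.
Qed.

Lemma enorm_tdot z : enorm z ^+ 2 = tdot z z.
Proof.
rewrite edist_sqr; apply: eq_bigr => i _.
by rewrite tnth_mktuple subr0 expr2.
Qed.

(** The mirror is the perpendicular bisector of [x] and [y]. Invariance
    under reflections thus does the work of rotation invariance: it moves
    any direction onto [e1]. *)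
Lemma householder_swap x y : enorm x = enorm y ->
  householder (tadd x (topp y)) x = y.
Proof.
move=> xy; have xy2 : tdot x x = tdot y y by rewrite -!enorm_tdot xy.
apply: eq_from_tnth => i; rewrite !tnth_mktuple.
set v := tadd x (topp y).
have [v0|v0] := eqVneq (tdot v v) 0.
  rewrite v0 invr0 mulr0 oppr0 mul0r addr0.
  have := tdot_eq0 v0 => /(congr1 (fun t => tnth t i)); rewrite !tnth_mktuple.
  by move/eqP; rewrite subr_eq0 => /eqP.
have E : tdot v v = 2 * tdot x v.
  rewrite /v tdotDl tdotNl ![tdot _ (tadd _ _)]tdotC !tdotDl !tdotNl -xy2 [tdot y x]tdotC.
  ring.
rewrite -E divff//; ring.
Qed.

Lemma scaled_e1E a : scaled_e1 a = tscale a e1 :> Rd R d.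
Proof. by []. Qed.

Lemma enorm_e1 : (1 <= d)%N -> enorm (e1 : Rd R d) = 1.
Proof.
move=> d1; rewrite /enorm /edist (bigD1 (Ordinal d1))//= big1 => [|i i0].
  by rewrite !tnth_mktuple eqxx subr0 expr1n addr0 sqrtr1.
rewrite !tnth_mktuple subr0; case: eqP => [i00|_]; last by rewrite expr0n.
by move: i0 => /eqP []; apply: val_inj.
Qed.

Lemma enorm_tscale a x : 0 <= a -> enorm (tscale a x) = a * enorm x.
Proof. by move=> a0; rewrite /enorm -{1}(tscaler0 a) edist_tscale. Qed.

End euclid.

(** * Lebesgue measure on tuples and its invariance *)

Lemma measurable_setP d1 d2 (T1 : measurableType d1) (T2 : measurableType d2)
    (f : T1 -> T2) (B : set T2) :
  measurable_fun setT f -> measurable B -> measurable [set x | B (f x)].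
Proof. by move=> mf mB; rewrite -[X in measurable X]setTI; exact: mf. Qed.

Section measurable_euclid.
Context (R : realType) (d : nat) (d0 : measure_display) (T : measurableType d0).
Local Notation mR := (measurableTypeR R).

Lemma measurable_tnth_comp (f : T -> Rd R d) i :
  measurable_fun setT f -> measurable_fun setT (fun x => tnth (f x) i : mR).
Proof. by move=> mf; apply: (measurableT_comp (measurable_tnth i)). Qed.

Lemma measurable_edist (f g : T -> Rd R d) :
  measurable_fun setT f -> measurable_fun setT g ->
  measurable_fun setT (fun x => edist (f x) (g x) : mR).
Proof.
move=> mf mg; apply: (@measurableT_comp _ _ _ _ _ _ (Num.sqrt : mR -> mR)).
  by apply: continuous_measurable_fun; exact: sqrt_continuous.
apply: measurable_sum => i; apply: measurable_funX.
by apply: measurable_funB; exact: measurable_tnth_comp.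
Qed.

Lemma measurable_mktuple (f : T -> 'I_d -> mR) :
  (forall i, measurable_fun setT (f ^~ i)) ->
  measurable_fun setT (fun x => [tuple f x i | i < d] : Rd R d).
Proof.
move=> mf; apply/measurable_fun_tnthP => i.
by rewrite (_ : _ \o _ = f ^~ i)//; apply/funext => x /=; rewrite tnth_mktuple.
Qed.

Lemma measurable_le_set (f g : T -> mR) :
  measurable_fun setT f -> measurable_fun setT g ->
  measurable [set x | f x <= g x].
Proof.
move=> mf mg; rewrite -[X in measurable X]setTI.
rewrite (_ : [set x | _] = (fun x => f x <= g x) @^-1` [set true]).
  exact: (measurable_fun_ler mf mg).
by apply/seteqP; split => x.
Qed.

Lemma measurable_lt_set (f g : T -> mR) :
  measurable_fun setT f -> measurable_fun setT g ->
  measurable [set x | f x < g x].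
Proof.
move=> mf mg; rewrite -[X in measurable X]setTI.
rewrite (_ : [set x | _] = (fun x => f x < g x) @^-1` [set true]).
  exact: (measurable_fun_ltr mf mg).
by apply/seteqP; split => x.
Qed.

End measurable_euclid.

Definition image_measure d1 d2 (T1 : measurableType d1) (T2 : measurableType d2)
  (R : realType) (m : {measure set T1 -> \bar R}) (f : T1 -> T2)
  (mf : measurable_fun setT f) : {measure set T2 -> \bar R} :=
  measure_function_pushforward__canonical__measure_function_Measure m mf.

Section lebesgue_Rd_theory.
Context (R : realType) (d : nat).
Local Notation mR := (measurableTypeR R).
Local Notation leb := (lebesgue_Rd R d).
Implicit Types (x y z b : Rd R d) (a r : R).

Lemma measurable_eball x r : measurable (eball x r).
Proof.
apply: measurable_le_set => //; apply: measurable_edist => //.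
Qed.

Definition box (A : 'I_d -> set mR) : set (Rd R d) :=
  [set x | forall i, A i (tnth x i)].

Lemma measurable_box A : (forall i, measurable (A i)) -> measurable (box A).
Proof.
move=> mA; rewrite (_ : box A = \bigcap_(i in [set: 'I_d]) ((@tnth _ _ ^~ i) @^-1` (A i))).
  apply: fin_bigcap_measurable => // i _.
  by rewrite -[X in measurable X]setTI; exact: measurable_tnth.
by apply/seteqP; split => x /= H i; [move=> _|]; exact: H.
Qed.

Let boxes : set (set (Rd R d)) := [set box A | A in [set A | forall i, measurable (A i)]].

Lemma measurable_boxes : @measurable _ (Rd R d) = <<s boxes >>.
Proof.
apply/seteqP; split; last first.
  apply: smallest_sub; first exact: sigma_algebra_measurable.
  by move=> _ [A mA <-]; exact: measurable_box.
apply: smallest_sub; first exact: smallest_sigma_algebra.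
move=> X /=; rewrite -bigcup_seq /= => -[i _ [A mA <-]].
apply: sub_sigma_algebra; exists (fun j => if j == i then A else setT).
  by move=> j /=; case: ifP.
rewrite setTI; apply/seteqP; split => x /= H; first by have := H i; rewrite eqxx.
by move=> j; case: eqP => [->|].
Qed.

Lemma leb_box A : (forall i, measurable (A i)) ->
  leb (box A) = (\prod_(i < d) lebesgue_measure (A i))%E.
Proof. exact: lebesgue_Rd_box. Qed.

Lemma prodEFin (I : Type) (s : seq I) (f : I -> R) :
  (\prod_(i <- s) (f i)%:E)%E = (\prod_(i <- s) f i)%:E.
Proof. by elim/big_rec2 : _ => // i x y _ ->; rewrite EFinM. Qed.

Lemma lebesgue_cube r : 0 <= r ->
  leb (box (fun=> `[- r, r]%classic)) = ((r *+ 2) ^+ d)%:E.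
Proof.
move=> r0; rewrite leb_box//.
rewrite (eq_bigr (fun=> (r *+ 2)%:E)) => [|i _].
  by rewrite prodEFin prodr_const card_ord.
rewrite lebesgue_measure_itv/= lte_fin; case: ifPn => [_|].
  by rewrite -EFinD opprK mulr2n.
rewrite -leNgt => rr; have -> : r = 0 by apply/eqP; rewrite eq_le r0 andbT; lra.
by rewrite mul0rn.
Qed.

(** Boxes form a generating pi-system and the cubes with half side [k]
    exhaust the space with finite measure. *)
Lemma lebesgue_Rd_unique (m : {measure set (Rd R d) -> \bar R}) :
  (forall A, (forall i, measurable (A i)) ->
     m (box A) = (\prod_(i < d) lebesgue_measure (A i))%E) ->
  forall B, measurable B -> m B = leb B.
Proof.
move=> mE B mB; apply/esym.
pose g (k : nat) := box (fun=> `[- k%:R, k%:R]%classic).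
apply: (measure_unique boxes g) => //.
- exact: measurable_boxes.
- move=> _ _ [A mA <-] [A' mA' <-]; exists (fun i => A i `&` A' i).
    by move=> i; exact: measurableI.
  apply/seteqP; split => x /=; first by move=> H; split => i; have [] := H i.
  by move=> [H1 H2] i; split.
- by move=> k; exists (fun=> `[- k%:R, k%:R]%classic).
- rewrite -subTset => x _.
  exists (Num.truncn (\sum_(i < d) `|tnth x i|)).+1 => // i /=.
  rewrite in_itv/= -ler_norml (le_trans _ (ltW (truncnS_gt _)))//.
  by rewrite (bigD1 i)//= lerDl sumr_ge0.
- by move=> _ [A mA <-]; rewrite mE//; exact: lebesgue_Rd_box.
- by move=> k; rewrite [X in (X < _)%E](lebesgue_cube (ler0n R k)) ltry.
Qed.

(** Comparison on half-open intervals determines the measure. *)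
Lemma lebesgue_affine a (b : R) (A : set mR) : 0 < a -> measurable A ->
  (a%:E * lebesgue_measure [set t | A (a * t + b)%R])%E = lebesgue_measure A.
Proof.
move=> a0 mA.
have mf : measurable_fun setT (fun t : mR => a * t + b : mR).
  by apply: measurable_funD => //; exact: measurable_funM.
pose ma : {nonneg R} := NngNum (ltW a0).
pose m := mscale ma (image_measure (@lebesgue_measure R) mf).
apply/esym.
apply: (lebesgue_measure_unique (mu := m)) => // _ [[u v]] _ <- /=.
rewrite /m /mscale /= /pushforward.
rewrite (_ : _ @^-1` _ = `]((u - b) / a), ((v - b) / a)]%classic); last first.
  apply/seteqP; split => t /=; rewrite !in_itv/= ltr_pdivrMr// ler_pdivlMr//;
    by rewrite ltrBlDr lerBrDr [t * a]mulrC.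
rewrite !lebesgue_measure_itv/= !lte_fin ltr_pdivrMr// mulfVK ?gt_eqF// ltrD2r.
case: ifP => _; last by rewrite mule0.
rewrite -!EFinD -EFinM; congr EFin.
by field; rewrite gt_eqF.
Qed.

Lemma lebesgue_Rd_affine a b B : 0 < a -> measurable B ->
  ((a ^+ d)%:E * leb [set x | B (tadd (tscale a x) b)])%E = leb B.
Proof.
move=> a0 mB.
have mf : measurable_fun setT (fun x : Rd R d => tadd (tscale a x) b).
  apply: measurable_mktuple => i.
  rewrite (_ : (fun x : Rd R d => _) = (fun x => a * tnth x i + tnth b i)).
    apply: measurable_funD => //; apply: measurable_funM => //.
    exact: measurable_tnth.
  by apply/funext => x; rewrite tnth_mktuple.
have ad0 : 0 <= a ^+ d by rewrite exprn_ge0// ltW.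
pose ma : {nonneg R} := NngNum ad0.
pose m := mscale ma (image_measure leb mf).
apply: (lebesgue_Rd_unique (m := m)) => // A mA.
rewrite -[LHS]/((a ^+ d)%:E * leb ((fun x : Rd R d => tadd (tscale a x) b) @^-1` box A))%E.
rewrite (_ : _ @^-1` _ = box (fun i => [set t | A i (a * t + tnth b i)])); last first.
  apply/seteqP; split => x /= H i; have := H i;
    by rewrite /= !tnth_mktuple.
rewrite leb_box => [|i]; last first.
  rewrite -[X in measurable X]setTI.
  suff : measurable_fun setT (fun t : mR => a * t + tnth b i : mR) by exact.
  by apply: measurable_funD => //; exact: measurable_funM.
rewrite (_ : (a ^+ d)%:E = \prod_(i < d) a%:E)%E; last first.
  by rewrite prodEFin prodr_const card_ord.
rewrite -big_split/=; apply: eq_bigr => i _.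
exact: lebesgue_affine.
Qed.

Lemma lebesgue_Rd_translate b B : measurable B ->
  leb [set x | B (tadd x b)] = leb B.
Proof.
move=> mB; rewrite -[RHS](lebesgue_Rd_affine b ltr01 mB) expr1n mul1e.
congr (leb _); apply/seteqP; split => x /=; congr B;
  by apply: eq_from_tnth => i; rewrite !tnth_mktuple mul1r.
Qed.

Lemma eball_sub_box r : eball origin r `<=` box (fun=> `[- r, r]%classic).
Proof.
move=> x xr i /=; rewrite in_itv/= -ler_norml.
have := coord_le_edist x origin i; rewrite tnth_mktuple subr0 => /le_trans; apply.
by rewrite edistC; exact: xr.
Qed.

Lemma leb_eball x r : leb (eball x r) = leb (eball origin r).
Proof.
rewrite -(lebesgue_Rd_translate x (measurable_eball x r)); congr (leb _).
apply/seteqP; split => y; rewrite /eball /=.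
  by rewrite -{1}(tadd0 x) (taddC x) edist_taddr.
by rewrite -(edist_taddr x) (taddC origin) tadd0.
Qed.

Lemma leb_eball_le x r : 0 <= r -> (leb (eball x r) <= ((r *+ 2) ^+ d)%:E)%E.
Proof.
move=> r0; rewrite leb_eball -lebesgue_cube//.
apply: le_measure; rewrite ?inE; [exact: measurable_eball|by apply: measurable_box|].
exact: eball_sub_box.
Qed.

Lemma leb_eball_lty x r : (leb (eball x r) < +oo)%E.
Proof.
have [r0|r0] := leP 0 r; first exact: le_lt_trans (leb_eball_le x r0) (ltry _).
rewrite (_ : eball x r = set0) ?measure0// -subset0 => y.
rewrite /eball /= => yr; have := lt_le_trans (le_lt_trans yr r0) (edist_ge0 x y).
by rewrite ltxx.
Qed.

Lemma leb_eball_gt0 x r : 0 < r -> (0 < leb (eball x r))%E.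
Proof.
move=> r0; rewrite leb_eball.
pose s := r / d.+1%:R; have s0 : 0 < s by rewrite divr_gt0.
apply: (@lt_le_trans _ _ ((s *+ 2) ^+ d)%:E).
  by rewrite lte_fin exprn_gt0// pmulrn_lgt0.
rewrite -lebesgue_cube; last exact: ltW.
apply: le_measure; rewrite ?inE; [by apply: measurable_box|exact: measurable_eball|].
move=> y ys; rewrite /eball /=; rewrite (le_trans (edist_le_sum _ _))//.
apply: (@le_trans _ _ (\sum_(i < d) s)).
  apply: ler_sum => i _; rewrite tnth_mktuple add0r normrN ler_norml.
  by have := ys i; rewrite /= in_itv.
rewrite sumr_const card_ord /s -[_ *+ d]mulr_natr -mulrA ger_pMr//.
by rewrite ler_pdivrMl// mulr1 ler_nat.
Qed.

Lemma leb_set1 x : (1 <= d)%N -> leb [set x] = 0%E.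
Proof.
move=> d1; rewrite (_ : [set x] = box (fun i => [set tnth x i])).
  rewrite leb_box => [|i]; last exact: measurable_set1.
  by rewrite (bigD1 (Ordinal d1))//= lebesgue_measure_set1 mul0e.
apply/seteqP; split => [_ -> //|y /= xy].
by apply: eq_from_tnth => i; exact: xy.
Qed.

Lemma measurable_set1_Rd x : measurable [set x].
Proof.
rewrite (_ : [set x] = box (fun i => [set tnth x i])).
  by apply: measurable_box => i; exact: measurable_set1.
apply/seteqP; split => [_ -> //|y /= xy].
by apply: eq_from_tnth => i; exact: xy.
Qed.

End lebesgue_Rd_theory.

Section measurable_ops.
Context (R : realType) (d : nat) (d0 : measure_display) (T : measurableType d0).
Local Notation mR := (measurableTypeR R).

Lemma measurable_tadd (f g : T -> Rd R d) :
  measurable_fun setT f -> measurable_fun setT g ->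
  measurable_fun setT (fun x => tadd (f x) (g x)).
Proof.
move=> mf mg; apply: measurable_mktuple => i.
by apply: measurable_funD; exact: measurable_tnth_comp.
Qed.

Lemma measurable_tscale (a : T -> mR) (f : T -> Rd R d) :
  measurable_fun setT a -> measurable_fun setT f ->
  measurable_fun setT (fun x => tscale (a x) (f x)).
Proof.
move=> ma mf; apply: measurable_mktuple => i.
by apply: measurable_funM => //; exact: measurable_tnth_comp.
Qed.

Lemma measurable_topp (f : T -> Rd R d) :
  measurable_fun setT f -> measurable_fun setT (fun x => topp (f x)).
Proof.
move=> mf; apply: measurable_mktuple => i; apply: measurable_funN.
exact: measurable_tnth_comp.
Qed.

Lemma measurable_householder v (f : T -> Rd R d) :
  measurable_fun setT f -> measurable_fun setT (fun x => householder v (f x)).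
Proof.
move=> mf; apply: measurable_tadd => //; apply: measurable_tscale => //.
apply: measurable_funN; apply: measurable_funM => //.
apply: measurable_funM => //; apply: measurable_sum => i.
by apply: measurable_funM => //; exact: measurable_tnth_comp.
Qed.

End measurable_ops.

Lemma integral_indic_setT d (T : measurableType d) (R : realType)
  (m : {measure set T -> \bar R}) A : measurable A ->
  (\int[m]_x (\1_A x)%:E = m A)%E.
Proof. by move=> mA; rewrite integral_indic// setIT. Qed.

Section fubini_sets.
Context d1 d2 (T1 : measurableType d1) (T2 : measurableType d2) (R : realType).

Lemma fubini_sets (m1 : {sigma_finite_measure set T1 -> \bar R})
    (m2 : {sigma_finite_measure set T2 -> \bar R}) (E : set (T1 * T2)) :
  measurable E ->
  (\int[m1]_x m2 [set y | E (x, y)] = \int[m2]_y m1 [set x | E (x, y)])%E.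
Proof.
move=> mE; have := @fubini_tonelli _ _ _ _ R m1 m2 (fun p => (\1_E p : R)%:E).
move=> /= H.
have mx x : measurable [set y | E (x, y)] by exact: (measurable_setP (pair1_measurable x) mE).
have my y : measurable [set x | E (x, y)] by exact: (measurable_setP (pair2_measurable y) mE).
transitivity (\int[m1]_x \int[m2]_y (\1_E (x, y) : R)%:E)%E.
  by apply: eq_integral => x _; apply/esym; exact: (integral_indic_setT m2 (mx x)).
rewrite H//.
  by apply: eq_integral => y _; exact: (integral_indic_setT m1 (my y)).
by apply/measurable_EFinP; exact: measurable_indic.
Qed.
End fubini_sets.

(** Uniqueness of translation invariant measures, specialized to the image
    [m] of Lebesgue measure [leb] under a reflection. For the unit ball [A],
    Fubini applied to the pairs [(x, y)] with [x] in [B] and [x - y] in [A]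
    gives [m B * leb A = leb B * m A], after substituting [x + y] for [x] by
    translation invariance of [m]; and [m A = leb A] since a reflection
    preserves the ball. *)
Section rotation.
Context (R : realType) (d : nat) (v : Rd R d).
Local Notation leb := (lebesgue_Rd R d).
Local Notation H := (householder v).

Let mH : measurable_fun setT H.
Proof. by apply: measurable_householder; exact: measurable_id. Qed.

Definition refl_measure : set (Rd R d) -> \bar R := image_measure leb mH.
HB.instance Definition _ := Measure.on refl_measure.

Let refl_ball r : refl_measure (eball origin r) = leb (eball origin r).
Proof.
rewrite -[LHS]/(leb (H @^-1` eball origin r)); congr (leb _).
have E x : edist origin (H x) = edist origin x.
  by rewrite -[in LHS](householder_origin v) edist_householder.
by apply/seteqP; split => x; rewrite /eball /= E.
Qed.

Let refl_sigma_finite : sigma_finite [set: Rd R d] refl_measure.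
Proof.
exists (fun k => eball origin k%:R).
  apply/esym; rewrite -subTset => x _.
  exists (Num.truncn (edist origin x)).+1 => //.
  by rewrite /eball /= ltW// truncnS_gt.
move=> k; split; first exact: measurable_eball.
by rewrite refl_ball; exact: leb_eball_lty.
Qed.
HB.instance Definition _ := Measure_isSigmaFinite.Build _ _ _ refl_measure
  refl_sigma_finite.

Let refl_translate b B : measurable B ->
  refl_measure [set x | B (tadd x b)] = refl_measure B.
Proof.
move=> mB.
rewrite -[LHS]/(leb [set x | B (tadd (H x) b)]) -[RHS]/(leb [set x | B (H x)]).
rewrite -[RHS](lebesgue_Rd_translate (H b)); last exact: measurable_setP.
congr (leb _); apply/seteqP; split => x /=;
  by rewrite householder_add householderK.
Qed.

Lemma leb_householder B : measurable B -> leb [set x | B (H x)] = leb B.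
Proof.
move=> mB; rewrite -[LHS]/(refl_measure B).
pose A := eball (origin : Rd R d) 1.
have mA : measurable A by exact: measurable_eball.
pose E1 : set (Rd R d * Rd R d) := [set p | A p.1 /\ B (tadd p.2 p.1)].
pose E2 : set (Rd R d * Rd R d) := [set p | A (tadd p.1 (topp p.2)) /\ B p.1].
have mE1 : measurable E1.
  apply: measurableI; first exact: measurable_setP.
  by apply: measurable_setP => //; apply: measurable_tadd.
have mE2 : measurable E2.
  apply: measurableI; last exact: measurable_setP.
  by apply: measurable_setP => //; apply: measurable_tadd => //; exact: measurable_topp.
suff : (refl_measure B * leb A = leb B * leb A)%E.
  have Af : leb A \is a fin_num.
    by rewrite ge0_fin_numE//; exact: leb_eball_lty.
  have A0 : fine (leb A) != 0.
    by rewrite gt_eqF// fine_gt0// leb_eball_gt0//= leb_eball_lty.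
  rewrite -(fineK Af) => /(congr1 (fun t => t * (fine (leb A))^-1%:E)%E).
  by rewrite -!muleA -!EFinM divff// !mule1.
transitivity (\int[refl_measure]_x leb [set y | E2 (x, y)])%E.
  rewrite -(@integral_indic_setT _ _ _ refl_measure)//.
  rewrite -ge0_integralZr//.
  - apply: eq_integral => x _; rewrite indicE.
    have [xB|xB] := pselect (B x).
      rewrite mem_set// mul1e -(leb_eball x 1); congr (leb _).
      have Exy y : edist origin (tadd x (topp y)) = edist x y.
        by rewrite edistC -enormE -edist_enorm.
      by apply/seteqP; split => y; rewrite /E2 /A /eball /= Exy // => -[].
    rewrite memNset//= mul0e (_ : [set y | _] = set0) ?measure0//.
    by rewrite -subset0 => y [].
  - by apply/measurable_EFinP; exact: measurable_indic.
rewrite fubini_sets//.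
transitivity (\int[leb]_y refl_measure [set x | E1 (x, y)])%E.
  apply: eq_integral => y _.
  have mS : measurable [set x | E2 (x, y)].
    exact: (measurable_setP (pair2_measurable y) mE2).
  rewrite -[LHS](refl_translate y mS).
  by congr (refl_measure _); apply/seteqP; split => x /=;
    rewrite /E1 /E2 /= taddK taddC.
rewrite -fubini_sets// -refl_ball.
rewrite -(@integral_indic_setT _ _ _ refl_measure)//.
rewrite -ge0_integralZl//.
- apply: eq_integral => x _; rewrite indicE.
  have [xA|xA] := pselect (A x).
    rewrite mem_set// mule1 -(lebesgue_Rd_translate x mB); congr (leb _).
    by apply/seteqP; split => y //= -[].
  rewrite memNset//= mule0 (_ : [set y | _] = set0) ?measure0//.
  by rewrite -subset0 => y [].
- by apply/measurable_EFinP; exact: measurable_indic.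
Qed.
End rotation.

(** * The constant c_alpha as an integral over space *)

Section powers.
Variable R : realType.
Implicit Types a b t : R.

Lemma powR_cvgy b : 0 < b -> t `^ (- b) @[t --> +oo] --> (0 : R).
Proof.
move=> b0; apply/cvgrPdist_lt => e e0; near=> t.
have t0 : 0 < t by near: t; exact: nbhs_pinfty_gt.
rewrite sub0r normrN ger0_norm ?powR_ge0// powRN invf_plt ?posrE ?powR_gt0//.
have -> : e^-1 = (e^-1 `^ b^-1) `^ b.
  by rewrite -powRrM mulVf ?gt_eqF// powRr1// invr_ge0 ltW.
rewrite gt0_ltr_powR ?nnegrE ?powR_ge0 ?(ltW t0)//.
Unshelve. all: by end_near. Qed.

Lemma integral_powR_tail b t : 0 < b -> 0 < t ->
  (\int[lebesgue_measure]_(r in `[t, +oo[) (b * r `^ (- b - 1))%:E = (t `^ (- b))%:E)%E.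
Proof.
move=> b0 t0.
have tpos r : t <= r -> r \in `]0, +oo[ by move=> tr; rewrite in_itv/= andbT (lt_le_trans t0).
rewrite (@ge0_continuous_FTC2y _ _ (fun r => - r `^ (- b)) _ 0).
- by rewrite -EFinD opprK add0r.
- by move=> r tr; rewrite mulr_ge0 ?powR_ge0// ltW.
- apply: derivable_within_continuous => r; rewrite in_itv/= andbT => tr.
  apply: derivableM => //; apply: derivable_powR; exact: tpos.
- by rewrite -oppr0; apply: cvgN; exact: powR_cvgy.
- move=> r tr; apply: derivableN; apply: derivable_powR; apply: tpos; exact: ltW.
- apply: cvgN; apply: cvg_at_right_filter.
  suff : {for t, continuous (@powR R ^~ (- b))} by [].
  apply: differentiable_continuous; apply/derivable1_diffP.
  by apply: derivable_powR; exact: tpos.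
- move=> r; rewrite in_itv/= andbT => tr.
  have rp : r \in `]0, +oo[ by apply: tpos; exact: ltW.
  rewrite derive1E deriveN; last exact: derivable_powR.
  by rewrite -derive1E (powR_derive1 _ rp) mulNr opprK.
Qed.

Lemma powR_anti b s t : 0 <= b -> 0 < s -> s <= t -> t `^ (- b) <= s `^ (- b).
Proof.
move=> b0 s0 st; rewrite !powRN lef_pV2 ?posrE ?powR_gt0 ?(lt_le_trans s0 st)//.
by rewrite ge0_ler_powR ?nnegrE ?(ltW s0)// (le_trans (ltW s0) st).
Qed.

(** Dyadic localization, used both for the integrability of [gauge] and for
    the Potter bound. *)
Lemma pow2_ge t : 1 <= t -> exists k, 2 ^+ k <= t < 2 ^+ k.+1.
Proof.
move=> t1.
have [n tn] : exists n, t < 2 ^+ n.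
  exists (Num.truncn t).+1; apply: lt_le_trans (truncnS_gt _) _.
  rewrite -natrX ler_nat; apply: ltnW; exact: ltn_expl.
elim: n tn => [|n IH] tn; first by move: (le_lt_trans t1 tn); rewrite expr0 ltxx.
have [/IH//|nt] := ltP t (2 ^+ n).
by exists n; rewrite nt tn.
Qed.

End powers.

Section gauge.
Context (R : realType) (d : nat).
Local Notation mR := (measurableTypeR R).
Local Notation leb := (lebesgue_Rd R d).

(** Integrable majorant in the scaled variable; the Potter bound will
    produce the exponent [b], with [d < b < alpha]. *)
Definition gauge (b : R) (y : Rd R d) : R := (1 + edist origin y) `^ (- b).

Lemma gauge_ge0 b y : 0 <= gauge b y.
Proof. exact: powR_ge0. Qed.

Lemma measurable_edist1 x : measurable_fun setT (fun y : Rd R d => edist x y : mR).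
Proof. by apply: measurable_edist => //; exact: measurable_id. Qed.

Lemma measurable_powR_comp d0 (T : measurableType d0) (f : T -> mR) (b : R) :
  measurable_fun setT f -> measurable_fun setT (fun x => f x `^ b : mR).
Proof. by move=> mf; apply: (measurableT_comp (measurable_powR b) mf). Qed.

Lemma measurable_gauge b : measurable_fun setT (gauge b : _ -> mR).
Proof.
apply: measurable_powR_comp; apply: measurable_funD => //.
exact: measurable_edist1.
Qed.

(** On the dyadic shell where [1 + |y|] lies between [2 ^ k] and [2 ^ k.+1],
    the gauge is at most [2 ^ (- b * k)] and the volume is of order [2 ^ (d
    * k)]; the resulting geometric series converges for [b > d]. *)
Lemma integral_gauge_lty (b : R) : d%:R < b ->
  (\int[leb]_y (gauge b y)%:E < +oo)%E.
Proof.
move=> db; have b0 : 0 < b by rewrite (le_lt_trans _ db).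
(* [q ^ k] bounds the gauge on the shell number [k] *)
pose q : R := 2 `^ (- b).
have q0 : 0 <= q by exact: powR_ge0.
pose f (k : nat) (y : Rd R d) : \bar R :=
  ((q ^+ k)%:E * (\1_(eball origin (2 ^+ k.+1)) y)%:E)%E.
have f0 k y : (0 <= f k y)%E by rewrite mule_ge0 ?lee_fin ?exprn_ge0.
have mf k : measurable_fun setT (f k).
  apply: measurable_funeM; apply/measurable_EFinP.
  by apply: measurable_indic; exact: measurable_eball.
apply: (@le_lt_trans _ _ (\int[leb]_y (\sum_(k <oo) f k y))%E).
  apply: ge0_le_integral => //.
  - by move=> y _; rewrite lee_fin gauge_ge0.
  - by apply/measurable_EFinP; exact: measurable_gauge.
  - by apply: ge0_emeasurable_sum.
  - move=> y _; have [k /andP[k1 k2]] := @pow2_ge R (1 + edist origin y)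
      (ltac:(by rewrite lerDl edist_ge0)).
    apply: (@le_trans _ _ (f k y)); last first.
      rewrite (nneseriesD1 (n := k))//; first by rewrite leeDl// nneseries_ge0.
    rewrite /f indicE mem_set ?mule1; last first.
      by rewrite /eball /= (le_trans _ (ltW k2))// lerDr.
    rewrite lee_fin /gauge /q -powR_mulrn// -powRrM mulrC powRrM.
    by rewrite powR_mulrn// powR_anti// ?(ltW b0)// exprn_gt0.
rewrite integral_nneseries//.
have le1 k : (\int[leb]_y f k y <= ((4 ^+ d) * (2 ^+ d * q) ^+ k)%:E)%E.
  rewrite ge0_integralZl//.
  - rewrite integral_indic_setT; last exact: measurable_eball.
    apply: le_trans (lee_wpmul2l _ (leb_eball_le _ _)) _; rewrite ?lee_fin ?exprn_ge0//.
    rewrite (_ : 2 ^+ k.+1 *+ 2 = 4 * 2 ^+ k); last by rewrite exprS; ring.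
    rewrite !exprMn -!exprM [(d * k)%N]mulnC le_eqVlt; apply/orP; left; apply/eqP.
    ring.
  - by apply/measurable_EFinP; apply: measurable_indic; exact: measurable_eball.
  - by rewrite lee_fin exprn_ge0.
apply: le_lt_trans (lee_nneseries (fun k _ _ => _) (fun k _ => le1 k)) _.
  by move=> k _ _; apply: integral_ge0 => y _.
have q1 : `|2 ^+ d * q| < 1.
  rewrite ger0_norm ?mulr_ge0// /q powRN -powR_mulrn// -[ltRHS]invr1.
  rewrite -[_ * _]invrK invfM invrK mulrC -powRB ?pnatr_eq0 ?implybT//.
  have E : 1 = 1 `^ (b - d%:R) :> R by rewrite powR1.
  by rewrite ltf_pV2 ?posrE ?powR_gt0// [ltLHS]E gt0_ltr_powR ?nnegrE ?subr_gt0// ltr1n.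
suff -> : (\sum_(0 <= i <oo) (4 ^+ d * (2 ^+ d * q) ^+ i)%:E =
           (4 ^+ d * (1 - 2 ^+ d * q)^-1)%:E)%E by rewrite ltry.
apply/cvg_lim => //.
rewrite (_ : (fun n => _) = EFin \o series (geometric (4 ^+ d) (2 ^+ d * q))).
  by apply: cvg_EFin; [exact: nearW|exact: cvg_geometric_series].
by apply/funext => n /=; rewrite sumEFin.
Qed.

(** The least radius for which [y] lies in both balls defining [c_alpha]. *)
Definition farther (y : Rd R d) : R := Num.max (edist origin y) (edist e1 y).

Lemma measurable_farther : measurable_fun setT (farther : _ -> mR).
Proof. by apply: measurable_maxr; exact: measurable_edist1. Qed.

Lemma farther_le y r : farther y <= r <-> eball origin r y /\ eball e1 r y.
Proof. by rewrite /farther ge_max; split => [/andP//|[a b]]; apply/andP. Qed.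

Hypothesis d1 : (1 <= d)%N.

Lemma farther_ge y : (1 + edist origin y) / 4 <= farther y.
Proof.
have H : 1 <= edist origin y + edist e1 y.
  by rewrite -(enorm_e1 R d1) /enorm edistC (le_trans (edist_triangle y _ _))// lerD2l edistC.
have := edist_ge0 origin y; have := edist_ge0 e1 y.
by rewrite /farther; case: (leP (edist origin y)) => *; lra.
Qed.

Lemma farther_gt0 y : 0 < farther y.
Proof.
by apply: lt_le_trans (farther_ge y); rewrite divr_gt0// ltr_pwDl ?edist_ge0.
Qed.

Lemma farther_le1 y : farther y <= 1 + edist origin y.
Proof.
rewrite /farther ge_max lerDr ler01/=.
rewrite (le_trans (edist_triangle origin _ _))// lerD2r -(enorm_e1 R d1)//.
Qed.

(** Layer cake: the volume of the intersection of the balls of radius [r] is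
    the volume of [farther y <= r], and integrating the density [b * r ^ (-
    b - 1)] from [farther y] on gives [farther y ^ (- b)]. *)
Lemma c_alpha_E (b : R) : 0 < b ->
  (\int[@lebesgue_measure R]_(r in `]0%R, +oo[)
    (fine (leb (eball origin r `&` eball e1 r)) * (b * r `^ (- b - 1)))%:E =
   \int[leb]_y (farther y `^ (- b))%:E)%E.
Proof.
move=> b0; pose g (r : R) : R := b * r `^ (- b - 1).
have g0 r : 0 <= g r by rewrite mulr_ge0 ?powR_ge0// ltW.
have mg : measurable_fun setT (g : mR -> mR).
  by apply: measurable_funM => //; exact: measurable_powR.
pose E : set (mR * Rd R d) := [set p | farther p.2 <= p.1].
have mE : measurable E.
  by apply: measurable_le_set => //; apply: (measurableT_comp measurable_farther).
pose f (p : mR * Rd R d) : \bar R := (\1_E p * g p.1)%:E.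
have f0 p : (0 <= f p)%E by rewrite lee_fin mulr_ge0.
have mf : measurable_fun setT f.
  apply/measurable_EFinP; apply: measurable_funM; first exact: measurable_indic.
  exact: (measurableT_comp mg).
transitivity (\int[@lebesgue_measure R]_r \int[leb]_y f (r, y))%E.
  rewrite integral_mkcond; apply: eq_integral => r _.
  rewrite patchE; case: ifPn => r0; last first.
    apply/esym; apply: integral0_eq => y _; rewrite /f indicE memNset ?mul0r//.
    rewrite /E /= => Mr; move: r0 => /negP; apply; rewrite inE/= in_itv/= andbT.
    exact: lt_le_trans (farther_gt0 y) Mr.
  rewrite /f /=; under eq_integral do rewrite mulrC EFinM.
  have mS : measurable [set y | E (r, y)].
    exact: (measurable_setP (pair1_measurable r) mE).
  have mI : measurable_fun setT (fun y => (\1_E (r, y) : R)%:E).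
    by apply/measurable_EFinP; exact: (measurable_indic mS).
  rewrite (ge0_integralZl _ _ mI) ?lee_fin//.
  rewrite (integral_indic_setT leb mS) EFinM muleC; congr (_ * _)%E.
  have -> : [set y | E (r, y)] = eball origin r `&` eball e1 r.
    by apply/seteqP; split => y /farther_le.
  rewrite fineK// ge0_fin_numE//; apply: le_lt_trans (leb_eball_lty origin r).
  apply: le_measure; rewrite ?inE; [|exact: measurable_eball|by apply: subIsetl].
  by apply: measurableI; exact: measurable_eball.
rewrite fubini_tonelli//; apply: eq_integral => y _.
rewrite -(integral_powR_tail b0 (farther_gt0 y)) [RHS]integral_mkcond.
apply: eq_integral => r _; rewrite patchE /f indicE.
have [My|My] := leP (farther y) r.
  by rewrite !mem_set ?mul1r//= in_itv/= My.
rewrite !memNset ?mul0r//= /E /= ?in_itv/= ?andbT; by apply/negP; rewrite -ltNge.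
Qed.

Lemma integral_farther_lty (b : R) : d%:R < b ->
  (\int[leb]_y (farther y `^ (- b))%:E < +oo)%E.
Proof.
move=> db; have b0 : 0 <= b by rewrite ltW// (le_lt_trans _ db).
apply: (@le_lt_trans _ _ (\int[leb]_y ((4 `^ b)%:E * (gauge b y)%:E))%E).
  apply: ge0_le_integral => //.
  - by move=> y _; rewrite lee_fin powR_ge0.
  - by apply/measurable_EFinP; apply: measurable_powR_comp; exact: measurable_farther.
  - by apply: measurable_funeM; apply/measurable_EFinP; exact: measurable_gauge.
  - move=> y _; rewrite -EFinM lee_fin.
    apply: le_trans (powR_anti b0 _ (farther_ge y)) _.
      by rewrite divr_gt0// ltr_pwDl ?edist_ge0.
    rewrite powRM ?invr_ge0 ?addr_ge0 ?edist_ge0// mulrC /gauge.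
    by rewrite ler_wpM2r ?powR_ge0// -powR_inv1// -powRrM mulN1r opprK.
rewrite ge0_integralZl//.
- by rewrite lte_mul_pinfty ?lee_fin ?powR_ge0 ?integral_gauge_lty.
- by apply/measurable_EFinP; exact: measurable_gauge.
- by move=> y _; rewrite lee_fin gauge_ge0.
Qed.

Lemma integral_farther_gt0 (b : R) : 0 <= b ->
  (0 < \int[leb]_y (farther y `^ (- b))%:E)%E.
Proof.
move=> b0; pose B := eball (origin : Rd R d) 1.
have mB : measurable B by exact: measurable_eball.
apply: (@lt_le_trans _ _ (\int[leb]_y ((2 `^ (- b))%:E * (\1_B y)%:E))%E).
  rewrite ge0_integralZl//.
  - rewrite integral_indic_setT// mule_gt0 ?lte_fin ?powR_gt0//.
    exact: leb_eball_gt0.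
  - by apply/measurable_EFinP; exact: measurable_indic.
apply: ge0_le_integral => //.
- by apply: measurable_funeM; apply/measurable_EFinP; exact: measurable_indic.
- by apply/measurable_EFinP; apply: measurable_powR_comp; exact: measurable_farther.
move=> y _; rewrite indicE; have [yB|yB] := pselect (B y).
  rewrite mem_set// mule1 lee_fin powR_anti ?farther_gt0//.
  by rewrite (le_trans (farther_le1 y))// -[2]/(1 + 1) lerD2l.
by rewrite memNset// mule0 lee_fin powR_ge0.
Qed.

Lemma c_alpha_gt0 (b : R) : d%:R < b -> 0 < c_alpha b d.
Proof.
move=> db; have b0 : 0 < b by rewrite (le_lt_trans _ db).
rewrite /c_alpha /Rintegral c_alpha_E// fine_gt0//.
by rewrite integral_farther_gt0 ?(ltW b0)//= integral_farther_lty.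
Qed.

Lemma c_alphaE (b : R) : d%:R < b ->
  ((c_alpha b d)%:E = \int[leb]_y (farther y `^ (- b))%:E)%E.
Proof.
move=> db; have b0 : 0 < b by rewrite (le_lt_trans _ db).
rewrite /c_alpha /Rintegral c_alpha_E// fineK// ge0_fin_numE ?integral_farther_lty//.
by apply: integral_ge0 => y _; rewrite lee_fin powR_ge0.
Qed.

End gauge.

(** * The intensity measure of the grains *)

Lemma measurable_fun_section d1 d2 (T1 : measurableType d1) (T2 : measurableType d2)
    (R : realType) (m : {sigma_finite_measure set T2 -> \bar R}) (E : set (T1 * T2)) :
  measurable E -> measurable_fun setT (fun x => m [set y | E (x, y)]).
Proof.
move=> mE; rewrite (_ : (fun x => _) = m \o xsection E).
  exact: measurable_fun_xsection.
apply/funext => x /=; congr (m _).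
by apply/seteqP; split => y; rewrite /xsection /= inE.
Qed.

Section intensity_measure.
Context (R : realType) (d : nat) (lam : {nonneg R})
  (F : probability (measurableTypeR R) R).
Local Notation mR := (measurableTypeR R).
Local Notation leb := (lebesgue_Rd R d).
Local Notation G := (grain R d).

(** Grains of the model are determined by center and radius: their weight is
    the radius. *)
Definition balanced (p : Rd R d * mR) : G := (p.1, p.2, p.2).

Lemma measurable_balanced : measurable_fun setT balanced.
Proof.
apply: measurable_fun_pair => //.
by apply: measurable_fun_pair.
Qed.

(** The intensity measure, realized as an image measure so that it is
    available as a sigma-finite measure on all of the grain space;
    [intensityE] identifies it with the iterated integral of the model. *)
Definition Lam : set G -> \bar R :=
  mscale lam (image_measure (leb \x F)%E measurable_balanced).
HB.instance Definition _ := Measure.on Lam.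

Lemma LamE B : (Lam B = lam%:num%:E * (leb \x F) (balanced @^-1` B))%E.
Proof. by []. Qed.

Lemma measurable_balanced_preim B : measurable B -> measurable (balanced @^-1` B).
Proof. by move=> mB; exact: (measurable_setP measurable_balanced mB). Qed.

Lemma Lam_center B : measurable B ->
  (Lam B = lam%:num%:E * \int[leb]_x F [set r | B (x, r, r)])%E.
Proof.
move=> mB; rewrite LamE; congr (_ * _)%E; apply: eq_integral => x _.
congr (F _); apply/seteqP; split => r; by rewrite /xsection /= inE.
Qed.

Lemma Lam_radius B : measurable B ->
  (Lam B = lam%:num%:E * \int[F]_r leb [set x | B (x, r, r)])%E.
Proof.
move=> mB; rewrite Lam_center//; congr (_ * _)%E.
exact: (fubini_sets leb F (measurable_balanced_preim mB)).
Qed.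

Lemma measurable_center : measurable_fun setT (@Defs.center R d).
Proof. by apply: measurableT_comp => //; exact: measurable_fst. Qed.

Lemma measurable_radius : measurable_fun setT (@Defs.radius R d : G -> mR).
Proof. by apply: measurableT_comp => //; exact: measurable_fst. Qed.

Lemma measurable_weight : measurable_fun setT (@weight R d : G -> mR).
Proof. exact: measurable_snd. Qed.

(** Applies a transformation of space to the center only; Lebesgue
    invariances thereby become invariances of [Lam]. *)
Definition recenter (f : Rd R d -> Rd R d) (g : G) : G := (f (center g), radius g, weight g).

Lemma measurable_recenter f : measurable_fun setT f -> measurable_fun setT (recenter f).
Proof.
move=> mf; apply: measurable_fun_pair; last exact: measurable_weight.
apply: measurable_fun_pair; last exact: measurable_radius.
exact: (measurableT_comp mf measurable_center).
Qed.

Lemma measurable_translate (b : Rd R d) : measurable_fun setT (fun x => tadd x b).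
Proof. by apply: measurable_tadd => //; exact: measurable_id. Qed.

Lemma measurable_homothety (a : R) : measurable_fun setT (@tscale R d a).
Proof. by apply: measurable_tscale => //; exact: measurable_id. Qed.

Lemma measurable_section (B : set G) r : measurable B -> measurable [set x : Rd R d | B (x, r, r)].
Proof.
move=> mB; apply: (measurable_setP (f := fun x => (x, r, r)) _ mB).
by apply: measurable_fun_pair => //; apply: measurable_fun_pair.
Qed.

Lemma Lam_translate b (B : set G) : measurable B ->
  Lam [set g | B (recenter (fun x => tadd x b) g)] = Lam B.
Proof.
move=> mB; rewrite !Lam_radius//; last first.
  exact: (measurable_setP (measurable_recenter (measurable_translate b)) mB).
congr (_ * _)%E; apply: eq_integral => r _.
exact: (lebesgue_Rd_translate b (measurable_section r mB)).
Qed.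

(** Only the centers are scaled, hence the factor [a ^ d] and no change of
    the radius law. *)
Lemma Lam_scale a (B : set G) : 0 < a -> measurable B ->
  ((a ^+ d)%:E * Lam [set g | B (recenter (tscale a) g)] = Lam B)%E.
Proof.
move=> a0 mB; rewrite !Lam_radius//; last first.
  exact: (measurable_setP (measurable_recenter (measurable_homothety a)) mB).
rewrite muleCA; congr (_ * _)%E; rewrite -ge0_integralZl//.
- apply: eq_integral => r _.
  rewrite -[RHS](lebesgue_Rd_affine origin a0 (measurable_section r mB)).
  by congr (_ * leb _)%E; apply/seteqP; split => x /=; rewrite tadd0.
- apply: (@measurable_fun_section _ _ _ _ _ leb [set p : mR * Rd R d | B (tscale a p.2, p.1, p.1)]).
  apply: (measurable_setP (f := fun p : mR * Rd R d => (tscale a p.2, p.1, p.1)) _ mB).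
  apply: measurable_fun_pair => //; apply: measurable_fun_pair => //.
  exact: (measurableT_comp (measurable_homothety a)).
- by rewrite lee_fin exprn_ge0// ltW.
Qed.

Lemma Lam_householder v (B : set G) : measurable B ->
  Lam [set g | B (recenter (householder v) g)] = Lam B.
Proof.
move=> mB; have mH := measurable_householder v (@measurable_id _ (Rd R d) setT).
rewrite !Lam_radius//; last first.
  exact: (measurable_setP (measurable_recenter mH) mB).
congr (_ * _)%E; apply: eq_integral => r _.
exact: (leb_householder v (measurable_section r mB)).
Qed.

Lemma Lam_finite_centers x r : (Lam [set g | (edist x (center g) <= r)%R] < +oo)%E.
Proof.
have mB : measurable [set g : G | edist x (center g) <= r].
  exact: (measurable_setP measurable_center (measurable_eball x r)).
rewrite Lam_radius//= lte_mul_pinfty//.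
rewrite (eq_integral (fun=> leb (eball x r)))//.
rewrite integral_cst//= probability_setT mule1; exact: leb_eball_lty.
Qed.

Let Lam_sigma_finite : sigma_finite [set: G] Lam.
Proof.
exists (fun k => [set g | edist origin (center g) <= k%:R]).
  apply/esym; rewrite -subTset => g _.
  exists (Num.truncn (edist origin (center g))).+1 => //=.
  by rewrite ltW// truncnS_gt.
move=> k; split; last exact: Lam_finite_centers.
exact: (measurable_setP measurable_center (measurable_eball origin k%:R)).
Qed.
HB.instance Definition _ := Measure_isSigmaFinite.Build _ _ _ Lam Lam_sigma_finite.

Lemma measurable_point g : measurable [set g : G].
Proof.
rewrite (_ : [set g] = [set h | [set center g] (center h)] `&`
  ([set h | [set radius g] (radius h)] `&` [set h | [set weight g] (weight h)])).
  apply: measurableI; last apply: measurableI.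
  - exact: (measurable_setP measurable_center (measurable_set1_Rd (center g))).
  - exact: (measurable_setP measurable_radius (measurable_set1 (radius g : mR))).
  - exact: (measurable_setP measurable_weight (measurable_set1 (weight g : mR))).
case: g => [[x r] w]; apply/seteqP; split => [_ -> //|[[x' r'] w']] /=.
by rewrite /Defs.center /Defs.radius /weight /= => -[-> [-> ->]].
Qed.

Lemma Lam_set1 g : (1 <= d)%N -> Lam [set g] = 0%E.
Proof.
move=> d1; rewrite (Lam_radius (measurable_point g)) integral0_eq ?mule0// => r _.
apply/eqP; rewrite eq_le measure_ge0 andbT -(leb_set1 (center g) d1).
apply: le_measure; rewrite ?inE; [|exact: measurable_set1_Rd|].
  exact: measurable_section (measurable_point g).
by move=> x /= <-.
Qed.

Lemma intensityE B : measurable B ->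
  intensity lam%:num F (radius_weight R) B = Lam B.
Proof.
move=> mB; rewrite Lam_center// /intensity; congr (_ * _)%E.
apply: eq_integral => x _.
have mS : measurable [set r : mR | B (x, r, r)].
  apply: (measurable_setP (f := fun r : mR => (x, r, r)) _ mB).
  by apply: measurable_fun_pair => //; apply: measurable_fun_pair.
rewrite -(integral_indic_setT F mS); apply: eq_integral => r _.
rewrite /radius_weight /kdirac integral_dirac//.
  by rewrite diracT mul1e.
have mw : measurable [set w | B (x, r, w)].
  exact: (measurable_setP (pair1_measurable (x, r)) mB).
by apply/measurable_EFinP; exact: (measurable_indic mw).
Qed.

End intensity_measure.
Arguments measurable_center {R d}.
Arguments measurable_radius {R d}.
Arguments measurable_weight {R d}.
Arguments measurable_balanced {R d}.

(** * Potter bound for a power law *)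

Section tails.
Context (R : realType) (F : probability (measurableTypeR R) R) (alpha : R).
Hypothesis F_Rplus : F `[0%R, +oo[%classic = 1%E.
Hypothesis tail_gt0 : \forall t \near +oo, 0 < tail F t.
Hypothesis tail_lim : forall a, 0 < a ->
  tail F (a * t) / tail F t @[t --> +oo] --> a `^ (- alpha).

(** The tail that includes its left end point, as it arises from the closed
    conditions defining sets of grains. *)
Definition ctail (t : R) : R := fine (F `[t, +oo[%classic).

Lemma ctailE t : (ctail t)%:E = F `[t, +oo[%classic.
Proof. by rewrite fineK// fin_num_measure. Qed.

Lemma ctail_ge0 t : 0 <= ctail t.
Proof. by rewrite fine_ge0. Qed.

Lemma tailE t : 0 <= t -> (tail F t)%:E = F `]t, +oo[%classic.
Proof.
move=> t0; rewrite /tail EFinB fineK ?fin_num_measure// -F_Rplus.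
rewrite (_ : `[0, +oo[%classic = `[0, t]%classic `|` `]t, +oo[%classic).
  rewrite measureU//; last first.
    rewrite -subset0 => x [] /=; rewrite !in_itv/= andbT => /andP[_ xt] tx.
    by move: (le_lt_trans xt tx); rewrite ltxx.
  by rewrite addeAC subee ?add0e// fin_num_measure.
apply/seteqP; split => x /=; rewrite !in_itv/= ?andbT.
  by move=> x0; have [xt|xt] := leP x t; [left; rewrite x0|right].
by move=> [/andP[]//|tx]; exact: le_trans t0 (ltW tx).
Qed.

Lemma tail_ge0 t : 0 <= tail F t.
Proof.
rewrite /tail subr_ge0 -[leRHS]/(fine 1%:E) fine_le ?fin_num_measure//.
by rewrite probability_le1.
Qed.

Lemma ctail_anti s t : s <= t -> ctail t <= ctail s.
Proof.
move=> st; rewrite /ctail fine_le ?fin_num_measure//.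
apply: le_measure; rewrite ?inE//.
by move=> x /=; rewrite !in_itv/= !andbT; exact: le_trans.
Qed.

Lemma tail_le_ctail t : 0 <= t -> tail F t <= ctail t.
Proof.
move=> t0; rewrite -lee_fin tailE// ctailE.
apply: le_measure; rewrite ?inE//.
by move=> x /=; rewrite !in_itv/= !andbT; exact: ltW.
Qed.

Lemma ctail_le_tail s t : 0 <= s -> s < t -> ctail t <= tail F s.
Proof.
move=> s0 st; rewrite -lee_fin tailE// ctailE.
apply: le_measure; rewrite ?inE//.
by move=> x /=; rewrite !in_itv/= !andbT; exact: lt_le_trans.
Qed.

(** For large [u], doubling the argument multiplies the tail by at most [2 ^
    (- beta)], because [beta < alpha]; iterating along powers of 2 gives the
    power bound with [alpha] weakened to [beta]. The factor 16 is the slack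
    of the sets [wide] below. The iteration starts at [u / 32], strictly
    below [u / 16], so that a closed tail is bounded by an open one. *)
Lemma potter_bound (beta : R) : 0 < beta -> beta < alpha ->
  exists2 C, 0 < C & \forall u \near +oo, 0 < tail F u /\
    forall s, 1 <= s -> ctail (u * s / 16) <= C * s `^ (- beta) * tail F u.
Proof.
move=> b0 ba; pose q : R := 2 `^ (- beta).
have q0 : 0 < q by rewrite powR_gt0.
have aq : 2 `^ (- alpha) < q.
  rewrite /q !powRN ltf_pV2 ?posrE ?powR_gt0//.
  rewrite -(subrK beta alpha) powRD ?pnatr_eq0 ?implybT// ltr_pMl ?powR_gt0//.
  have E : 1 = 1 `^ (alpha - beta) :> R by rewrite powR1.
  by rewrite [ltLHS]E gt0_ltr_powR ?nnegrE ?subr_gt0// ltr1n.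
have H2 : \forall u \near +oo, tail F (2 * u) <= q * tail F u.
  have := tail_lim (ltr0n R 2) => /cvgr_lt/(_ _ aq) H.
  near=> u; have u0 : 0 < tail F u by near: u.
  by rewrite -ler_pdivrMr// ltW//; near: u.
(* the limit of the ratio of the tails at [u / 32] and [u], plus a margin *)
pose c32 : R := 32^-1 `^ (- alpha) + 1.
have H32 : \forall u \near +oo, tail F (32^-1 * u) <= c32 * tail F u.
  have : 32^-1 `^ (- alpha) < c32 by rewrite ltrDl.
  have i32 : 0 < 32^-1 :> R by rewrite invr_gt0.
  have := tail_lim i32 => /cvgr_lt/[apply] H.
  near=> u; have u0 : 0 < tail F u by near: u.
  by rewrite -ler_pdivrMr// ltW//; near: u.
have [U [_ HU]] := H2.
have c0 : 0 < c32 by rewrite ltr_wpDl ?powR_ge0.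
exists ((2^-1) `^ (- beta) * c32); first by rewrite mulr_gt0 ?powR_gt0 ?invr_gt0.
near=> u.
have u0 : 0 < u by near: u; exact: nbhs_pinfty_gt.
have U0 : Num.max U 0 < 32^-1 * u.
  by rewrite ltr_pdivlMl//; near: u; apply: nbhs_pinfty_gt; exact: num_real.
move: U0; rewrite gt_max => /andP[Uv v0].
split; first by near: u.
move=> s s1; have [k /andP[k1 k2]] := pow2_ge s1.
have Hk : tail F (2 ^+ k * (32^-1 * u)) <= q ^+ k * tail F (32^-1 * u).
  elim: (k) => [|n IH]; first by rewrite !expr0 !mul1r.
  rewrite exprS -mulrA (le_trans (HU _ _))//.
    rewrite (lt_le_trans Uv)// ler_pMl// exprn_ege1// ler1n//.
  by rewrite exprS -mulrA ler_pM2l.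
apply: (@le_trans _ _ (tail F (2 ^+ k * (32^-1 * u)))).
  apply: ctail_le_tail; first by rewrite mulr_ge0// ltW.
  have : 2 ^+ k * u <= s * u by rewrite ler_pM2r.
  have : 0 < s * u by rewrite mulr_gt0// (lt_le_trans ltr01 s1).
  lra.
apply: (le_trans Hk).
have H1 : tail F (32^-1 * u) <= c32 * tail F u by near: u.
apply: (le_trans (ler_wpM2l _ H1)); first by rewrite exprn_ge0// ltW.
rewrite mulrA ler_wpM2r ?tail_ge0// mulrAC ler_wpM2r ?(ltW c0)//.
rewrite -powRM ?invr_ge0//; last by rewrite (le_trans ler01).
rewrite /q -powR_mulrn ?powR_ge0// -powRrM mulrC powRrM powR_mulrn//.
rewrite powR_anti ?(ltW b0)//; first by rewrite mulr_gt0// (lt_le_trans ltr01).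
by rewrite ler_pdivrMl// -exprS ltW.
Unshelve. all: by end_near. Qed.

(** A bounded shift and the difference between open and closed tails are
    absorbed by comparing with [tail (b * u)] for [b] slightly smaller than
    [a], the limit being continuous in [a]. *)
Lemma ctail_ratio_cvg (u : R ^nat) (a s : R) : 0 < a -> 0 <= s ->
  u n @[n --> \oo] --> +oo ->
  ctail (u n * a - s) / tail F (u n) @[n --> \oo] --> a `^ (- alpha).
Proof.
move=> a0 s0 uoo.
have utail : \forall n \near \oo, 0 < tail F (u n) by exact: (uoo _ tail_gt0).
have ugt M : \forall n \near \oo, M < u n by exact: (uoo _ (nbhs_pinfty_gt (num_real M))).
have sub b : 0 < b -> tail F (b * u n) / tail F (u n) @[n --> \oo] --> b `^ (- alpha).
  by move=> b0; apply: (cvg_comp _ _ uoo (tail_lim b0)).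
apply/cvgrPdist_lt => e e0.
have cont : t `^ (- alpha) @[t --> a^'-] --> a `^ (- alpha).
  apply: cvg_at_left_filter.
  suff : {for a, continuous (@powR R ^~ (- alpha))} by [].
  apply: differentiable_continuous; apply/derivable1_diffP.
  by apply: derivable_powR; rewrite in_itv/= a0.
have [b [b0 ba be]] : exists b, [/\ 0 < b, b < a & b `^ (- alpha) < a `^ (- alpha) + e].
  have : a `^ (- alpha) < a `^ (- alpha) + e by rewrite ltrDl.
  move=> /(cvgr_lt _ cont) H.
  have [b bP] : exists b, [/\ 0 < b, b < a & b `^ (- alpha) < a `^ (- alpha) + e].
    apply: (@filter_ex _ (a^'-)); near=> b; split.
    - by near: b; exact: nbhs_left_gt.
    - by near: b; exact: nbhs_left_lt.
    - by near: b; exact: H.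
  by exists b.
have /cvgr_lt/(_ _ be) H1 := sub b b0.
have le1 : a `^ (- alpha) - e < a `^ (- alpha) by rewrite ltrBlDr ltrDl.
have /cvgr_gt/(_ _ le1) H2 := sub a a0.
near=> n.
have un0 : 0 < u n by near: n; exact: ugt.
have tn0 : 0 < tail F (u n) by near: n.
rewrite ltr_norml; apply/andP; split.
  rewrite ltrBrDl ltrBlDr addrC.
  apply: le_lt_trans (_ : tail F (b * u n) / tail F (u n) < _); last by near: n.
  rewrite ler_pM2r ?invr_gt0//; apply: ctail_le_tail; first by rewrite mulr_ge0// ltW.
  have : s / (a - b) < u n by near: n; exact: ugt.
  by rewrite ltr_pdivrMr ?subr_gt0// mulrBr => us; lra.
rewrite ltrBlDr addrC -ltrBlDr.
apply: lt_le_trans (_ : _ < tail F (a * u n) / tail F (u n)) _; first by near: n.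
rewrite ler_pM2r ?invr_gt0//.
apply: le_trans (tail_le_ctail _) _; first by rewrite mulr_ge0// ltW.
by apply: ctail_anti; rewrite mulrC gerBl.
Unshelve. all: by end_near. Qed.

End tails.

(** * Intensity of the grains that reach two distant points *)

(** Dominated convergence for nonnegative functions under a pointwise bound
    with finite integral. *)
Lemma ge0_dominated_cvg d (T : measurableType d) (R : realType)
    (m : {measure set T -> \bar R}) (D : set T) (f_ : (T -> \bar R)^nat)
    (f g : T -> \bar R) :
  measurable D -> (forall n, measurable_fun D (f_ n)) -> measurable_fun D g ->
  (\int[m]_(x in D) g x < +oo)%E ->
  (forall n x, D x -> (0 <= f_ n x)%E) -> (forall n x, D x -> (f_ n x <= g x)%E) ->
  (forall x, D x -> f_ n x @[n --> \oo] --> f x) ->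
  (\int[m]_(x in D) f_ n x)%E @[n --> \oo] --> (\int[m]_(x in D) f x)%E.
Proof.
move=> mD mf mg ig f0 fg ff.
have mlim : measurable_fun D f by exact: emeasurable_fun_cvg mf ff.
have g0 x : D x -> (0 <= g x)%E by move=> Dx; exact: le_trans (f0 0%N x Dx) (fg 0%N x Dx).
have intg : m.-integrable D g.
  apply/integrableP; split => //.
  by under eq_integral => x /[!inE] Dx do rewrite (gee0_abs (g0 _ Dx)).
have f_f : {ae m, forall x, D x -> f_ n x @[n --> \oo] --> f x} by exact: aeW.
have f_g : {ae m, forall x n, D x -> (`|f_ n x| <= g x)%E}.
  by apply: aeW => x n Dx; rewrite gee0_abs ?f0// fg.
by have [] := dominated_convergence mD mf mlim f_f intg f_g.
Qed.

Section grain_intensity.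
Context (R : realType) (d : nat) (lam : {nonneg R})
  (F : probability (measurableTypeR R) R) (alpha : R).
Local Notation mR := (measurableTypeR R).
Local Notation leb := (lebesgue_Rd R d).
Local Notation G := (grain R d).
Local Notation L := (@Lam R d lam F).

(** Grains that contain [x] once their radius is enlarged by [a]; allowing
    [a > 0] makes the sets of killers of a grain covering [x] comparable
    with sets attached to the point [x] alone. *)
Definition reach (a : R) (x : Rd R d) : set G :=
  [set g | edist x (center g) <= radius g + a].

(** A single set of intensity [O (rho u)] that contains all the grains
    linking two regions at distance [u] that occur below; the constant 16 is
    a convenient common choice. *)
Definition wide (u : R) : set G :=
  [set g | (u + edist origin (center g)) / 16 <= radius g].

(** The common decay rate of all the two-point quantities. *)
Definition rho (u : R) : R := u ^+ d * tail F u.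

Lemma measurable_centers x r : measurable [set g : G | edist x (center g) <= r].
Proof. exact: (measurable_setP measurable_center (measurable_eball x r)). Qed.

Lemma measurable_reach a x : measurable (reach a x).
Proof.
apply: measurable_le_set.
  by apply: measurable_edist => //; exact: measurable_center.
by apply: measurable_funD => //; exact: measurable_radius.
Qed.

Lemma measurable_wide u : measurable (wide u).
Proof.
apply: measurable_le_set; last exact: measurable_radius.
apply: measurable_funM => //; apply: measurable_funD => //.
by apply: measurable_edist => //; exact: measurable_center.
Qed.

Lemma reach_sub a b x y : a + edist x y <= b -> reach a x `<=` reach b y.
Proof.
move=> ab g; rewrite /reach /= => xg.
rewrite (le_trans (edist_triangle x _ _))// (le_trans (lerD (lexx _) xg))//.
by rewrite edistC addrCA lerD2l addrC.
Qed.

Hypothesis d1 : (1 <= d)%N.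
Hypothesis F_Rplus : F `[0%R, +oo[%classic = 1%E.
Hypothesis alpha_gt_d : d%:R < alpha.
Hypothesis tail_gt0 : \forall t \near +oo, 0 < tail F t.
Hypothesis tail_lim : forall a, 0 < a ->
  tail F (a * t) / tail F t @[t --> +oo] --> a `^ (- alpha).

Let beta : R := (d%:R + alpha) / 2.
Let d_beta : d%:R < beta. Proof. by rewrite /beta (midf_lt alpha_gt_d). Qed.
Let beta_alpha : beta < alpha. Proof. by rewrite /beta (midf_lt alpha_gt_d). Qed.
Let beta0 : 0 < beta. Proof. exact: le_lt_trans d_beta. Qed.

Let potter := potter_bound F_Rplus tail_gt0 tail_lim beta0 beta_alpha.

Lemma rho_gt0 : \forall u \near +oo, 0 < rho u.
Proof.
near=> u; have u0 : 0 < u by near: u; exact: nbhs_pinfty_gt.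
by rewrite /rho mulr_gt0 ?exprn_gt0//; near: u.
Unshelve. all: by end_near. Qed.

Lemma Lam_center_scaled u (B : set G) : 0 < u -> measurable B ->
  (L B = (u ^+ d)%:E * (lam%:num%:E *
     \int[leb]_x F [set r | B (tscale u x, r, r)]))%E.
Proof.
move=> u0 mB; rewrite -(Lam_scale lam F u0 mB) Lam_center//.
exact: (measurable_setP (measurable_recenter (measurable_homothety u)) mB).
Qed.

Lemma measurable_section_center (B : set G) u : measurable B ->
  measurable_fun setT (fun x => F [set r | B (tscale u x, r, r)]).
Proof.
move=> mB.
apply: (@measurable_fun_section _ _ _ _ _ F [set p : Rd R d * mR | B (tscale u p.1, p.2, p.2)]).
apply: (measurable_setP (f := fun p : Rd R d * mR => (tscale u p.1, p.2, p.2)) _ mB).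
apply: measurable_fun_pair => //; apply: measurable_fun_pair => //.
exact: (measurableT_comp (measurable_homothety u)).
Qed.

Lemma edist_origin_scale u (x : Rd R d) : 0 <= u -> edist origin (tscale u x) = u * edist origin x.
Proof. by move=> u0; rewrite -{1}(tscaler0 d u) edist_tscale. Qed.

(** In the variable [y = x / u], the radius must exceed [u * (1 + |y|) /
    16], and the Potter bound makes the integrand integrable. *)
Lemma Lam_wide : exists2 C, 0 < C & \forall u \near +oo,
  (L (wide u) <= (C * rho u)%:E)%E.
Proof.
have [C C0 HC] := potter.
pose I := fine (\int[leb]_y (gauge beta y)%:E)%E.
have IE : I%:E = (\int[leb]_y (gauge beta y)%:E)%E.
  rewrite fineK// ge0_fin_numE ?integral_gauge_lty//.
  by apply: integral_ge0 => y _; rewrite lee_fin gauge_ge0.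
have I0 : 0 <= I by rewrite fine_ge0// integral_ge0// => y _; rewrite lee_fin gauge_ge0.
(* adding 1 keeps the constant positive when the integral vanishes *)
exists (lam%:num * C * I + 1); first by rewrite ltr_wpDl// !mulr_ge0// ltW.
near=> u; have u0 : 0 < u by near: u; exact: nbhs_pinfty_gt.
have [tu0 Cu] : 0 < tail F u /\
    forall s, 1 <= s -> ctail F (u * s / 16) <= C * s `^ (- beta) * tail F u by near: u.
rewrite (Lam_center_scaled u0 (measurable_wide u)).
apply: (@le_trans _ _ ((u ^+ d)%:E * (lam%:num%:E * ((C * tail F u)%:E * I%:E)))%E); last first.
  rewrite -!EFinM lee_fin /rho.
  rewrite (_ : _ * (_ * _) = lam%:num * C * I * (u ^+ d * tail F u)); last by ring.
  by rewrite ler_wpM2r ?mulr_ge0 ?exprn_ge0 ?tail_ge0 ?(ltW u0)// lerDl.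
rewrite lee_wpmul2l ?lee_fin ?exprn_ge0 ?(ltW u0)// lee_wpmul2l ?lee_fin//.
have Ct0 : (0 <= (C * tail F u)%:E)%E by rewrite lee_fin mulr_ge0 ?tail_ge0// ltW.
rewrite IE -ge0_integralZl//; first last.
- by move=> y _; rewrite lee_fin gauge_ge0.
- by apply/measurable_EFinP; exact: measurable_gauge.
apply: ge0_le_integral => //.
- exact: measurable_section_center (measurable_wide u).
- by apply: measurable_funeM; apply/measurable_EFinP; exact: measurable_gauge.
move=> y _; rewrite (_ : [set r | _] = `[u * (1 + edist origin y) / 16, +oo[%classic).
  rewrite -ctailE lee_fin (le_trans (Cu _ _)) ?lerDl ?edist_ge0//.
  by rewrite /gauge mulrAC.
apply/seteqP; split => r; rewrite /wide /Defs.center /Defs.radius /= edist_origin_scale ?(ltW u0)//;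
  by rewrite in_itv/= andbT mulrDr mulr1.
Unshelve. all: by end_near. Qed.

(** A grain that reaches [x] has its center in a bounded set or is wide;
    both kinds have finite intensity. *)
Lemma Lam_reach_lty a x : (L (reach a x) < +oo)%E.
Proof.
have [C C0 HC] := Lam_wide.
pose b := `|a| + edist x origin.
have [u [u0 bu uC]] : exists u : R, [/\ 0 < u, 3 * b <= u & (L (wide u) <= (C * rho u)%:E)%E].
  apply: (@filter_ex _ +oo); near=> u; split.
  - by near: u; exact: nbhs_pinfty_gt.
  - by near: u; apply: nbhs_pinfty_ge; exact: num_real.
  - by near: u.
have b0 : 0 <= b by rewrite addr_ge0 ?edist_ge0.
have mB : measurable [set g : G | edist origin (center g) <= u].
  exact: measurable_centers.
apply: (@le_lt_trans _ _ (L ([set g | edist origin (center g) <= u]%R `|` wide u))).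
  apply: le_measure; rewrite ?inE; first exact: measurable_reach.
    by apply: measurableU => //; exact: measurable_wide.
  move=> g xg; have [gu|gu] := leP (edist origin (center g)) u; [by left|right].
  have /(_ g xg) : reach a x `<=` reach b origin.
    by apply: reach_sub; rewrite /b lerD2r ler_norm.
  by rewrite /reach /wide /= => H; lra.
apply: le_lt_trans (measureU2 _ _ _) _ => //; first exact: measurable_wide.
apply: lte_add_pinfty; first exact: Lam_finite_centers.
exact: le_lt_trans uC (ltry _).
Unshelve. all: by end_near. Qed.

(** In the variable [y = x / u], the section over [y] is the set of radii at
    least [u * farther y - a]; its mass divided by [tail u] converges to
    [farther y ^ (- alpha)] and is dominated by a multiple of [gauge], since
    [farther y >= (1 + |y|) / 4] and [a] is at most [3 * u / 16] for large
    [u]. *)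
Lemma Lam_lens_cvg (u : R ^nat) (a : R) : 0 <= a -> u n @[n --> \oo] --> +oo ->
  fine (L (reach a origin `&` reach a (scaled_e1 (u n)))) / rho (u n)
    @[n --> \oo] --> lam%:num * c_alpha alpha d.
Proof.
move=> a0 uoo.
have ugt M : \forall n \near \oo, M < u n by exact: (uoo _ (nbhs_pinfty_gt (num_real M))).
have [C C0 HC] := potter.
have [N _ HN] : \forall n \near \oo, [/\ 0 < u n, 16 / 3 * a < u n, 0 < tail F (u n) &
    forall s, 1 <= s -> ctail F (u n * s / 16) <= C * s `^ (- beta) * tail F (u n)].
  near=> n; have [? ?] : 0 < tail F (u n) /\ forall s, 1 <= s ->
      ctail F (u n * s / 16) <= C * s `^ (- beta) * tail F (u n).
    by near: n; exact: (uoo _ HC).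
  by split => //; near: n; exact: ugt.
have {}HN n : [/\ 0 < u (n + N)%N, 16 / 3 * a < u (n + N)%N, 0 < tail F (u (n + N)%N) &
    forall s, 1 <= s -> ctail F (u (n + N)%N * s / 16) <= C * s `^ (- beta) * tail F (u (n + N)%N)].
  by apply: HN => /=; exact: leq_addl.
rewrite -(cvg_shiftn N).
pose v n := u (n + N)%N.
pose f n (y : Rd R d) : \bar R := (ctail F (v n * farther y - a) / tail F (v n))%:E.
have secE n y : [set r | (reach a origin `&` reach a (scaled_e1 (v n))) (tscale (v n) y, r, r)] =
    `[v n * farther y - a, +oo[%classic.
  have [v0 _ _ _] := HN n.
  apply/seteqP; split => r; rewrite /reach /Defs.center /Defs.radius /= in_itv/= andbT;
    rewrite edist_origin_scale ?(ltW v0)// scaled_e1E edist_tscale ?(ltW v0)//;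
    rewrite /farther maxr_pMr ?(ltW v0)// lerBlDr ge_max.
    by move=> [-> ->].
  by move=> /andP[].
have mB n : measurable (reach a origin `&` reach a (scaled_e1 (v n))).
  by apply: measurableI; exact: measurable_reach.
have mf n : measurable_fun setT (f n).
  apply/measurable_EFinP; apply: measurable_funM => //.
  apply/measurable_EFinP.
  have := measurable_section_center (v n) (mB n).
  by congr measurable_fun; apply/funext => y /=; rewrite secE ctailE.
have f0 n y : (0 <= f n y)%E.
  by have [v0 _ tv _] := HN n; rewrite lee_fin divr_ge0 ?ctail_ge0// ltW.
have fle n y : (f n y <= (C * gauge beta y)%:E)%E.
  have [v0 av tv Cv] := HN n.
  rewrite lee_fin ler_pdivrMr//; apply: le_trans (Cv (1 + edist origin y) _); last first.
    by rewrite lerDl edist_ge0.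
  apply: ctail_anti; have := farther_ge d1 y; have := edist_ge0 origin y.
  move: av v0; rewrite -/(v n); set t := edist origin y; set M := farther y.
  move=> av v0 t0 tM; have : v n * ((1 + t) / 4) <= v n * M by rewrite ler_pM2l.
  have : 0 <= v n * t by rewrite mulr_ge0// ltW.
  lra.
have dom : (\int[leb]_y (C%:E * (gauge beta y)%:E) < +oo)%E.
  rewrite ge0_integralZl//.
  - by rewrite lte_mul_pinfty ?lee_fin ?(ltW C0)// integral_gauge_lty.
  - by apply/measurable_EFinP; exact: measurable_gauge.
  - by move=> y _; rewrite lee_fin gauge_ge0.
  - by rewrite lee_fin ltW.
have If n : (\int[leb]_y f n y < +oo)%E.
  apply: le_lt_trans dom; apply: ge0_le_integral => //.
  - by apply: measurable_funeM; apply/measurable_EFinP; exact: measurable_gauge.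
have IE n : fine (L (reach a origin `&` reach a (scaled_e1 (v n)))) / rho (v n) =
    lam%:num * fine (\int[leb]_y f n y)%E.
  have [v0 av tv Cv] := HN n.
  have -> : L (reach a origin `&` reach a (scaled_e1 (v n))) =
     ((v n ^+ d * lam%:num * tail F (v n))%:E * \int[leb]_y f n y)%E.
    rewrite (Lam_center_scaled v0 (mB n)) !EFinM -!muleA; congr (_ * (_ * _))%E.
    rewrite -ge0_integralZl//.
    - apply: eq_integral => y _; rewrite secE -ctailE /f -EFinM; congr EFin.
      by field; rewrite gt_eqF.
    - by rewrite lee_fin ltW.
  rewrite fineM//; last by rewrite ge0_fin_numE ?If// integral_ge0// => y _; exact: f0.
  rewrite /rho /=; field; rewrite !gt_eqF ?exprn_gt0//.
under eq_fun do rewrite IE.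
apply: cvgMr.
have -> : c_alpha alpha d = fine (\int[leb]_y (farther y `^ (- alpha))%:E)%E.
  by rewrite -c_alphaE.
apply: fine_cvg; rewrite -c_alphaE// fineK// c_alphaE//.
apply: (ge0_dominated_cvg (g := fun y => (C%:E * (gauge beta y)%:E)%E)) => //.
- by apply: measurable_funeM; apply/measurable_EFinP; exact: measurable_gauge.
- move=> y _; apply: cvg_EFin; first exact: nearW.
  apply: (ctail_ratio_cvg F_Rplus tail_gt0 tail_lim) => //.
    exact: farther_gt0.
  by rewrite (cvg_shiftn N u).
Unshelve. all: by end_near. Qed.

End grain_intensity.

(** * The killing relation and its discretization *)

Section kills.
Context (R : realType) (d : nat).
Local Notation mR := (measurableTypeR R).
Local Notation G := (grain R d).
Implicit Types (g h : G) (e : R).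

(** Grains [h] that remove [g], with a slack [e] in all the conditions; the
    slack accommodates the replacement of grains by representatives of their
    cells. The sign conditions express that balls of negative radius are
    empty. *)
Definition kills (e : R) (g : G) : set G := [set h |
  [/\ 0 <= radius g + e, 0 <= radius h + e,
      edist (center g) (center h) <= radius g + radius h + e &
      weight g <= weight h + e]].

Definition near_grain (e : R) (g h : G) := [/\ edist (center g) (center h) <= e,
  `|radius g - radius h| <= e & `|weight g - weight h| <= e].

Lemma near_grainC e g h : near_grain e g h -> near_grain e h g.
Proof. by move=> [? ? ?]; split; rewrite 1?edistC// distrC. Qed.

Lemma kills_le e e' g h : e <= e' -> kills e g h -> kills e' g h.
Proof. by move=> ee [? ? ? ?]; split; lra. Qed.

Lemma kills_lim g h : (forall e, 0 < e -> kills e g h) -> kills 0 g h.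
Proof.
move=> H; split.
- by apply/ler_addgt0Pr => e /H[+ _ _ _]; rewrite addr0.
- by apply/ler_addgt0Pr => e /H[_ + _ _]; rewrite addr0.
- by apply/ler_addgt0Pr => e /H[_ _ + _]; rewrite addr0.
- by apply/ler_addgt0Pr => e /H[_ _ _ +]; rewrite addr0.
Qed.

Lemma kills_near_l e dl g g' h : near_grain dl g g' -> kills e g h -> kills (e + 2 * dl) g' h.
Proof.
move=> [gx]; rewrite !ler_norml => /andP[r1 r2] /andP[w1 w2] [H1 H2 H3 H4].
have := edist_triangle (center g) (center g') (center h).
rewrite (edistC (center g') (center g)) => H5.
have := edist_ge0 (center g) (center g') => H6.
split; lra.
Qed.

Lemma kills_near_r e dl g h h' : near_grain dl h h' -> kills e g h -> kills (e + 2 * dl) g h'.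
Proof.
move=> [gx]; rewrite !ler_norml => /andP[r1 r2] /andP[w1 w2] [H1 H2 H3 H4].
have := edist_triangle (center h) (center g) (center h') => H5.
have := edist_ge0 (center h) (center h') => H6.
split; lra.
Qed.

Lemma kills_sub_reach e g : kills e g `<=` reach (radius g + e) (center g).
Proof. by move=> h [_ _ H _]; rewrite /reach /=; lra. Qed.

Lemma measurable_kills e g : measurable (kills e g).
Proof.
rewrite (_ : kills e g = [set h | (fun=> 0 <= radius g + e) h] `&`
   ([set h | 0 <= radius h + e] `&`
   ([set h | edist (center g) (center h) <= radius g + radius h + e] `&`
   [set h | weight g <= weight h + e]))).
  apply: measurableI; last apply: measurableI; last apply: measurableI.
  - have [H|H] := pselect (0 <= radius g + e).
      by rewrite (_ : mkset _ = setT)//; apply/seteqP; split.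
    by rewrite (_ : mkset _ = set0)//; apply/seteqP; split.
  - by apply: measurable_le_set => //; apply: measurable_funD => //; exact: measurable_radius.
  - apply: measurable_le_set.
      by apply: measurable_edist => //; exact: measurable_center.
    by apply: measurable_funD => //; apply: measurable_funD => //; exact: measurable_radius.
  - by apply: measurable_le_set => //; apply: measurable_funD => //; exact: measurable_weight.
by apply/seteqP; split => h /=; [move=> []|move=> [? [? [? ?]]]].
Qed.

Lemma gball_meetP g h : gball h `&` gball g !=set0 <-> 
  [/\ 0 <= radius g, 0 <= radius h & edist (center g) (center h) <= radius g + radius h].
Proof.
rewrite /gball eball_meetP; split => -[? ? ?]; split => //; by rewrite edistC addrC.
Qed.

Lemma kills0P g h : kills 0 g h <-> gball h `&` gball g !=set0 /\ weight g <= weight h.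
Proof.
rewrite gball_meetP /kills /= !addr0; split; first by case.
by move=> [[? ? ?] ?].
Qed.

(** Retention as a void event: this form makes Poisson void probabilities
    applicable. *)
Lemma thinP (phi : set G) g :
  thin phi g <-> phi g /\ phi `&` (kills 0 g `\ g) = set0.
Proof.
split=> [[pg H]|[pg H]]; split => //.
  rewrite -subset0 => h [ph [/kills0P[m w] hg]].
  by have := H h ph hg m; rewrite ltNge w.
move=> h ph hg m; rewrite ltNge; apply/negP => w.
suff : (phi `&` (kills 0 g `\ g)) h by rewrite H.
by split => //; split => //; exact/kills0P.
Qed.

(** Cubes of side [1 / n.+1] in the [d + 2] coordinates of a grain; they are
    numbered by [cell]. *)
Definition cell_code (n : nat) (g : G) :=
  ([tuple Num.floor (n.+1%:R * tnth (center g) i) | i < d],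
   Num.floor (n.+1%:R * radius g), Num.floor (n.+1%:R * weight g)).

Definition cell (n : nat) (g : G) : nat := choice.pickle (cell_code n g).

(** The sum norm bounds the distance of two centers in a cell by [d / n.+1];
    the numerator [d.+1] makes the bound valid for radii and weights too. *)
Definition mesh (n : nat) : R := d.+1%:R / n.+1%:R.

Lemma mesh_cvg (c e : R) : 0 <= c -> 0 < e -> \forall n \near \oo, c * mesh n <= e.
Proof.
move=> c0 e0; near=> n; rewrite /mesh mulrA ler_pdivrMr// mulrC -ler_pdivrMl//.
apply: (@le_trans _ _ n%:R); last by rewrite ler_nat.
near: n; exact: nbhs_infty_ger.
Unshelve. all: by end_near. Qed.

Lemma floor_near (n : nat) (a b : R) : Num.floor (n.+1%:R * a) = Num.floor (n.+1%:R * b) ->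
  `|a - b| <= n.+1%:R^-1.
Proof.
move=> ab; have n0 : 0 < n.+1%:R :> R by [].
have := floor_le (n.+1%:R * a); have := floorD1_gt (n.+1%:R * a).
have := floor_le (n.+1%:R * b); have := floorD1_gt (n.+1%:R * b).
rewrite ab intrD; set m := (_ : int)%:~R => b1 b2 a1 a2.
rewrite -(ler_pM2l n0) mulfV ?gt_eqF// -[X in X * `|_|](ger0_norm (ltW n0)) -normrM.
by rewrite ler_norml mulrBr; apply/andP; split; lra.
Qed.

Lemma cell_near n g h : cell n g = cell n h -> near_grain (mesh n) g h.
Proof.
move=> /(pcan_inj choice.pickleK) E.
have Hr := congr1 (fun p => p.1.2) E; have Hw := congr1 snd E.
have H : n.+1%:R^-1 <= mesh n by rewrite /mesh -[leLHS]mul1r ler_wpM2r// ler1n.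
split.
- apply: (le_trans (edist_le_sum _ _)).
  apply: (@le_trans _ _ (\sum_(i < d) n.+1%:R^-1)).
    apply: ler_sum => i _; apply: floor_near.
    by have := congr1 (fun p => tnth p.1.1 i) E; rewrite /= !tnth_mktuple.
  by rewrite sumr_const card_ord /mesh -[_ *+ d]mulr_natl ler_wpM2r// ler_nat.
- exact: le_trans (floor_near Hr) H.
- exact: le_trans (floor_near Hw) H.
Qed.

Lemma measurable_cell n i : measurable [set g | cell n g = i].
Proof.
have mfl (f : G -> mR) (z : int) : measurable_fun setT f ->
    measurable [set g | Num.floor (f g) = z].
  move=> mf; rewrite (_ : [set g | _] = [set g | z%:~R <= f g] `&` [set g | f g < (z + 1)%:~R]).
    by apply: measurableI; [apply: measurable_le_set|apply: measurable_lt_set].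
  apply/seteqP; split => g /=.
    by move=> <-; rewrite floor_le floorD1_gt.
  by move=> [? ?]; apply: floor_def; apply/andP.
have [[[[t r] w] <-]|Hi] := pselect (exists c, choice.pickle (c : d.-tuple int * int * int) = i).
  rewrite (_ : [set g | _] =
    \bigcap_(k in [set: 'I_d]) [set g | Num.floor (n.+1%:R * tnth (center g) k) = tnth t k] `&`
    ([set g | Num.floor (n.+1%:R * radius g) = r] `&`
     [set g | Num.floor (n.+1%:R * weight g) = w])).
    apply: measurableI; last apply: measurableI.
    - apply: fin_bigcap_measurable => // k _; apply: mfl; apply: measurable_funM => //.
      apply: measurable_tnth_comp; exact: measurable_center.
    - apply: mfl; apply: measurable_funM => //; exact: measurable_radius.
    - apply: mfl; apply: measurable_funM => //; exact: measurable_weight.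
  apply/seteqP; split => g /=.
    move=> /(pcan_inj choice.pickleK) E; split; [|split].
    - by move=> k _; have := congr1 (fun p => tnth p.1.1 k) E; rewrite /= tnth_mktuple.
    - by have := congr1 (fun p => p.1.2) E.
    - by have := congr1 snd E.
  move=> [Ht [Hr Hw]]; congr choice.pickle; rewrite /cell_code Hr Hw; congr (_, _, _).
  by apply: eq_from_tnth => k; rewrite tnth_mktuple; exact: Ht.
rewrite (_ : [set g | _] = set0)//; rewrite -subset0 => g /= gi.
by apply: Hi; exists (cell_code n g).
Qed.

Definition rep (n i : nat) : G := xget (origin, 0, 0) [set g | cell n g = i].

Lemma rep_near n g : near_grain (mesh n) (rep n (cell n g)) g.
Proof.
apply: cell_near; rewrite /rep.
by case: xgetP => [h _ //|/(_ g)/=].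
Qed.

(** Outer approximation of [kills 0 g] that depends on the cell of [g] only;
    the slack [2 * mesh] pays for replacing [g] by the representative of its
    cell. *)
Definition cell_kills (n i : nat) : set G := kills (2 * mesh n) (rep n i).

Lemma cell_kills_sup n g h : kills 0 g h -> cell_kills n (cell n g) h.
Proof.
move=> H; rewrite /cell_kills -[2 * _]add0r; apply: kills_near_l H.
exact: near_grainC (rep_near n g).
Qed.

Lemma cell_kills_sub n g h : cell_kills n (cell n g) h -> kills (4 * mesh n) g h.
Proof.
move=> H; have := kills_near_l (rep_near n g) H.
by congr kills; ring.
Qed.

(** The cell is removed because a grain competes with the other grains only;
    the set thus becomes disjoint from the cell, so that its emptiness is
    independent of the number of points in the cell. *)
Definition void_set n i : set G := cell_kills n i `\` [set h | cell n h = i].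

Lemma near_grain_eq g h : (forall e, 0 < e -> near_grain e g h) -> g = h.
Proof.
move=> H; case: g h H => [[x r] w] [[x' r'] w'] H.
have -> : x = x'.
  apply: edist_eq0; apply/ler_addgt0Pr => e /H[+ _ _]; rewrite add0r; exact.
have -> : r = r'.
  apply/eqP; rewrite -subr_eq0 -normr_le0; apply/ler_addgt0Pr => e /H[_ + _].
  by rewrite add0r.
have -> // : w = w'.
apply/eqP; rewrite -subr_eq0 -normr_le0; apply/ler_addgt0Pr => e /H[_ _ +].
by rewrite add0r.
Qed.

Lemma cell_sep g h : g <> h -> \forall n \near \oo, cell n g <> cell n h.
Proof.
move=> gh; have [[e [e0 ne]]|H] := pselect (exists e, 0 < e /\ ~ near_grain e g h).
  near=> n; move=> /cell_near [H1 H2 H3]; apply: ne.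
  have ne : 1 * mesh n <= e by near: n; exact: mesh_cvg.
  rewrite mul1r in ne.
  by split; [exact: le_trans H1 ne|exact: le_trans H2 ne|exact: le_trans H3 ne].
exfalso; apply: gh; apply: near_grain_eq => e e0; apply: contrapT => ne.
by apply: H; exists e.
Unshelve. all: by end_near. Qed.

Lemma kills_out g h : ~ kills 0 g h -> exists2 e, 0 < e & ~ kills e g h.
Proof.
move=> nk; apply: contrapT => H; apply: nk; apply: kills_lim => e e0.
by apply: contrapT => ne; apply: H; exists e.
Qed.

End kills.

Lemma near_finite_set (T : choiceType) (S : set T) (P : T -> nat -> Prop) : finite_set S ->
  (forall x, S x -> \forall n \near \oo, P x n) ->
  \forall n \near \oo, forall x, S x -> P x n.
Proof.
move=> /finite_seqP[s ->]; elim: s => [|y s IH] H; first by near=> n.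
have H1 : \forall n \near \oo, P y n by apply: H; rewrite /= mem_head.
have {IH}H2 : \forall n \near \oo, forall x, [set` s] x -> P x n.
  by apply: IH => x xs; apply: H; rewrite /= inE xs orbT.
near=> n => x; rewrite /= inE => /predU1P[->|xs]; first by near: n.
by move: x xs; near: n.
Unshelve. all: by end_near. Qed.

(** * Counting measure and Poisson moments *)

Lemma counting_eq0 (T : choiceType) (R : realType) (A : set T) :
  counting A = 0%E :> \bar R <-> A = set0.
Proof.
split=> [|->]; last by rewrite /counting asboolT// fset_set0.
rewrite /counting; case: asboolP => // fA /eqP.
by rewrite eqe pnatr_eq0 cardfs_eq0 => /eqP/fset_set_set0; exact.
Qed.

Lemma counting_ge0 (T : choiceType) (R : realType) (A : set T) :
  (0 <= counting A :> \bar R)%E.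
Proof. by rewrite /counting; case: ifPn; rewrite ?lee_fin// lee_pinfty. Qed.

Lemma counting_lty (T : choiceType) (R : realType) (A : set T) :
  (counting A < +oo :> \bar R)%E <-> finite_set A.
Proof. by rewrite /counting; case: asboolP => // fA; split => // _; rewrite ltry. Qed.

Lemma counting_natP (T : choiceType) (R : realType) (A : set T) :
  (exists k : nat, counting A = k%:R%:E :> \bar R) \/ counting A = +oo%E :> \bar R.
Proof.
by rewrite /counting; case: asboolP => fA; [left; exists (#|` fset_set A|)|right].
Qed.

Lemma counting_setI (T : choiceType) (R : realType) (S C : set T) : finite_set S ->
  counting (S `&` C) = (\sum_(g <- fset_set S) (g \in C)%:R)%:E :> \bar R.
Proof.
move=> fS; have fSC : finite_set (S `&` C) by exact: finite_setIl.
rewrite /counting asboolT// -natr_sum; congr (_%:R%:E).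
have pe : perm_eq (fset_set (S `&` C)) [seq g <- fset_set S | g \in C].
  apply: uniq_perm; rewrite ?filter_uniq ?fset_uniq// => g.
  rewrite mem_filter !in_fset_set// in_setI andbC//.
rewrite (perm_size pe) size_filter -sum1_count big_mkcond/=.
by apply: eq_bigr => g _; case: (g \in C).
Qed.

Section expectations.
Local Open Scope ereal_scope.
Context d (T : measurableType d) (R : realType) (P : probability T R).

Lemma poisson_sum1 (x : R) : (0 <= x)%R ->
  \sum_(k <oo) (expR (- x) * x ^+ k / k`!%:R)%:E = 1.
Proof.
move=> x0; rewrite [RHS](_ : _ = (expR (- x))%:E * (expR x)%:E); last first.
  by rewrite -EFinM expRN mulVf ?gt_eqF ?expR_gt0.
under eq_eseriesr do rewrite -mulrA EFinM.
rewrite nneseriesZl/=; last by move=> n _; rewrite lee_fin divr_ge0// exprn_ge0.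
congr *%E; rewrite -EFin_lim; last exact: is_cvg_series_exp_coeff.
by apply/congr_lim/funext => n/=; rewrite /series/= -sumEFin.
Qed.

Lemma poisson_sum_mean (x : R) : (0 <= x)%R ->
  \sum_(k <oo) (k%:R * (expR (- x) * x ^+ k / k`!%:R))%:E = x%:E.
Proof.
move=> x0; have t0 k : (0 <= expR (- x) * x ^+ k / k`!%:R)%R.
  by rewrite divr_ge0// mulr_ge0 ?expR_ge0// exprn_ge0.
rewrite nneseries_recl//; last by move=> k _; rewrite lee_fin mulr_ge0.
rewrite mul0r add0e -(nneseries_addn (f := fun k => (k%:R * _)%:E)); last first.
  by move=> k; rewrite lee_fin mulr_ge0.
rewrite -[RHS]mule1 -(poisson_sum1 x0) -nneseriesZl; last by move=> k _; rewrite lee_fin.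
apply: eq_eseriesr => k _; rewrite -EFinM addn1 factS exprS natrM; congr EFin.
by field; rewrite pnatr_eq0 -lt0n fact_gt0 /= addrC natr1 pnatr_eq0.
Qed.

Lemma poisson_sum_sqr_lty (x : R) : (0 <= x)%R ->
  \sum_(k <oo) (k%:R ^+ 2 * (expR (- x) * x ^+ k / k`!%:R))%:E < +oo.
Proof.
move=> x0; have t0 k : (0 <= expR (- x) * x ^+ k / k`!%:R)%R.
  by rewrite divr_ge0// mulr_ge0 ?expR_ge0// exprn_ge0.
rewrite nneseries_recl//; last by move=> k _; rewrite lee_fin mulr_ge0.
rewrite expr0n mul0r add0e -(nneseries_addn (f := fun k => (k%:R ^+ 2 * _)%:E)); last first.
  by move=> k; rewrite lee_fin mulr_ge0.
pose a k := (k%:R * (expR (- x) * x ^+ k / k`!%:R))%:E.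
pose b k := (expR (- x) * x ^+ k / k`!%:R)%:E.
rewrite (eq_eseriesr (g := fun k => x%:E * (a k + b k))); last first.
  move=> k _; rewrite /a /b -EFinD -EFinM addn1 factS (exprS x) natrM -natr1; congr EFin.
  by field; rewrite pnatr_eq0 -lt0n fact_gt0 /= natr1 pnatr_eq0.
have a0 k : 0 <= a k by rewrite lee_fin mulr_ge0.
have b0 k : 0 <= b k by rewrite lee_fin.
rewrite nneseriesZl; last by move=> k _; rewrite adde_ge0.
by rewrite nneseriesD// /a /b poisson_sum_mean// poisson_sum1// -EFinD -EFinM ltry.
Qed.

Definition above (k : nat) : set (\bar R) := [set y | (k%:R%:E < y)%E].

Lemma aboveE k (x : \bar R) : \1_(above k) x = ((k%:R%:E < x)%E)%:R :> R.
Proof. by rewrite indicE; congr (_%:R); congr nat_of_bool; apply/idP/idP; rewrite inE. Qed.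

(** Writes a count as a sum of indicators, so that independence of events is
    enough to compute expectations of products of counts. *)
Lemma nat_tail_sum (x : \bar R) : (exists k : nat, x = k%:R%:E) \/ x = +oo ->
  x = \sum_(k <oo) (\1_(above k) x)%:E.
Proof.
case=> [[n ->]|->]; last first.
  apply/esym; rewrite (eq_eseriesr (g := fun=> 1%:E)) => [|k _]; last first.
    by rewrite aboveE ltry.
  apply/cvg_lim => //; rewrite (_ : (fun n => _) = (fun n => n%:R%:E)).
    by apply/cvgenyP; exact: cvg_id.
  by apply/funext => n; rewrite sumEFin big_const_nat subn0 iter_addr_0.
rewrite (nneseries_split 0 n)// add0n [X in _ + X]eseries0 ?adde0.
  rewrite big_mkord (eq_bigr (fun=> 1%:E)) => [|i _].
    by rewrite sumEFin sumr_const card_ord.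
  by rewrite aboveE lte_fin ltr_nat ltn_ord.
by move=> i ni _; rewrite aboveE lte_fin ltr_nat ltnNge ni.
Qed.

End expectations.

(** * Void probabilities and passage to the limit of the cells *)

Lemma nneseries_single (R : realType) (f : nat -> \bar R) k :
  (forall i, 0 <= f i)%E -> (forall i, i != k -> f i = 0%E) ->
  (\sum_(i <oo) f i = f k)%E.
Proof.
move=> f0 fk; rewrite (nneseriesD1 (n := k))// eseries0 ?adde0//.
by move=> i _ /fk.
Qed.

Lemma sum_cells_seq (R : realType) (T : eqType) (s : seq T) (q : T -> nat) (f : nat -> \bar R) :
  (forall k, (0 <= f k)%E) ->
  (\sum_(k <oo) (\sum_(g <- s) (q g == k)%:R)%:E * f k = \sum_(g <- s) f (q g))%E.
Proof.
move=> f0.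
transitivity (\sum_(k <oo) \sum_(g <- s) ((q g == k)%:R%:E * f k))%E.
  by apply: eq_eseriesr => k _; rewrite -sumEFin ge0_sume_distrl.
rewrite nneseries_sum//; last by move=> g k _; rewrite mule_ge0.
apply: eq_bigr => g _; rewrite (nneseries_single (k := q g)).
- by rewrite eqxx mul1e.
- by move=> k; rewrite mule_ge0.
- by move=> k; rewrite eq_sym => /negbTE ->; rewrite mul0e.
Qed.

Lemma counting_cell (R : realType) (T : choiceType) (S : set T) (q : T -> nat) k :
  finite_set S -> counting (S `&` [set g | q g = k]) =
  (\sum_(g <- fset_set S) (q g == k)%:R)%:E :> \bar R.
Proof.
move=> fS; rewrite counting_setI//; congr (_%:E); apply: eq_bigr => g _.
congr (_%:R); congr nat_of_bool.
by apply/idP/idP => [/set_mem ->//|/eqP H]; exact/mem_set.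
Qed.

Lemma sum_cells (R : realType) (T : choiceType) (S : set T) (q : T -> nat)
    (f : nat -> \bar R) : finite_set S -> (forall k, (0 <= f k)%E) ->
  (\sum_(k <oo) counting (S `&` [set g | q g = k]) * f k = \sum_(g <- fset_set S) f (q g))%E.
Proof.
move=> fS f0; rewrite -(sum_cells_seq _ q f0).
by apply: eq_eseriesr => k _; rewrite counting_cell.
Qed.

Section poisson_facts.
Context (R : realType) (d : nat) (dO : measure_display) (Omega : measurableType dO)
  (P : probability Omega R) (Phi : Omega -> set (grain R d)).
Local Notation G := (grain R d).
Variable L : {sigma_finite_measure set G -> \bar R}.
Hypothesis HP : poisson_random_measure P Phi L.
Local Notation N := (npoints Phi).
Local Open Scope ereal_scope.

Lemma npoints_natP B w : (exists k : nat, N B w = k%:R%:E) \/ N B w = +oo.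
Proof. exact: counting_natP. Qed.

Lemma npoints_ge0 B w : 0 <= N B w. Proof. exact: counting_ge0. Qed.

Lemma measurable_npoints_set B C : measurable B -> measurable C ->
  measurable [set w | C (N B w)].
Proof. by move=> mB mC; exact: (measurable_setP (prm_measurable HP mB) mC). Qed.

Lemma measurable_above k : measurable (above k : set (\bar R)).
Proof.
rewrite (_ : (above k : set (\bar R)) = [set` `]k%:R%:E, +oo[%O ]).
  exact: emeasurable_itv.
by apply/seteqP; split => y; rewrite /above /= in_itv/= andbT.
Qed.

Lemma npoints_partition B : [set: Omega] =
  \bigcup_k [set w | N B w = k%:R%:E] `|` [set w | N B w = +oo].
Proof.
apply/esym; rewrite -subTset => w _; have [[k Nk]|] := npoints_natP B w; last by right.
by left; exists k.
Qed.

Lemma natval_trivIset B : trivIset setT (fun k : nat => [set w | N B w = k%:R%:E]).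
Proof.
apply/trivIsetP => i j _ _ ij; rewrite -subset0 => w /= [-> /eqP].
by rewrite eqe eqr_nat (negbTE ij).
Qed.

Lemma P_npoints_infty B : measurable B -> L B < +oo -> P [set w | N B w = +oo] = 0.
Proof.
move=> mB LB; have mk k : measurable [set w | N B w = k%:R%:E].
  by apply: (measurable_npoints_set (C := [set k%:R%:E]) mB).
have moo : measurable [set w | N B w = +oo].
  by apply: (measurable_npoints_set (C := [set +oo]) mB).
have mU : measurable (\bigcup_k [set w | N B w = k%:R%:E]) by exact: bigcup_measurable.
have dj : (\bigcup_k [set w | N B w = k%:R%:E]) `&` [set w | N B w = +oo] = set0.
  by rewrite -subset0 => w /= [[k _ ->]].
have : P setT = \sum_(k <oo) P [set w | N B w = k%:R%:E] + P [set w | N B w = +oo].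
  rewrite {1}(npoints_partition B).
  transitivity (P (\bigcup_k [set w | N B w = k%:R%:E]) + P [set w | N B w = +oo]).
    exact: measureU.
  by congr (_ + _); apply: measure_semi_bigcup => //; exact: natval_trivIset.
rewrite probability_setT (eq_eseriesr (fun k _ => prm_poisson HP mB LB k)).
rewrite poisson_sum1; last by rewrite fine_ge0.
have := fin_num_measure P _ moo; case: (P _) => [r _|//|//].
by move=> [E]; congr EFin; apply: (@addrI _ 1%R); rewrite addr0.
Qed.

Lemma ae_finite B : measurable B -> L B < +oo ->
  {ae P, forall w, finite_set (Phi w `&` B)}.
Proof.
move=> mB LB; exists [set w | N B w = +oo]; split.
- by apply: (measurable_npoints_set (C := [set +oo]) mB).
- exact: P_npoints_infty.
- move=> w /= nf; apply/eqP; rewrite -leye_eq leNgt; apply/negP => /counting_lty; exact: nf.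
Qed.

Lemma E_npoints_fun B (h : \bar R -> \bar R) (a : nat -> R) :
  measurable B -> L B < +oo -> (forall k, 0 <= a k)%R ->
  (forall k, h k%:R%:E = (a k)%:E) -> (forall y, 0 <= y -> 0 <= h y) ->
  measurable_fun setT (fun w => h (N B w)) ->
  \int[P]_w h (N B w) =
  \sum_(k <oo) (a k * (expR (- fine (L B)) * fine (L B) ^+ k / k`!%:R))%:E.
Proof.
move=> mB LB a0 ha h0 mh; have mk k : measurable [set w | N B w = k%:R%:E].
  by apply: (measurable_npoints_set (C := [set k%:R%:E]) mB).
pose f k w : \bar R := (a k * \1_[set w | N B w = k%:R%:E] w)%:E.
have mf k : measurable_fun setT (f k).
  by apply/measurable_EFinP; apply: measurable_funM => //; exact: measurable_indic.
have f0 k w : 0 <= f k w by rewrite lee_fin mulr_ge0.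
transitivity (\int[P]_w \sum_(k <oo) f k w).
  apply: ge0_ae_eq_integral => //.
  - by apply: ge0_emeasurable_sum.
  - by move=> w _; apply: h0; exact: npoints_ge0.
  - by move=> w _; exact: nneseries_ge0.
  exists [set w | N B w = +oo]; split.
  - by apply: (measurable_npoints_set (C := [set +oo]) mB).
  - exact: P_npoints_infty.
  - move=> w /= nf; have [[k Nk]|//] := npoints_natP B w; exfalso; apply: nf => _.
    rewrite (nneseries_single (k := k))//; first by rewrite /f indicE mem_set//= mulr1 Nk ha.
    move=> i /negP ik; rewrite /f indicE memNset ?mulr0//= Nk => -[] /eqP.
    by rewrite eqr_nat eq_sym => /ik.
rewrite integral_nneseries//.
apply: eq_eseriesr => k _; rewrite /f; under eq_integral do rewrite EFinM.
rewrite ge0_integralZl//.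
- rewrite integral_indic_setT// EFinM; congr (_ * _).
  exact: (prm_poisson HP mB LB k).
- by apply/measurable_EFinP; exact: measurable_indic.
- by rewrite lee_fin.
Qed.

Lemma E_npoints B : measurable B -> L B < +oo -> \int[P]_w N B w = L B.
Proof.
move=> mB LB; rewrite -[RHS]fineK ?ge0_fin_numE// -poisson_sum_mean ?fine_ge0//.
apply: (E_npoints_fun (h := id) (a := fun k => k%:R)) => //.
exact: (prm_measurable HP mB).
Qed.

Lemma E_npoints_sqr_lty B : measurable B -> L B < +oo ->
  \int[P]_w (N B w * N B w) < +oo.
Proof.
move=> mB LB.
rewrite (E_npoints_fun (h := fun y => y * y) (a := fun k => (k%:R ^+ 2)%R)) => //.
- by rewrite poisson_sum_sqr_lty// fine_ge0.
- by move=> y y0; rewrite mule_ge0.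
- by apply: emeasurable_funM; exact: (prm_measurable HP mB).
Qed.

Lemma indep3 (B1 B2 B3 : set G) (C1 C2 C3 : set \bar R) :
  measurable B1 -> measurable B2 -> measurable B3 ->
  measurable C1 -> measurable C2 -> measurable C3 ->
  B1 `&` B2 = set0 -> B1 `&` B3 = set0 -> B2 `&` B3 = set0 ->
  P [set w | [/\ C1 (N B1 w), C2 (N B2 w) & C3 (N B3 w)]] =
  P [set w | C1 (N B1 w)] * P [set w | C2 (N B2 w)] * P [set w | C3 (N B3 w)].
Proof.
move=> mB1 mB2 mB3 mC1 mC2 mC3 B12 B13 B23.
pose B (i : 'I_3) := nth set0 [:: B1; B2; B3] i.
pose C (i : 'I_3) := nth set0 [:: C1; C2; C3] i.
have mB i : measurable (B i) by case: i => [[|[|[|]]]].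
have mC i : measurable (C i) by case: i => [[|[|[|]]]].
have tB : trivIset [set: 'I_3] B.
  by apply/trivIsetP => -[[|[|[|//]]] ?] [[|[|[|//]]] ?] //= _ _ _; rewrite /B/= 1?setIC.
have := prm_independent HP mB tB mC.
rewrite !big_ord_recl big_ord0 mule1 muleA => <-; congr (P _).
apply/seteqP; split => w /=.
  by move=> [? ? ?] [[|[|[|]]]].
move=> H; split.
- exact: (H ord0).
- exact: (H (lift ord0 ord0)).
- exact: (H (lift ord0 (lift ord0 ord0))).
Qed.

Lemma P_void B : measurable B -> L B < +oo ->
  P [set w | N B w = 0] = (expR (- fine (L B)))%:E.
Proof.
by move=> mB LB; rewrite (prm_poisson HP mB LB 0) expr0 mulr1 fact0 divr1.
Qed.

Definition void_ind (V : set G) w : \bar R := (\1_[set w | N V w = 0] w)%:E.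

Lemma measurable_void_ind V : measurable V -> measurable_fun setT (void_ind V).
Proof.
move=> mV; apply/measurable_EFinP; apply: measurable_indic.
by apply: (measurable_npoints_set (C := [set 0]) mV).
Qed.

Lemma npoints_tail_sum B w : N B w = \sum_(k <oo) (\1_[set w | above k (N B w)] w)%:E.
Proof. exact: (nat_tail_sum (npoints_natP B w)). Qed.

Lemma E_tail_sum B : measurable B -> L B < +oo ->
  \sum_(k <oo) P [set w | above k (N B w)] = L B.
Proof.
move=> mB LB; rewrite -(E_npoints mB LB).
under [RHS]eq_integral do rewrite npoints_tail_sum.
have mk k : measurable [set w | above k (N B w)].
  by apply: measurable_npoints_set => //; exact: measurable_above.
rewrite integral_nneseries//; first by apply: eq_eseriesr => k _; rewrite integral_indic_setT.
by move=> k; apply/measurable_EFinP; exact: measurable_indic.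
Qed.

(** The counts are replaced by their tail sums, and the independence of
    counts in disjoint sets is applied term by term. *)
Lemma E_npoints2_void B1 B2 V : measurable B1 -> measurable B2 -> measurable V ->
  L B1 < +oo -> L B2 < +oo -> L V < +oo ->
  B1 `&` B2 = set0 -> B1 `&` V = set0 -> B2 `&` V = set0 ->
  \int[P]_w (N B1 w * N B2 w * void_ind V w) = L B1 * L B2 * (expR (- fine (L V)))%:E.
Proof.
move=> mB1 mB2 mV LB1 LB2 LV B12 B1V B2V.
have mk B k : measurable B -> measurable [set w | above k (N B w)].
  by move=> mB; apply: measurable_npoints_set => //; exact: measurable_above.
have mVs : measurable [set w | N V w = 0].
  by apply: (measurable_npoints_set (C := [set 0]) mV).
pose A k l := [set w | [/\ above k (N B1 w), above l (N B2 w) & [set 0] (N V w)]].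
have mA k l : measurable (A k l).
  rewrite (_ : A k l = [set w | above k (N B1 w)] `&` ([set w | above l (N B2 w)] `&` [set w | N V w = 0])).
    by apply: measurableI; [exact: mk|apply: measurableI => //; exact: mk].
  by apply/seteqP; split => w [] // ? [].
have mI k l : measurable_fun setT (fun w => (\1_(A k l) w)%:E : \bar R).
  by apply/measurable_EFinP; exact: measurable_indic.
have mI1 k : measurable_fun setT (fun w => \sum_(l <oo) (\1_(A k l) w)%:E : \bar R).
  by apply: ge0_emeasurable_sum.
transitivity (\int[P]_w \sum_(k <oo) \sum_(l <oo) (\1_(A k l) w)%:E).
  (* outside a null set both counts are finite, so that real arithmetic applies *)
  have fin12 : {ae P, forall w, finite_set (Phi w `&` B1) /\ finite_set (Phi w `&` B2)}.
    have := ae_finite mB2 LB2; have := ae_finite mB1 LB1.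
    by apply: filterS2 => w.
  apply: ge0_ae_eq_integral => //.
  - apply: emeasurable_funM; last exact: measurable_void_ind.
    by apply: emeasurable_funM; exact: (prm_measurable HP).
  - by apply: ge0_emeasurable_sum => // k w _ _; exact: nneseries_ge0.
  - by move=> w _; rewrite !mule_ge0 ?npoints_ge0// lee_fin.
  - by move=> w _; apply: nneseries_ge0 => k _ _; exact: nneseries_ge0.
  apply: filterS fin12 => w [f1 f2] _.
  have AE k l : \1_(A k l) w = (\1_(above k) (N B1 w) * \1_(above l) (N B2 w) *
      \1_[set w | N V w = 0] w)%R :> R.
    rewrite -!mulrA !indicE -!natrM !mulnb; congr (_%:R); congr nat_of_bool.
    apply/idP/idP => [/set_mem[h1 h2 h3]|/and3P[/set_mem h1 /set_mem h2 /set_mem h3]].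
      by apply/and3P; split; exact/mem_set.
    exact/mem_set.
  have N1E := nat_tail_sum (npoints_natP B1 w).
  have N2E := nat_tail_sum (npoints_natP B2 w).
  have F1 : N B1 w \is a fin_num by rewrite ge0_fin_numE ?npoints_ge0//; exact/counting_lty.
  have F2 : N B2 w \is a fin_num by rewrite ge0_fin_numE ?npoints_ge0//; exact/counting_lty.
  transitivity (\sum_(k <oo) (fine (N B2 w) * \1_[set w | N V w = 0%E] w)%:E * (\1_(above k) (N B1 w))%:E).
    rewrite nneseriesZl//.
    by rewrite -N1E /void_ind EFinM fineK// -muleA muleC.
  apply: eq_eseriesr => k _.
  under [RHS]eq_eseriesr => l _ do rewrite AE mulrAC EFinM.
  rewrite nneseriesZl//.
  by rewrite -N2E -[in RHS](fineK F2) -!EFinM; congr EFin; ring.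
rewrite integral_nneseries//; last by move=> k w _; exact: nneseries_ge0.
have PE B : measurable B -> forall k, P [set w | above k (N B w)] = (fine (P [set w | above k (N B w)]))%:E.
  by move=> mB k; rewrite fineK// fin_num_measure//; exact: mk.
transitivity (\sum_(k <oo) (fine (L B2) * expR (- fine (L V)))%:E * P [set w | above k (N B1 w)]).
  apply: eq_eseriesr => k _; rewrite integral_nneseries//.
  rewrite (eq_eseriesr (g := fun l => (fine (P [set w | above k (N B1 w)]) * expR (- fine (L V)))%:E *
     P [set w | above l (N B2 w)])); last first.
    move=> l _; rewrite integral_indic_setT//.
    transitivity (P [set w | above k (N B1 w)] * P [set w | above l (N B2 w)] * P [set w | [set 0] (N V w)]).
      by apply: indep3 => //; exact: measurable_above.
    rewrite (P_void mV LV) EFinM -PE// -!muleA; congr (_ * _); exact: muleC.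
  rewrite nneseriesZl// E_tail_sum// PE// -[in LHS](fineK (_ : L B2 \is a fin_num)) ?ge0_fin_numE//.
  by rewrite -!EFinM; congr EFin; ring.
rewrite nneseriesZl// E_tail_sum// EFinM fineK ?ge0_fin_numE//.
by rewrite muleC muleA.
Qed.

Lemma E_npoints_void B V : measurable B -> measurable V ->
  L B < +oo -> L V < +oo -> B `&` V = set0 ->
  \int[P]_w (N B w * void_ind V w) = L B * (expR (- fine (L V)))%:E.
Proof.
move=> mB mV LB LV BV.
have mk k : measurable [set w | above k (N B w)].
  by apply: measurable_npoints_set => //; exact: measurable_above.
have mVs : measurable [set w | N V w = 0].
  by apply: (measurable_npoints_set (C := [set 0]) mV).
pose A k := [set w | above k (N B w)] `&` [set w | N V w = 0].
have mA k : measurable (A k) by exact: measurableI.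
transitivity (\int[P]_w \sum_(k <oo) (\1_(A k) w)%:E).
  apply: eq_integral => w _; rewrite npoints_tail_sum muleC.
  rewrite -nneseriesZl//; apply: eq_eseriesr => k _.
  by rewrite -EFinM /A indicI mulrC.
rewrite integral_nneseries//; last first.
  by move=> k; apply/measurable_EFinP; exact: measurable_indic.
rewrite -(E_tail_sum mB LB) muleC -nneseriesZl//.
apply: eq_eseriesr => k _; rewrite integral_indic_setT// muleC.
have B0 (S : set G) : S `&` set0 = set0 by rewrite setI0.
have := indep3 mB mV measurable0 (measurable_above k) (emeasurable_set1 0) measurableT BV (B0 _) (B0 _).
rewrite [X in _ * X](_ : _ = 1) ?mule1; last first.
  by rewrite -[RHS](probability_setT P); congr (P _); apply/seteqP; split.
rewrite -(P_void mV LV) => <-; congr (P _).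
by apply/seteqP; split => w; [move=> [? ?]|move=> []].
Qed.
End poisson_facts.

Section void_formula.
Context (R : realType) (dO : measure_display) (Omega : measurableType dO)
  (P : probability Omega R) (dY : measure_display) (Y : measurableType dY)
  (LY : {measure set Y -> \bar R}).
Local Open Scope ereal_scope.

Lemma measurable_cell_fun (q : Y -> nat) (f : nat -> \bar R) :
  (forall k, measurable [set y | q y = k]) -> measurable_fun setT (fun y => f (q y)).
Proof.
move=> mq _ C mC; rewrite setTI.
rewrite (_ : _ @^-1` C = \bigcup_(k in [set k | C (f k)]) [set y | q y = k]).
  exact: bigcup_measurable.
by apply/seteqP; split => y /=; [move=> H; exists (q y)|move=> [k /= Ck ->]].
Qed.

Lemma integral_cell_fun (B : set Y) (q : Y -> nat) (f : nat -> \bar R) :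
  measurable B -> (forall k, measurable [set y | q y = k]) -> (forall k, 0 <= f k) ->
  \int[LY]_(y in B) f (q y) = \sum_(k <oo) f k * LY (B `&` [set y | q y = k]).
Proof.
move=> mB mq f0.
have BE : B = \bigcup_k (B `&` [set y | q y = k]).
  by apply/seteqP; split => [y By|y [k _ []]//]; exists (q y).
rewrite [in LHS]BE ge0_integral_bigcup//.
- apply: eq_eseriesr => k _.
  rewrite (eq_integral (fun=> f k)) => [|y /[!inE] -[_ <-]//].
  by rewrite integral_cst//; exact: measurableI.
- by move=> k; exact: measurableI.
- by apply: measurable_funTS; exact: measurable_cell_fun.
- apply/trivIsetP => i j _ _ ij; rewrite -subset0 => y [[_ yi] [_ yj]].
  by move/eqP: ij; apply; transitivity (q y); [exact: esym yi|exact: yj].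
Qed.

(** Passage from cells to points. The random variable [X n k] belongs to the
    cell number [k] of the [n]-th partition, with expectation [e_ n k] times
    the mass of the cell; the sums over the cells converge to the indicator
    of [E] under an integrable bound [D], while the step functions [e_ n \o
    q n] converge to [e]. The same argument serves for single grains and for
    pairs. *)
Lemma void_formula (B : set Y) (q : nat -> Y -> nat) (e_ : nat -> nat -> R) (e : Y -> R)
    (X : nat -> nat -> Omega -> \bar R) (D : Omega -> \bar R) (E : set Omega) :
  measurable B -> LY B < +oo -> (forall n k, measurable [set y | q n y = k]) ->
  (forall n k, (0 <= e_ n k <= 1)%R) ->
  (forall y, B y -> e_ n (q n y) @[n --> \oo] --> e y) ->
  (forall n k, measurable_fun setT (X n k)) -> (forall n k w, 0 <= X n k w) ->
  (forall n k, \int[P]_w X n k w = (e_ n k)%:E * LY (B `&` [set y | q n y = k])) ->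
  measurable E -> measurable_fun setT D -> \int[P]_w D w < +oo -> (forall w, 0 <= D w) ->
  {ae P, forall w n, \sum_(k <oo) X n k w <= D w} ->
  {ae P, forall w, \sum_(k <oo) X n k w @[n --> \oo] --> (\1_E w)%:E} ->
  P E = \int[LY]_(y in B) (e y)%:E.
Proof.
move=> mB LB mq e01 eE mX X0 EX mE mD ID D0 XD XE.
have H1 : \int[P]_w (\sum_(k <oo) X n k w) @[n --> \oo] --> \int[P]_w (\1_E w)%:E.
  have intD : P.-integrable setT D.
    apply/integrableP; split => //.
    by under eq_integral => w _ do rewrite gee0_abs//.
  have mS n : measurable_fun setT (fun w => \sum_(k <oo) X n k w).
    by apply: ge0_emeasurable_sum.
  have XE' : {ae P, forall w, setT w -> (fun n => \sum_(k <oo) X n k w) @ \oo --> (\1_E w)%:E}.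
    by apply: filterS XE => w + _.
  have XD' : {ae P, forall w n, setT w -> `|\sum_(k <oo) X n k w| <= D w}.
    apply: filterS XD => w + n _; move=> /(_ n); rewrite gee0_abs//.
    exact: nneseries_ge0.
  have m1 : measurable_fun setT (fun w => (\1_E w)%:E : \bar R).
    by apply/measurable_EFinP; exact: measurable_indic.
  by have [] := dominated_convergence measurableT mS m1 XE' intD XD'.
have H2 : \int[LY]_(y in B) (e_ n (q n y))%:E @[n --> \oo] --> \int[LY]_(y in B) (e y)%:E.
  apply: (ge0_dominated_cvg (g := fun=> 1)) => //.
  - by move=> n; apply: measurable_funTS; apply: (measurable_cell_fun (fun k => (e_ n k)%:E) (mq n)).
  - by rewrite integral_cst// mul1e.
  - by move=> n y _; rewrite lee_fin; case/andP: (e01 n (q n y)).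
  - by move=> n y _; rewrite lee_fin; case/andP: (e01 n (q n y)).
  - by move=> y By; apply: cvg_EFin; [exact: nearW|exact: eE].
rewrite -(integral_indic_setT P mE) -(cvg_lim _ H1)// -(cvg_lim _ H2)//.
congr (limn _).
apply/funext => n; rewrite integral_nneseries//.
rewrite (integral_cell_fun (f := fun k => (e_ n k)%:E) mB (mq n)).
  by apply: eq_eseriesr => k _; exact: EX.
by move=> k; rewrite lee_fin; case/andP: (e01 n k).
Qed.

End void_formula.

(** * Convergence of the discretized killing sets *)

Section set_convergence.
Context (d0 : measure_display) (T : measurableType d0) (R : realType).

(** Convergence of sets at each point separately. Together with a finite
    window it becomes equality on a locally finite configuration
    ([set_cvg_finite]) and convergence of measures ([set_cvg_measure]). *)
Definition set_cvg (V_ : nat -> set T) (V : set T) :=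
  forall h, \forall n \near \oo, V_ n h <-> V h.

Lemma set_cvgU V_ V V_' V' : set_cvg V_ V -> set_cvg V_' V' ->
  set_cvg (fun n => V_ n `|` V_' n) (V `|` V').
Proof.
move=> H H' h; near=> n.
have h1 : V_ n h <-> V h by near: n; exact: H.
have h2 : V_' n h <-> V' h by near: n; exact: H'.
by rewrite /setU /= h1 h2.
Unshelve. all: by end_near. Qed.

Lemma set_cvgD V_ V V_' V' : set_cvg V_ V -> set_cvg V_' V' ->
  set_cvg (fun n => V_ n `\` V_' n) (V `\` V').
Proof.
move=> H H' h; near=> n.
have h1 : V_ n h <-> V h by near: n; exact: H.
have h2 : V_' n h <-> V' h by near: n; exact: H'.
by rewrite /setD /= h1 h2.
Unshelve. all: by end_near. Qed.

Lemma set_cvg_finite (phi : set T) V_ V W : set_cvg V_ V -> V `<=` W ->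
  (\forall n \near \oo, V_ n `<=` W) -> finite_set (phi `&` W) ->
  \forall n \near \oo, phi `&` V_ n = phi `&` V.
Proof.
move=> VV VW VnW fin; have H := near_finite_set fin (fun h _ => VV h).
near=> n.
have Hn : forall h, (phi `&` W) h -> V_ n h <-> V h by near: n.
have Wn : V_ n `<=` W by near: n.
apply/seteqP; split => h [ph hh]; split => //.
  by apply/(Hn h) => //; split => //; exact: Wn.
by apply/(Hn h) => //; split => //; exact: VW.
Unshelve. all: by end_near. Qed.

Lemma set_cvg_measure (L : {measure set T -> \bar R}) V_ V W :
  set_cvg V_ V -> (\forall n \near \oo, V_ n `<=` W) ->
  (forall n, measurable (V_ n)) -> measurable V -> measurable W ->
  (L W < +oo)%E -> L (V_ n) @[n --> \oo] --> L V.
Proof.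
move=> VV [N _ VnW] mVn mV mW LW.
rewrite -(cvg_shiftn N) -(integral_indic_setT L mV).
under eq_fun do rewrite -(integral_indic_setT L (mVn _)).
apply: (ge0_dominated_cvg (g := fun x => (\1_W x)%:E)) => //.
- by move=> n; apply/measurable_EFinP; exact: measurable_indic.
- by apply/measurable_EFinP; exact: measurable_indic.
- by rewrite integral_indic_setT.
- move=> n x _; rewrite lee_fin !indicE ler_nat.
  have [xV|xV] := boolP (x \in V_ _); last by [].
  rewrite mem_set//; apply: (VnW (n + N)%N) => /=; first exact: leq_addl.
  exact: set_mem.
move=> x _; apply: cvg_EFin; first exact: nearW.
rewrite (cvg_shiftn N (fun n => \1_(V_ n) x : R)).
have H := VV x; apply: cvg_near_cst; near=> n.
have h : V_ n x <-> V x by near: n.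
rewrite !indicE; congr (_%:R); congr nat_of_bool.
by apply/idP/idP => /set_mem/h/mem_set.
Unshelve. all: by end_near. Qed.

End set_convergence.

Section void_sets.
Context (R : realType) (d : nat).
Local Notation G := (grain R d).
Implicit Types g h : G.

Lemma cell_kills_cvg g : set_cvg (fun n => cell_kills n (cell n g)) (kills 0 g).
Proof.
move=> h; have [k0|/kills_out[e e0 ne]] := pselect (kills 0 g h).
  by near=> n; split => // _; exact: cell_kills_sup.
near=> n; split => [/cell_kills_sub H|H].
  exfalso; apply: ne; apply: kills_le H; near: n; exact: mesh_cvg.
exfalso; apply: ne; apply: kills_le H; exact: ltW.
Unshelve. all: by end_near. Qed.

Lemma cell_cvg g : set_cvg (fun n => [set h | cell n h = cell n g]) [set g].
Proof.
move=> h; have [->|hg] := pselect (h = g); first by near=> n.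
near=> n; split => // /=; have : cell n h <> cell n g by near: n; exact: cell_sep.
by [].
Unshelve. all: by end_near. Qed.

Lemma cell_kills_near g : \forall n \near \oo,
  cell_kills n (cell n g) `<=` reach (radius g + 1) (center g).
Proof.
near=> n => h hh; apply: kills_sub_reach.
apply: kills_le (cell_kills_sub hh); near: n; exact: mesh_cvg.
Unshelve. all: by end_near. Qed.

Lemma kills0_sub g : kills 0 g `<=` reach (radius g + 1) (center g).
Proof. by move=> h hh; apply: kills_sub_reach; apply: kills_le hh; exact: ler01. Qed.

Lemma measurable_void_set n i : measurable (void_set n i : set G).
Proof. by apply: measurableD; [exact: measurable_kills|exact: measurable_cell]. Qed.

Lemma void_set_cvg g : set_cvg (fun n => void_set n (cell n g)) (kills 0 g `\ g).
Proof. exact: (set_cvgD (cell_kills_cvg g) (cell_cvg g)). Qed.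

Lemma void_set_near g : \forall n \near \oo,
  void_set n (cell n g) `<=` reach (radius g + 1) (center g).
Proof.
by apply: filterS (cell_kills_near g) => n H h [/H].
Qed.

(** Discretized set of the killers of at least one of two grains; both cells
    are removed, since whether the two grains kill each other is decided
    separately by [apart]. *)
Definition pair_void n i j : set G :=
  (cell_kills n i `|` cell_kills n j) `\` ([set h | cell n h = i] `|` [set h | cell n h = j]).

Lemma measurable_pair_void n i j : measurable (pair_void n i j).
Proof.
by apply: measurableD; apply: measurableU;
  [exact: measurable_kills|exact: measurable_kills|exact: measurable_cell|exact: measurable_cell].
Qed.

Lemma pair_void_cvg g1 g2 : set_cvg (fun n => pair_void n (cell n g1) (cell n g2))
  ((kills 0 g1 `|` kills 0 g2) `\` [set g1; g2]).
Proof.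
apply: set_cvgD; first exact: (set_cvgU (cell_kills_cvg g1) (cell_kills_cvg g2)).
exact: (set_cvgU (cell_cvg g1) (cell_cvg g2)).
Qed.

Lemma pair_void_near g1 g2 : \forall n \near \oo,
  pair_void n (cell n g1) (cell n g2) `<=`
  reach (radius g1 + 1) (center g1) `|` reach (radius g2 + 1) (center g2).
Proof.
have := cell_kills_near g2; have := cell_kills_near g1; apply: filterS2 => n H1 H2 h.
by move=> [[/H1|/H2] ? _]; [left|right].
Qed.

(** A condition on cells which, for a given pair of grains and a fine enough
    mesh, says that neither grain kills the other; the slack [4 * mesh]
    covers the change of both grains to representatives, so that the killing
    relation is approximated from outside and its closedness makes the limit
    exact ([apart_cvg]). *)
Definition apart n i j := `[< ~ kills (4 * mesh R d n) (rep R d n i) (rep R d n j) /\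
  ~ kills (4 * mesh R d n) (rep R d n j) (rep R d n i) >].

Lemma apart_cvg g1 g2 : \forall n \near \oo, apart n (cell n g1) (cell n g2) <->
  ~ kills 0 g1 g2 /\ ~ kills 0 g2 g1.
Proof.
have half h1 h2 : \forall n \near \oo,
    kills (4 * mesh R d n) (rep R d n (cell n h1)) (rep R d n (cell n h2)) <-> kills 0 h1 h2.
  have up n : kills 0 h1 h2 -> kills (4 * mesh R d n) (rep R d n (cell n h1)) (rep R d n (cell n h2)).
    move=> /cell_kills_sup H; have := kills_near_r (near_grainC (rep_near n h2)) (H n).
    by congr kills; ring.
  have [k0|/kills_out[e e0 ne]] := pselect (kills 0 h1 h2).
    by near=> n; split => // _; exact: up.
  near=> n; split => [H|]; last exact: up.
  exfalso; apply: ne.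
  have := kills_near_r (rep_near n h2) (kills_near_l (rep_near n h1) H).
  apply: kills_le.
  rewrite (_ : _ + _ + _ = 8 * mesh R d n); last by ring.
  near: n; exact: mesh_cvg.
have := half g2 g1; have := half g1 g2; apply: filterS2 => n H1 H2.
rewrite /apart; split => [/asboolP|?]; [|apply/asboolP]; by rewrite H1 H2.
Unshelve. all: by end_near. Qed.

End void_sets.

(** * Probability that a retained grain lies in a given set *)

Section retained.
Context (R : realType) (d : nat) (dO : measure_display) (Omega : measurableType dO)
  (P : probability Omega R) (Phi : Omega -> set (grain R d)).
Local Notation G := (grain R d).
Variable L : {sigma_finite_measure set G -> \bar R}.
Hypothesis HP : poisson_random_measure P Phi L.
Local Notation N := (npoints Phi).

Definition hits (B : set G) : set Omega := [set w | exists2 g, thin (Phi w) g & B g].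

Let U (m : nat) : set G := [set g | edist origin (center g) <= m%:R].

Let measurable_U m : measurable (U m). Proof. exact: measurable_centers. Qed.

Let finite_U w m : finite_set (Phi w `&` U m).
Proof.
apply: sub_finite_set (prm_locally_finite HP w m%:R).
by apply: setIS => g; rewrite /U /enorm /= edistC.
Qed.

Lemma measurable_npoints0 B : measurable B -> measurable [set w | N B w = 0%E].
Proof. by move=> mB; apply: (measurable_npoints_set HP (C := [set 0%E]) mB). Qed.

Lemma npoints_eq0 B w : N B w = 0%E <-> Phi w `&` B = set0.
Proof. exact: counting_eq0. Qed.

(** The event speaks of uncountably many grains. It is rewritten with
    countably many counts: for some [n] and all [m], and all fine enough
    meshes, a point of [B] with center within [n] has no discretized killer
    with center within [m]. Local finiteness makes the discretization exact
    for fine meshes, and, since only finitely many points have a center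
    within [n], one of them works for all [m]. *)
Lemma measurable_hits B : measurable B -> measurable (hits B).
Proof.
move=> mB.
pose E n m k := \bigcup_i (~` [set w | N (U n `&` B `&` [set g | cell k g = i]) w = 0%E] `&`
  [set w | N (U m `&` void_set k i) w = 0%E]).
have mE n m k : measurable (E n m k).
  apply: bigcup_measurable => i _; apply: measurableI.
    apply: measurableC; apply: measurable_npoints0.
    by apply: measurableI; [exact: measurableI|exact: measurable_cell].
  by apply: measurable_npoints0; apply: measurableI => //; exact: measurable_void_set.
have EP n m k w : E n m k w <-> exists g, [/\ Phi w g, U n g, B g &
    Phi w `&` U m `&` void_set k (cell k g) = set0].
  split=> [[i _ [/= H1 /npoints_eq0 H2]]|[g [pg Ug Bg H]]].
    have [g [pg [[Ug Bg] gi]]] : (Phi w `&` (U n `&` B `&` [set g | cell k g = i])) !=set0.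
      by apply/set0P/eqP => H; apply: H1; exact/npoints_eq0.
    by exists g; split => //; rewrite (_ : cell k g = i)// -setIA.
  exists (cell k g) => //; split; last by apply/npoints_eq0; rewrite setIA.
  move=> /= /npoints_eq0; rewrite -subset0 => /(_ g); apply.
  by split => //; split.
rewrite (_ : hits B = \bigcup_n \bigcap_m \bigcup_K \bigcap_(k in [set k | (K <= k)%N]) E n m k).
  apply: bigcup_measurable => n _; apply: bigcap_measurable => // m _.
  by apply: bigcup_measurable => K _; apply: bigcap_measurable => //; exists K => /=.
have stab w n m : \forall k \near \oo, forall g, (Phi w `&` U n) g ->
    Phi w `&` U m `&` void_set k (cell k g) = Phi w `&` U m `&` (kills 0 g `\ g).
  apply: near_finite_set => // g _.
  apply: (set_cvg_finite (void_set_cvg g) _ (void_set_near g)).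
    by move=> h [hh _]; exact: kills0_sub.
  by apply: finite_setIl; exact: finite_U.
apply/seteqP; split => w.
  move=> [g /thinP[pg vg] Bg].
  exists (Num.truncn (edist origin (center g))).+1 => //= m _.
  have Ug : U (Num.truncn (edist origin (center g))).+1 g by rewrite /U /= ltW// truncnS_gt.
  have [K _ HK] := stab w (Num.truncn (edist origin (center g))).+1 m.
  exists K => //= k /= Kk; apply/EP; exists g; split => //.
  rewrite HK// -subset0 => h [[ph _] kh].
  by rewrite -vg.
move=> [n _ Hn].
have Hm m : exists g, [/\ (Phi w `&` U n) g, B g & Phi w `&` U m `&` (kills 0 g `\ g) = set0].
  have [K _ HK] := Hn m Logic.I.
  have [K' _ HK'] := stab w n m.
  have /EP[g [pg Ug Bg H]] := HK (maxn K K') (leq_maxl _ _).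
  exists g; split => //; rewrite -[RHS]H; apply/esym.
  exact: (HK' (maxn K K') (leq_maxr _ _)).
(* the finitely many candidates are refuted at a common stage [m] *)
pose bad g m := ~ (B g /\ Phi w `&` U m `&` (kills 0 g `\ g) = set0).
have [[g [pg gall]]|nog] := pselect (exists g, (Phi w `&` U n) g /\ forall m, ~ bad g m).
  exists g; last by have /contrapT[] := gall 0%N.
  apply/thinP; split; first by case: pg.
  rewrite -subset0 => h [ph kh].
  have /contrapT[_] := gall (Num.truncn (edist origin (center h))).+1.
  rewrite -subset0 => /(_ h); apply; split => //; split => //.
  by rewrite /U /= ltW// truncnS_gt.
exfalso.
have : \forall m \near \oo, forall g, (Phi w `&` U n) g -> bad g m.
  apply: near_finite_set => // g pg.
  have [m bm] : exists m, bad g m.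
    apply: contrapT => H; apply: nog; exists g; split => // m bm.
    by apply: H; exists m.
  exists m => // m' /= mm' [Bg H]; apply: bm; split => //.
  rewrite -subset0 => h [[ph Uh] kh]; rewrite -H; split => //; split => //.
  by rewrite /U /= (le_trans Uh)// ler_nat.
move=> [M _ HM]; have [g [pg Bg H]] := Hm M.
by have := HM M (leqnn _) g pg; apply; split.
Qed.

Hypothesis L_reach : forall a x, (L (reach a x) < +oo)%E.
Hypothesis L_point : forall g, L [set g] = 0%E.

(** Retention probability of an added grain: the void probability of its
    killers. *)
Definition hprob (g : G) : R := expR (- fine (L (kills 0 g))).

Lemma L_kills_lty e g : (L (kills e g) < +oo)%E.
Proof.
apply: le_lt_trans (L_reach (radius g + e) (center g)).
apply: le_measure; rewrite ?inE; [exact: measurable_kills|exact: measurable_reach|].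
exact: kills_sub_reach.
Qed.

Lemma ae_finite_reach : {ae P, forall w, forall a x, finite_set (Phi w `&` reach a x)}.
Proof.
have H k := ae_finite HP (measurable_reach k%:R origin) (L_reach k%:R origin).
have := ae_foralln H; apply: filterS => w Hw a x.
apply: sub_finite_set (Hw (Num.truncn (a + edist x origin)).+1).
by apply: setIS; apply: reach_sub; rewrite ltW// truncnS_gt.
Qed.

(** With a diffuse intensity, excluding the grain itself from its killers
    does not change the void probability. *)
Lemma L_setD_point (A : set G) g : measurable A -> L (A `\ g) = L A.
Proof.
move=> mA; have mD : measurable (A `\ g) := measurableD mA (measurable_point g).
apply/eqP; rewrite eq_le; apply/andP; split.
  by apply: le_measure; rewrite ?inE//; exact: subDsetl.
rewrite -[leRHS]adde0 -(L_point g).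
apply: le_trans (measureU2 _ mD (measurable_point g)).
apply: le_measure; rewrite ?inE//.
  by apply: measurableU => //; exact: measurable_point.
by move=> h Ah; have [->|hg] := pselect (h = g); [right|left].
Qed.

Lemma expR_measure_cvg (V_ : nat -> set G) V W : set_cvg V_ V ->
  (\forall n \near \oo, V_ n `<=` W) ->
  (forall n, measurable (V_ n)) -> measurable V -> measurable W -> (L W < +oo)%E ->
  L V \is a fin_num ->
  expR (- fine (L (V_ n))) @[n --> \oo] --> expR (- fine (L V)).
Proof.
move=> VV VW mVn mV mW LW LV.
apply: (@cvg_comp _ _ _ _ _ _ (nbhs (- fine (L V)))); last exact: continuous_expR.
apply: cvgN; apply: fine_cvg; rewrite fineK//.
exact: (set_cvg_measure VV VW).
Qed.

Lemma void_indE V w : void_ind Phi V w = (if `[< Phi w `&` V = set0 >] then 1 else 0)%:E.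
Proof.
rewrite /void_ind indicE; case: asboolP => H.
  by rewrite mem_set//=; exact/npoints_eq0.
by rewrite memNset//= => /npoints_eq0.
Qed.

Lemma thin_unique w B g g' : (forall g g', B g -> B g' -> gball g `&` gball g' !=set0) ->
  thin (Phi w) g -> thin (Phi w) g' -> B g -> B g' -> g = g'.
Proof.
move=> BB [pg Hg] [pg' Hg'] Bg Bg'; apply: contrapT => gg'.
have h1 := Hg g' pg' (fun e => gg' (esym e)) (BB _ _ Bg' Bg).
have h2 := Hg' g pg gg' (BB _ _ Bg Bg').
by move: (lt_trans h1 h2); rewrite ltxx.
Qed.

(** Mecke formula for grains that meet pairwise: at most one of them is
    retained, so the number of retained grains in [B] is the indicator of
    [hits B], and its expectation is the integral of the retention
    probability. *)
Theorem P_hits B : measurable B -> (L B < +oo)%E ->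
  (forall g g', B g -> B g' -> gball g `&` gball g' !=set0) ->
  (P (hits B) = \int[L]_(g in B) (hprob g)%:E)%E.
Proof.
move=> mB LB BB.
apply: (@void_formula _ _ _ P _ _ L B (@cell R d)
  (fun n i => expR (- fine (L (void_set n i)))) hprob
  (fun n i w => N (B `&` [set g | cell n g = i]) w * void_ind Phi (void_set n i) w)%E
  (N B)) => //.
- by move=> n k; exact: measurable_cell.
- move=> n k; rewrite expR_ge0/= -expR0 ler_expR oppr_le0 fine_ge0//.
- move=> g Bg; rewrite /hprob -(L_setD_point g (measurable_kills 0 g)).
  apply: (expR_measure_cvg (void_set_cvg g) (void_set_near g)).
  + by move=> n; exact: measurable_void_set.
  + exact: measurableD (measurable_kills 0 g) (measurable_point g).
  + exact: measurable_reach.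
  + exact: L_reach.
  + by rewrite L_setD_point ?ge0_fin_numE ?L_kills_lty//; exact: measurable_kills.
- move=> n k; apply: emeasurable_funM.
    by apply: (prm_measurable HP); apply: measurableI => //; exact: measurable_cell.
  by apply: (measurable_void_ind HP); exact: measurable_void_set.
- by move=> n k w; rewrite mule_ge0 ?npoints_ge0// lee_fin.
- move=> n k; rewrite (E_npoints_void HP).
  + by rewrite muleC.
  + by apply: measurableI => //; exact: measurable_cell.
  + exact: measurable_void_set.
  + apply: le_lt_trans LB; apply: le_measure; rewrite ?inE//.
    by apply: measurableI => //; exact: measurable_cell.
  + apply: le_lt_trans (L_kills_lty (2 * mesh R d n) (rep R d n k)).
    apply: le_measure; rewrite ?inE; [exact: measurable_void_set|exact: measurable_kills|].
    by apply: subDsetl.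
  + by rewrite -subset0 => h [[_ hk] [_]].
- exact: measurable_hits.
- exact: (prm_measurable HP).
- by rewrite (E_npoints HP).
- have := ae_finite HP mB LB; apply: filterS => w fB n.
  under eq_eseriesr => k _ do rewrite /npoints setIA.
  rewrite (sum_cells _ fB) => [|k]; last by rewrite lee_fin.
  rewrite /npoints -[X in counting X]setIT counting_setI// -sumEFin.
  apply: lee_sum => g _; rewrite (mem_set (u := g))// /void_ind lee_fin indicE ler_nat.
  by case: (_ \in _).
- have := ae_finite_reach; have := ae_finite HP mB LB; apply: filterS2 => w fB fR.
  have H : \forall n \near \oo, forall g, (Phi w `&` B) g ->
     Phi w `&` void_set n (cell n g) = Phi w `&` (kills 0 g `\ g).
    apply: near_finite_set => // g _.
    apply: (set_cvg_finite (void_set_cvg g) _ (void_set_near g)) => //.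
    by move=> h [hh _]; exact: kills0_sub.
  apply: cvg_near_cst; near=> n.
  under eq_eseriesr => k _ do rewrite /npoints setIA.
  rewrite (sum_cells _ fB) => [|k]; last by rewrite lee_fin.
  have Hn : forall g, (Phi w `&` B) g ->
     Phi w `&` void_set n (cell n g) = Phi w `&` (kills 0 g `\ g) by near: n.
  transitivity (\sum_(g <- fset_set (Phi w `&` B)) (if `[< thin (Phi w) g >] then 1 else 0 : R)%R%:E)%E.
    rewrite !big_seq; apply: eq_bigr => g; rewrite in_fset_set// => /set_mem gB.
    rewrite void_indE Hn//; congr (if _ then _ else _)%:E.
    by apply: asbool_equiv_eq; rewrite thinP; split => [? |[]//]; split => //; case: gB.
  rewrite indicE; have [[g tg Bg]|nh] := pselect (hits B w).
    rewrite mem_set/=; last by exists g.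
    have gS : g \in fset_set (Phi w `&` B) by rewrite in_fset_set// mem_set//; case: tg.
    rewrite (bigD1_seq g)//=; last exact: fset_uniq.
    rewrite asboolT// big1_seq ?adde0// => g' /andP[gg']; rewrite in_fset_set// => /set_mem[_ Bg'].
    rewrite asboolF// => tg'; move/eqP: gg'; apply.
    exact: (thin_unique BB tg' tg).
  rewrite memNset// big1_seq// => g /andP[_]; rewrite in_fset_set// => /set_mem[_ Bg].
  by rewrite asboolF// => tg; apply: nh; exists g.
Unshelve. all: by end_near. Qed.

End retained.

(** * Probability of two different retained grains *)

Section retained_pairs.
Context (R : realType) (d : nat) (dO : measure_display) (Omega : measurableType dO)
  (P : probability Omega R) (Phi : Omega -> set (grain R d)).
Local Notation G := (grain R d).
Variable L : {sigma_finite_measure set G -> \bar R}.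
Hypothesis HP : poisson_random_measure P Phi L.
Local Notation N := (npoints Phi).
Hypothesis L_reach : forall a x, (L (reach a x) < +oo)%E.
Hypothesis L_point : forall g, L [set g] = 0%E.

Definition hits2 (B1 B2 : set G) : set Omega := [set w | exists g1 g2,
  [/\ thin (Phi w) g1, thin (Phi w) g2, B1 g1, B2 g2 & g1 <> g2]].

(** Joint retention probability of two added grains; it vanishes as soon as
    one of them kills the other. *)
Definition hprob2 (p : G * G) : R :=
  if `[< [/\ p.1 <> p.2, ~ kills 0 p.1 p.2 & ~ kills 0 p.2 p.1] >]
  then expR (- fine (L (kills 0 p.1 `|` kills 0 p.2))) else 0.

(** Pairs of cells carry a single number, so that [void_formula] applies to
    the product space. *)
Definition pair_cell (n : nat) (p : G * G) : nat := choice.pickle (cell n p.1, cell n p.2).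

(** Cells of index [i = j] get weight 0: the counts in a cell and itself are
    not independent, and distinct grains are separated by a fine mesh
    anyway. *)
Definition pair_weight (n k : nat) : R :=
  if choice.pickle_inv k is Some (i, j) then
    if (i != j) && apart R d n i j then expR (- fine (L (pair_void n i j))) else 0
  else 0.

Variables (B1 B2 : set G).

Definition pair_count (n k : nat) (w : Omega) : \bar R :=
  if choice.pickle_inv k is Some (i, j) then
    if (i != j) && apart R d n i j then
      (N (B1 `&` [set g | cell n g = i]) w * N (B2 `&` [set g | cell n g = j]) w *
       void_ind Phi (pair_void n i j) w)%E
    else 0%E
  else 0%E.

Hypotheses (mB1 : measurable B1) (mB2 : measurable B2).
Hypotheses (LB1 : (L B1 < +oo)%E) (LB2 : (L B2 < +oo)%E).

Lemma pair_cell_set n i j : [set p | pair_cell n p = choice.pickle (i, j)] =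
  [set g | cell n g = i] `*` [set g | cell n g = j].
Proof.
apply/seteqP; split => -[g1 g2]; rewrite /pair_cell /=.
  by move=> /(pcan_inj choice.pickleK)[].
by move=> [/= -> ->].
Qed.

Lemma unpickle_pairP (k : nat) : (exists i j : nat, k = choice.pickle (i, j)) \/
  (forall p : nat * nat, choice.pickle p <> k).
Proof.
have [[[i j] <-]|H] := pselect (exists p : nat * nat, choice.pickle p = k).
  by left; exists i, j.
by right => p pk; apply: H; exists p.
Qed.

Lemma measurable_pair_cell n k : measurable [set p | pair_cell n p = k].
Proof.
have [[i [j ->]]|H] := unpickle_pairP k.
  by rewrite pair_cell_set; apply: measurableX; exact: measurable_cell.
by rewrite (_ : [set p | _] = set0)// -subset0 => p /= /H.
Qed.

Lemma L_pair_void n i j : (L (pair_void n i j) < +oo)%E.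
Proof.
apply: (@le_lt_trans _ _ (L (cell_kills n i `|` cell_kills n j))).
  apply: le_measure; rewrite ?inE; [exact: measurable_pair_void| |exact: subDsetl].
  by apply: measurableU; exact: measurable_kills.
apply: le_lt_trans (measureU2 _ _ _) _; try exact: measurable_kills.
by apply: lte_add_pinfty; exact: L_kills_lty.
Qed.

Lemma hprob2_cvg p : pair_weight n (pair_cell n p) @[n --> \oo] --> hprob2 p.
Proof.
case: p => g1 g2; rewrite /hprob2 /=.
have Hw n : pair_weight n (pair_cell n (g1, g2)) =
   if (cell n g1 != cell n g2) && apart R d n (cell n g1) (cell n g2)
   then expR (- fine (L (pair_void n (cell n g1) (cell n g2)))) else 0.
  by rewrite /pair_weight /pair_cell choice.pickleK_inv.
under eq_fun do rewrite Hw.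
have ap := apart_cvg g1 g2.
have eqc := cell_cvg g2 g1.
case: asboolP => [[ng k12 k21]|H].
- have mK : measurable (kills 0 g1 `|` kills 0 g2) by apply: measurableU; exact: measurable_kills.
  have E : L ((kills 0 g1 `|` kills 0 g2) `\` [set g1; g2]) = L (kills 0 g1 `|` kills 0 g2).
    rewrite (_ : _ `\` [set g1; g2] = ((kills 0 g1 `|` kills 0 g2) `\ g1) `\ g2); last first.
      by rewrite /= setDDl.
    rewrite !L_setD_point//; exact: measurableD mK (measurable_point g1).
  have LK : (L (kills 0 g1 `|` kills 0 g2) < +oo)%E.
    apply: le_lt_trans (measureU2 _ _ _) _; try exact: measurable_kills.
    by apply: lte_add_pinfty; exact: L_kills_lty.
  have C : expR (- fine (L (pair_void n (cell n g1) (cell n g2)))) @[n --> \oo] -->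
      expR (- fine (L (kills 0 g1 `|` kills 0 g2))).
    rewrite -E; apply: (expR_measure_cvg (pair_void_cvg g1 g2) (pair_void_near g1 g2)).
    + by move=> n; exact: measurable_pair_void.
    + by apply: measurableD => //; apply: measurableU; exact: measurable_point.
    + by apply: measurableU; exact: measurable_reach.
    + apply: le_lt_trans (measureU2 _ _ _) _; try exact: measurable_reach.
      by apply: lte_add_pinfty; exact: L_reach.
    + by rewrite E ge0_fin_numE.
  apply: cvg_trans C; apply: near_eq_cvg; near=> n.
  have h1 : apart R d n (cell n g1) (cell n g2) by apply/(_ : _ <-> _); [near: n; exact: ap|split].
  have h2 : cell n g1 <> cell n g2.
    have : cell n g1 = cell n g2 <-> g1 = g2 by near: n; exact: eqc.
    by move=> [h _] /h.
  by rewrite h1 andbT; move/eqP: h2 => ->.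
apply: cvg_near_cst; near=> n; case: ifPn => // /andP[/eqP h1 h2]; exfalso; apply: H.
have h2' : apart R d n (cell n g1) (cell n g2) <-> ~ kills 0 g1 g2 /\ ~ kills 0 g2 g1.
  by near: n; exact: ap.
have [k12 k21] := h2'.1 h2; split => // g12; apply: h1; by rewrite g12.
Unshelve. all: by end_near. Qed.

Lemma pair_weight01 n k : 0 <= pair_weight n k <= 1.
Proof.
rewrite /pair_weight; case: choice.pickle_inv => [[i j]|]; last by rewrite lexx ler01.
case: ifP => _; last by rewrite lexx ler01.
by rewrite expR_ge0/= -expR0 ler_expR oppr_le0 fine_ge0.
Qed.

Lemma measurable_pair_count n k : measurable_fun setT (pair_count n k).
Proof.
rewrite /pair_count; case: choice.pickle_inv => [[i j]|//].
case: ((i != j) && apart R d n i j) => //.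
apply: emeasurable_funM; last first.
  by apply: (measurable_void_ind HP); exact: measurable_pair_void.
by apply: emeasurable_funM; apply: (prm_measurable HP); apply: measurableI => //; exact: measurable_cell.
Qed.

Lemma pair_count_ge0 n k w : (0 <= pair_count n k w)%E.
Proof.
rewrite /pair_count; case: choice.pickle_inv => [[i j]|//]; case: ifP => // _.
by rewrite !mule_ge0 ?npoints_ge0// lee_fin.
Qed.

Lemma E_pair_count n k : (\int[P]_w pair_count n k w = (pair_weight n k)%:E *
  (L \x L) (B1 `*` B2 `&` [set p | pair_cell n p = k]))%E.
Proof.
have [[i [j ->]]|H] := unpickle_pairP k; last first.
  rewrite (_ : _ `&` _ = set0) ?measure0 ?mule0; last by rewrite -subset0 => p [_ /H].
  rewrite integral0_eq// => w _; rewrite /pair_count.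
  by have := @choice.pickle_invK (nat * nat)%type k; case: choice.pickle_inv => [[i j]|//] /= Hk; case: (H (i, j) Hk).
rewrite pair_cell_set -setXI product_measure1E; try by apply: measurableI => //; exact: measurable_cell.
rewrite /pair_count /pair_weight choice.pickleK_inv; case: ifPn => [/andP[/eqP ij _]|_]; last first.
  by rewrite mul0e integral0.
have mI (B : set G) l : measurable B -> measurable (B `&` [set g | cell n g = l]).
  by move=> mB; apply: measurableI => //; exact: measurable_cell.
have LI (B : set G) l : measurable B -> (L B < +oo)%E -> (L (B `&` [set g | cell n g = l]) < +oo)%E.
  move=> mB LB; apply: le_lt_trans LB; apply: le_measure; rewrite ?inE//; exact: mI.
rewrite (E_npoints2_void HP); first by rewrite muleC.
- exact: mI.
- exact: mI.
- exact: measurable_pair_void.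
- exact: LI.
- exact: LI.
- exact: L_pair_void.
- by rewrite -subset0 => h [[_ hi] [_ hj]]; apply: ij; rewrite -hi -hj.
- by rewrite -subset0 => h [[_ hi] [_]]; apply; left.
- by rewrite -subset0 => h [[_ hi] [_]]; apply; right.
Qed.

Definition pair_ind (n k : nat) (w : Omega) : \bar R :=
  if choice.pickle_inv k is Some (i, j) then
    if (i != j) && apart R d n i j then void_ind Phi (pair_void n i j) w else 0%E
  else 0%E.

Definition points (B : set G) (w : Omega) : seq G := fset_set (Phi w `&` B).

Definition point_pairs w : seq (G * G) := [seq (a, b) | a <- points B1 w, b <- points B2 w].

Lemma mem_points B w g : finite_set (Phi w `&` B) -> (g \in points B w) = (g \in Phi w `&` B).
Proof. by move=> fB; rewrite /points in_fset_set. Qed.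

Lemma npoints_cell B n i w : finite_set (Phi w `&` B) ->
  N (B `&` [set g | cell n g = i]) w = (\sum_(g <- points B w) (cell n g == i)%:R)%:E.
Proof.
by move=> fB; rewrite /npoints setIA counting_cell.
Qed.

Lemma pair_count_sum n w : finite_set (Phi w `&` B1) -> finite_set (Phi w `&` B2) ->
  (\sum_(k <oo) pair_count n k w = \sum_(p <- point_pairs w) pair_ind n (pair_cell n p) w)%E.
Proof.
move=> f1 f2; rewrite -(sum_cells_seq _ (pair_cell n) (f := pair_ind n ^~ w)); last first.
  move=> k; rewrite /pair_ind; case: choice.pickle_inv => [[i j]|//].
  by case: ifP => // _; rewrite lee_fin.
apply: eq_eseriesr => k _.
have [[i [j ->]]|H] := unpickle_pairP k; last first.
  rewrite /pair_count /pair_ind; have := @choice.pickle_invK (nat * nat)%type k.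
  by case: (choice.pickle_inv k) => [[i j]|] /= Hk; [case: (H (i, j) Hk)|rewrite mule0].
rewrite /pair_count /pair_ind choice.pickleK_inv; case: ifP => _; last by rewrite mule0.
congr (_ * _)%E; rewrite !npoints_cell// -EFinM; congr (_%:E).
rewrite /point_pairs big_allpairs mulr_suml; apply: eq_bigr => a _.
rewrite mulr_sumr; apply: eq_bigr => b _.
rewrite -natrM mulnb; congr (_%:R); congr nat_of_bool.
rewrite /pair_cell (inj_eq (pcan_inj (@choice.pickleK _))) /= xpair_eqE.
by [].
Qed.

Hypothesis BB1 : forall g g', B1 g -> B1 g' -> gball g `&` gball g' !=set0.
Hypothesis BB2 : forall g g', B2 g -> B2 g' -> gball g `&` gball g' !=set0.

(** Uniqueness of the retained grain in each of the two families makes this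
    event a Boolean combination of one-grain events, hence measurable. *)
Lemma hits2E : hits2 B1 B2 = (hits Phi B1 `&` hits Phi B2) `\` hits Phi (B1 `&` B2).
Proof.
apply/seteqP; split => w.
  move=> [g1 [g2 [t1 t2 b1 b2 g12]]]; split; first by split; [exists g1|exists g2].
  move=> [g tg [gb1 gb2]]; apply: g12.
  by rewrite (thin_unique BB1 t1 tg)// (thin_unique BB2 t2 tg).
move=> [[[g1 t1 b1] [g2 t2 b2]] nh]; exists g1, g2; split => // g12; apply: nh.
by exists g1 => //; split => //; rewrite g12.
Qed.

(** The two-grain Mecke formula. Each family has at most one retained grain,
    so that the number of retained pairs of different grains is the
    indicator of [hits2]; the dominating variable is the square of a Poisson
    count. *)
Theorem P_hits2 : (P (hits2 B1 B2) = \int[L \x L]_(p in B1 `*` B2) (hprob2 p)%:E)%E.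
Proof.
have mB12 : measurable (B1 `|` B2) by exact: measurableU.
have LB12 : (L (B1 `|` B2) < +oo)%E.
  by apply: le_lt_trans (measureU2 _ mB1 mB2) _; exact: lte_add_pinfty.
apply: (@void_formula _ _ _ P _ _ (L \x L)%E (B1 `*` B2) pair_cell pair_weight hprob2 pair_count
  (fun w => N (B1 `|` B2) w * N (B1 `|` B2) w)%E).
- exact: measurableX.
- rewrite [X in (X < _)%E](product_measure1E L L mB1 mB2).
  by rewrite lte_mul_pinfty// ge0_fin_numE.
- exact: measurable_pair_cell.
- exact: pair_weight01.
- by move=> p _; exact: hprob2_cvg.
- exact: measurable_pair_count.
- exact: pair_count_ge0.
- exact: E_pair_count.
- rewrite hits2E; apply: measurableD; last by apply: (measurable_hits HP); exact: measurableI.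
  by apply: measurableI; exact: (measurable_hits HP).
- by apply: emeasurable_funM; exact: (prm_measurable HP).
- exact: (E_npoints_sqr_lty HP).
- by move=> w; rewrite mule_ge0 ?npoints_ge0.
- have := ae_finite HP mB12 LB12; apply: filterS => w f12 n.
  have f1 : finite_set (Phi w `&` B1) by apply: sub_finite_set f12; apply: setIS; exact: subsetUl.
  have f2 : finite_set (Phi w `&` B2) by apply: sub_finite_set f12; apply: setIS; exact: subsetUr.
  rewrite pair_count_sum//.
  apply: (@le_trans _ _ (\sum_(p <- point_pairs w) 1%:E)%E).
    apply: lee_sum => p _; rewrite /pair_ind; case: choice.pickle_inv => [[i j]|//].
    by case: ifP => // _; rewrite void_indE lee_fin; case: ifP.
  rewrite sumEFin big_const_seq count_predT iter_addr_0 size_allpairs natrM EFinM.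
  have le B : B `<=` B1 `|` B2 -> ((size (points B w))%:R%:E <= N (B1 `|` B2) w :> \bar R)%E.
    move=> sB; have fB : finite_set (Phi w `&` B) by apply: sub_finite_set f12; exact: setIS.
    rewrite /npoints /counting asboolT// lee_fin ler_nat.
    by apply: fsubset_leq_card; rewrite -fset_set_sub//; exact: setIS.
  by apply: lee_pmul => //; apply: le; [exact: subsetUl|exact: subsetUr].
- have := ae_finite_reach HP L_reach; have := ae_finite HP mB12 LB12; apply: filterS2 => w f12 fR.
  have f1 : finite_set (Phi w `&` B1) by apply: sub_finite_set f12; apply: setIS; exact: subsetUl.
  have f2 : finite_set (Phi w `&` B2) by apply: sub_finite_set f12; apply: setIS; exact: subsetUr.
  have H : \forall n \near \oo, forall p, [set` point_pairs w] p ->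
     pair_ind n (pair_cell n p) w =
     (if `[< [/\ thin (Phi w) p.1, thin (Phi w) p.2 & p.1 <> p.2] >] then 1%E else 0%E).
    apply: near_finite_set; first exact: finite_seq.
    move=> [a b] /= /allpairsP[[a' b'] /= [aB bB [-> ->]]] {a b}.
    move: aB bB; rewrite !mem_points// => /set_mem[pa aB] /set_mem[pb bB].
    have V : \forall n \near \oo, Phi w `&` pair_void n (cell n a') (cell n b') =
        Phi w `&` ((kills 0 a' `|` kills 0 b') `\` [set a'; b']).
      apply: (set_cvg_finite (pair_void_cvg a' b') _ (pair_void_near a' b')).
        by move=> h [[hh|hh] _]; [left|right]; exact: kills0_sub.
      by rewrite setIUr finite_setU; split; exact: fR.
    have ap := apart_cvg a' b'; have eqc := cell_cvg b' a'.
    near=> n; rewrite /pair_ind /pair_cell choice.pickleK_inv /=.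
    have Vn : Phi w `&` pair_void n (cell n a') (cell n b') =
        Phi w `&` ((kills 0 a' `|` kills 0 b') `\` [set a'; b']) by near: n.
    have an : apart R d n (cell n a') (cell n b') <-> ~ kills 0 a' b' /\ ~ kills 0 b' a'.
      by near: n.
    have en : cell n a' = cell n b' <-> a' = b' by near: n; exact: eqc.
    rewrite void_indE Vn; case: (asboolP [/\ thin (Phi w) a', thin (Phi w) b' & a' <> b']) => [[ta tb ab]|nt].
      have -> : apart R d n (cell n a') (cell n b').
        apply/an; split => K.
          have /thinP[_ /seteqP[+ _]] := ta => /(_ b'); apply; split => //.
          by split => // ba; apply: ab.
        have /thinP[_ /seteqP[+ _]] := tb => /(_ a'); apply; split => //.
      have -> : cell n a' != cell n b' by apply/eqP => /en.
      rewrite asboolT// -subset0 => h [ph [kh nh]].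
      case: kh => kh.
        have /thinP[_ /seteqP[+ _]] := ta => /(_ h); apply; split => //; split => // ha.
        by apply: nh; left.
      have /thinP[_ /seteqP[+ _]] := tb => /(_ h); apply; split => //; split => // ha.
      by apply: nh; right.
    case: ifPn => // /andP[/eqP e1 /an[k1 k2]]; rewrite asboolF// => V0; apply: nt.
    have ab : a' <> b' by move=> /en.
    split => //; apply/thinP; split => //; rewrite -subset0 => h [ph [kh nh]].
      rewrite -V0; split => //; split; first by left.
      by move=> [//|hb]; apply: k1; rewrite -hb.
    rewrite -V0; split => //; split; first by right.
    by move=> [ha|//]; apply: k2; rewrite -ha.
  apply: cvg_near_cst; near=> n; rewrite pair_count_sum//.
  have Hn : forall p, [set` point_pairs w] p ->
     pair_ind n (pair_cell n p) w =
     (if `[< [/\ thin (Phi w) p.1, thin (Phi w) p.2 & p.1 <> p.2] >] then 1%E else 0%E) by near: n.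
  rewrite big_seq (eq_bigr (fun p => if `[< [/\ thin (Phi w) p.1, thin (Phi w) p.2 & p.1 <> p.2] >] then 1%E else 0%E)); last first.
    by move=> p ps; exact: Hn.
  rewrite -big_seq indicE; have [[g1 [g2 [t1 t2 b1 b2 g12]]]|nh] := pselect (hits2 B1 B2 w).
    rewrite mem_set/=; last by exists g1, g2.
    have gS : (g1, g2) \in point_pairs w.
      apply/allpairsP; exists (g1, g2); split => //=; rewrite mem_points// mem_set//.
        by split => //; case: t1.
      by split => //; case: t2.
    rewrite (bigD1_seq (g1, g2))//=; last first.
      by apply: allpairs_uniq => [||[? ?] [? ?] _ _ /= [-> ->]//]; exact: fset_uniq.
    rewrite asboolT//= big1_seq ?adde0// => -[a b] /andP[gg' /allpairsP[[a' b'] /= [+ + [Ea Eb]]]].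
    rewrite !mem_points// => /set_mem[_ aB] /set_mem[_ bB].
    rewrite asboolF//= => -[ta tb _]; move/eqP: gg'; apply; rewrite Ea Eb in ta tb *.
    by rewrite (thin_unique BB1 ta t1)// (thin_unique BB2 tb t2).
  rewrite memNset// big1_seq// => -[a b] /andP[_ /allpairsP[[a' b'] /= [+ + [-> ->]]]].
  rewrite !mem_points// => /set_mem[_ aB] /set_mem[_ bB].
  by rewrite asboolF// => -[ta tb ab]; apply: nh; exists a', b'.
Unshelve. all: by end_near. Qed.

End retained_pairs.

(** * Retention probabilities and coverage events as integrals *)

Section integral_dirac.
Import HBNNSimple.

(** Holds for arbitrary nonnegative functions: such an integral is a
    supremum over the simple functions below, and a multiple of the
    indicator of [a] attains the value. Retention probabilities can thus be
    averaged over their weights before anything is known about their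
    measurability. *)
Lemma ge0_Rintegral_dirac (d0 : measure_display) (T : measurableType d0) (R : realType)
    (a : T) (f : T -> R) : measurable [set a] -> (forall x, 0 <= f x) ->
  \int[dirac a]_x f x = f a.
Proof.
move=> ma f0; rewrite /Rintegral -[RHS]/(fine (f a)%:E); congr fine.
have dE (h : {nnsfun T >-> R}) : sintegral (dirac a) h = (h a)%:E.
  rewrite -integralT_nnsfun integral_dirac//=.
    by rewrite diracT mul1e.
  by apply/measurable_EFinP.
rewrite ge0_integralTE => [|x]; last by rewrite lee_fin.
apply/eqP; rewrite eq_le; apply/andP; split.
  apply: ge_ereal_sup => _ [h hf <-].
  by rewrite (dE h).
apply: ereal_sup_ubound => /=.
have hE x : scale_nnsfun (indic_nnsfun R ma) (f0 a) x = f a * \1_[set a] x by [].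
exists (scale_nnsfun (indic_nnsfun R ma) (f0 a)).
  move=> x; rewrite lee_fin hE indicE.
  have [/set_mem ->|_] := boolP (x \in [set a]); first by rewrite mulr1.
  by rewrite mulr0.
by rewrite dE hE indicE mem_set// mulr1.
Qed.

End integral_dirac.

Section model.
Context (R : realType) (d : nat) (dO : measure_display) (Omega : measurableType dO)
  (P : probability Omega R) (Phi : Omega -> set (grain R d)) (lam : {nonneg R})
  (F : probability (measurableTypeR R) R).
Local Notation mR := (measurableTypeR R).
Local Notation G := (grain R d).
Local Notation L := (@Lam R d lam F).
Local Notation leb := (lebesgue_Rd R d).
Local Notation N := (npoints Phi).
Hypothesis d1 : (1 <= d)%N.
Hypothesis HPi : poisson_random_measure P Phi (intensity lam%:num F (radius_weight R)).

Lemma poisson_Lam : poisson_random_measure P Phi L.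
Proof.
case: HPi => H1 H2 H3 H4 H5 H6; split => //.
- by move=> B mB; rewrite -(intensityE lam F mB) => LB k; rewrite H4.
- by move=> B mB; rewrite -(intensityE lam F mB) => LB; rewrite H5.
Qed.

Let HP := poisson_Lam.

Hypothesis L_reach : forall a x, (L (reach a x) < +oo)%E.

Let L_point g : L [set g] = 0%E.
Proof. exact: Lam_set1. Qed.

Lemma Lam_ext (B B' : set G) : (forall x r, B (x, r, r) <-> B' (x, r, r)) -> L B = L B'.
Proof.
move=> BB; rewrite !LamE; congr (_ * _)%E; congr product_measure1.
by apply/seteqP; split => -[x r]; rewrite /balanced /= BB.
Qed.

(** Almost surely all points of the process lie in this set, and it has full
    [Lam] measure. *)
Definition balanced_set : set G := [set g | weight g = radius g].

Lemma measurable_balanced_set : measurable balanced_set.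
Proof.
rewrite (_ : balanced_set = [set g | weight g <= radius g] `&` [set g | radius g <= weight g]).
  by apply: measurableI; apply: measurable_le_set;
   [exact: measurable_weight|exact: measurable_radius|exact: measurable_radius|exact: measurable_weight].
apply/seteqP; split => g; rewrite /balanced_set /=; first by move=> ->.
by move=> [a b]; apply/eqP; rewrite eq_le a b.
Qed.

(** Restricting the grains that contain [y] to balanced ones gives geometric
    control: killing implies a comparison of radii. *)
Definition over (y : Rd R d) : set G := reach 0 y `&` balanced_set.

Lemma measurable_over y : measurable (over y).
Proof. by apply: measurableI; [exact: measurable_reach|exact: measurable_balanced_set]. Qed.

Lemma L_over y : L (over y) = L (reach 0 y).
Proof. by apply: Lam_ext => x r; split => [[]|]. Qed.

Lemma reach0_gball (y : Rd R d) (g : G) : reach 0 y g <-> gball g y.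
Proof. by rewrite /reach /gball /eball /= addr0 edistC. Qed.

Lemma over_meet (y : Rd R d) (g g' : G) : over y g -> over y g' -> gball g `&` gball g' !=set0.
Proof. by move=> [/reach0_gball gy _] [/reach0_gball gy' _]; exists y. Qed.

Lemma coveredE y : covered Phi y = hits Phi (reach 0 y).
Proof.
apply/seteqP; split => w; first by move=> [g tg gy]; exists g => //; exact/reach0_gball.
by move=> [g tg /reach0_gball gy]; exists g.
Qed.

Lemma measurable_covered y : measurable (covered Phi y).
Proof. by rewrite coveredE; apply: (measurable_hits HP); exact: measurable_reach. Qed.

Lemma unbalanced_null : P (~` [set w | N (~` balanced_set) w = 0%E]) = 0%E.
Proof.
have mb : measurable (~` balanced_set) := measurableC measurable_balanced_set.
have L0 : L (~` balanced_set) = 0%E.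
  by rewrite (Lam_ext (B' := set0)) ?measure0// => x r; split => // /(_ erefl).
have LV : (L (~` balanced_set) < +oo)%E by rewrite L0.
rewrite probability_setC; last exact: (measurable_npoints0 HP mb).
transitivity (1 - 1 : \bar R)%E; last by rewrite subee.
congr (_ - _)%E; rewrite (P_void HP mb LV) -expR0 -oppr0; congr (expR (- _))%:E.
exact: (congr1 fine L0).
Qed.

Lemma P_ae_eq (A B Z : set Omega) : measurable A -> measurable B -> measurable Z ->
  P Z = 0%E -> (forall w, ~ Z w -> A w <-> B w) -> P A = P B.
Proof.
move=> mA mB mZ Z0 AB.
have half (X Y : set Omega) : measurable X -> measurable Y -> (forall w, ~ Z w -> X w -> Y w) -> (P X <= P Y)%E.
  move=> mX mY XY; rewrite -[leRHS]adde0 -Z0; apply: le_trans (measureU2 _ mY mZ).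
  apply: le_measure; rewrite ?inE//; first exact: measurableU.
  by move=> w Xw; have [Zw|nZ] := pselect (Z w); [right|left; exact: XY].
by apply/eqP; rewrite eq_le !half// => w /AB H /H.
Qed.

Lemma balanced_ae w : N (~` balanced_set) w = 0%E -> forall g, Phi w g -> balanced_set g.
Proof.
move=> /npoints_eq0; rewrite -subset0 => H g pg; apply: contrapT => nb.
by apply: (H g); split.
Qed.

Lemma hits_over_ae w (y : Rd R d) : ~ (~` [set w | N (~` balanced_set) w = 0%E]) w ->
  hits Phi (reach 0 y) w <-> hits Phi (over y) w.
Proof.
move=> /contrapT /= /balanced_ae H; split => [[g tg gy]|[g tg [gy _]]]; exists g => //.
by split => //; apply: H; case: tg.
Qed.

Lemma P_covered y : P (covered Phi y) = P (hits Phi (over y)).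
Proof.
apply: (P_ae_eq (measurable_covered y)).
- by apply: (measurable_hits HP); exact: measurable_over.
- apply: measurableC; exact: (measurable_npoints0 HP (measurableC measurable_balanced_set)).
- exact: unbalanced_null.
- by move=> w /hits_over_ae H; rewrite coveredE.
Qed.

(** The two points are covered either by one retained grain or by two
    different ones, and these events exclude each other. *)
Lemma P_covered2 y z : P (covered Phi y `&` covered Phi z) =
  (P (hits Phi (over y `&` over z)) + P (hits2 Phi (over y) (over z)))%E.
Proof.
have mh B : measurable B -> measurable (hits Phi B) by exact: (measurable_hits HP).
have mo := measurable_over.
have mI : measurable (hits Phi (over y) `&` hits Phi (over z)) by apply: measurableI; exact: mh.
transitivity (P (hits Phi (over y) `&` hits Phi (over z))).
  apply: (P_ae_eq (measurableI _ _ (measurable_covered y) (measurable_covered z))) => //.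
  - apply: measurableC; exact: (measurable_npoints0 HP (measurableC measurable_balanced_set)).
  - exact: unbalanced_null.
  - by move=> w nw; rewrite /setI /= !coveredE !(hits_over_ae _ nw).
rewrite (hits2E Phi (@over_meet y) (@over_meet z)).
rewrite -measureU//; last 3 first.
- by apply: mh; exact: measurableI.
- by apply: measurableD => //; apply: mh; exact: measurableI.
- by rewrite setDE setICA setICr setI0.
congr (P _); rewrite setDUK//.
by move=> w [g tg [gy gz]]; split; exists g.
Qed.

Lemma thin_add_P (phi : set G) g : thin (phi `|` [set g]) g <-> phi `&` (kills 0 g `\ g) = set0.
Proof.
rewrite thinP; split => [[_ H]|H].
  by rewrite -subset0 => h [ph kh]; rewrite -H; split => //; left.
split; first by right.
rewrite -subset0 => h [[ph|->] kh]; first by rewrite -H.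
by case: kh => _ /(_ erefl).
Qed.

(** Adding both grains changes the killers of the first one by the second
    one only. *)
Lemma thin_add2_P (phi : set G) g h : g <> h ->
  thin (phi `|` [set g; h]) g <-> phi `&` (kills 0 g `\ g) = set0 /\ ~ kills 0 g h.
Proof.
move=> gh; rewrite thinP; split => [[_ H]|[H nk]].
  split; first by rewrite -subset0 => k [pk kk]; rewrite -H; split => //; left.
  move=> k0; suff : set0 h by [].
  by rewrite -H; split; [right; right|split => // /= hg; apply: gh].
split; first by right; left.
rewrite -subset0 => k [[pk|[->|->]] kk]; first by rewrite -H.
  by case: kk => _ /(_ erefl).
by case: kk.
Qed.

Let measurable_killsD (g : G) : measurable (kills 0 g `\ g).
Proof. exact: measurableD (measurable_kills 0 g) (measurable_point g). Qed.

Lemma P_void_setE (V : set G) : measurable V -> (L V < +oo)%E ->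
  P [set w | Phi w `&` V = set0] = (expR (- fine (L V)))%:E.
Proof.
move=> mV LV; rewrite -(P_void HP mV LV); congr (P _).
by apply/seteqP; split => w /npoints_eq0.
Qed.

Lemma retentionE r : retention P Phi r r = hprob L (origin, r, r).
Proof.
rewrite /retention; set g := (origin, r, r).
rewrite (_ : [set w | _] = [set w | Phi w `&` (kills 0 g `\ g) = set0]); last first.
  by apply/seteqP; split => w /thin_add_P.
have LE : L (kills 0 g `\ g) = L (kills 0 g).
  exact: (L_setD_point L_point g (measurable_kills 0 g)).
have Llty : (L (kills 0 g `\ g) < +oo)%E by rewrite LE; exact: L_kills_lty.
by rewrite (P_void_setE (measurable_killsD g) Llty) LE.
Qed.

(** The union of the killers, without the two reference grains, must be
    void; the reference grains have intensity zero. *)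
Lemma retention2E u r1 r2 :
  retention2 P Phi u r1 r1 r2 r2 = hprob2 L ((origin, r1, r1), (scaled_e1 u, r2, r2)).
Proof.
rewrite /retention2 /hprob2 /=; set g := (origin, r1, r1); set h := (scaled_e1 u, r2, r2).
case: asboolP => [[gh k1 k2]|nk]; last first.
  rewrite (_ : [set w | _] = set0) ?measure0// -subset0 => w [gh t1 t2]; apply: nk.
  have [_ ?] := (thin_add2_P (Phi w) gh).1 t1; split => //.
  move: t2; rewrite setUC => t2.
  have hg : h <> g by move=> /esym.
  by move: t2; rewrite setUC [X in _ `|` X]setUC => /(thin_add2_P (Phi w) hg)[].
pose V := (kills 0 g `|` kills 0 h) `\ g `\ h.
have mK : measurable (kills 0 g `|` kills 0 h) by apply: measurableU; exact: measurable_kills.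
have LV : L V = L (kills 0 g `|` kills 0 h).
  rewrite (L_setD_point L_point) ?(L_setD_point L_point)//.
  by apply: measurableD => //; exact: measurable_point.
rewrite -LV (_ : [set w | _] = [set w | Phi w `&` V = set0]).
  rewrite P_void_setE//; first by apply: measurableD; [apply: measurableD => //|]; exact: measurable_point.
  rewrite LV; apply: le_lt_trans (measureU2 _ _ _) _; try exact: measurable_kills.
  by apply: lte_add_pinfty; exact: L_kills_lty.
have hg : h <> g by move=> /esym.
apply/seteqP; split => w.
  move=> [_ /(thin_add2_P _ gh)[t1 _]].
  rewrite [X in _ `|` X]setUC => /(thin_add2_P _ hg)[t2 _].
  rewrite /mkset -subset0 => k [pk [[[kk|kk] kg] kh]].
    by rewrite -t1.
  by rewrite -t2.
move=> /= H; split => //.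
  apply/(thin_add2_P _ gh); split => //.
  rewrite -subset0 => k [pk [kk kg]]; rewrite -H; split => //; split; first by split => //; left.
  by move=> /= kh; apply: k1; rewrite -kh.
rewrite [X in _ `|` X]setUC; apply/(thin_add2_P _ hg); split => //.
rewrite -subset0 => k [pk [kk kh]]; rewrite -H; split => //; split => //; split; first by right.
by move=> /= kg; apply: k2; rewrite -kg.
Qed.

Lemma mean_retentionE r : mean_retention P Phi (radius_weight R) r = hprob L (origin, r, r).
Proof.
rewrite /mean_retention -retentionE; apply: ge0_Rintegral_dirac; first exact: measurable_set1.
by move=> w; exact: fine_ge0.
Qed.

Lemma mean_retention2E u r1 r2 : mean_retention2 P Phi (radius_weight R) u r1 r2 =
  hprob2 L ((origin, r1, r1), (scaled_e1 u, r2, r2)).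
Proof.
rewrite /mean_retention2 -retention2E.
have ge0 w1 w2 : 0 <= retention2 P Phi u r1 w1 r2 w2 by exact: fine_ge0.
transitivity (\int[dirac (r1 : mR)]_w1 retention2 P Phi u r1 w1 r2 r2).
  by congr Rintegral; apply/funext => w1; apply: ge0_Rintegral_dirac; first exact: measurable_set1.
by apply: ge0_Rintegral_dirac; first exact: measurable_set1.
Qed.

End model.

(** * Overlap of the killing sets of two distant grains *)

Lemma expR_excess_le1 (R : realType) (a b m : R) : 0 < a <= 1 -> 0 < b <= 1 ->
  a <= expR (- m) -> a * b * (expR m - 1) <= 1.
Proof.
move=> /andP[/ltW a0 _] /andP[/ltW b0 b1] am.
apply: (@le_trans _ _ (a * b * expR m)).
  by rewrite ler_wpM2l ?mulr_ge0// gerBl.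
apply: (@le_trans _ _ (a * expR m)).
  by rewrite ler_wpM2r ?expR_ge0// ler_piMr.
by rewrite -(expRxMexpNx_1 m) mulrC ler_wpM2l// expR_ge0.
Qed.

Lemma fine_measure_setD d (T : measurableType d) (R : realType)
    (m : {measure set T -> \bar R}) (A B C : set T) :
  measurable A -> measurable B -> measurable C -> (m A < +oo)%E ->
  B `<=` A -> C `<=` A `\` B -> fine (m C) <= fine (m A) - fine (m B).
Proof.
move=> mA mB mC Aoo BA CAB.
have fin X : measurable X -> X `<=` A -> m X \is a fin_num.
  move=> mX XA; rewrite ge0_fin_numE// (le_lt_trans _ Aoo)//.
  by apply: le_measure; rewrite ?inE.
have CA : C `<=` A by move=> x /CAB[].
rewrite -fineB; [|exact: fin|exact: fin].
have DE : m (A `\` B) = (m A - m B)%E by rewrite measureD// (setIidr BA).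
rewrite -DE; have mD : measurable (A `\` B) by exact: measurableD.
apply: fine_le; [exact: fin|by apply: fin => //; exact: subDsetl|].
by apply: le_measure; rewrite ?inE.
Qed.

(** Squeezes an integral between multiples of the measure of the domain;
    used where the integrand is a probability close to 1. *)
Lemma integral_between d (T : measurableType d) (R : realType)
    (m : {measure set T -> \bar R}) (D : set T) (f : T -> R) (a : R) :
  measurable D -> (m D < +oo)%E -> measurable_fun D (f : T -> measurableTypeR R) ->
  0 <= a -> (forall x, D x -> a <= f x <= 1) ->
  a * fine (m D) <= fine (\int[m]_(x in D) (f x)%:E) <= fine (m D).
Proof.
move=> mD mDoo mf a0 af.
have mfE : measurable_fun D (fun x => (f x)%:E) by apply/measurable_EFinP.
have f0 x : D x -> (0 <= (f x)%:E)%E by move=> /af/andP[+ _]; rewrite lee_fin; exact: le_trans.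
have up : (\int[m]_(x in D) (f x)%:E <= m D)%E.
  rewrite -[leRHS]mul1e -integral_cst//; apply: ge0_le_integral => // x /af/andP[_].
  by rewrite lee_fin.
have low : (a%:E * m D <= \int[m]_(x in D) (f x)%:E)%E.
  rewrite -integral_cst//; apply: ge0_le_integral => // x /af/andP[+ _].
  by rewrite lee_fin.
have mfin : m D \is a fin_num by rewrite ge0_fin_numE.
have ifin : (\int[m]_(x in D) (f x)%:E)%E \is a fin_num.
  by rewrite ge0_fin_numE ?integral_ge0// (le_lt_trans up).
rewrite -!lee_fin EFinM !fineK// up andbT//.
Qed.

Lemma measurable_comp_pair d d1 d2 d3 (T : measurableType d) (T1 : measurableType d1)
    (T2 : measurableType d2) (T3 : measurableType d3) (f : T1 * T2 -> T3) (f1 : T -> T1) (f2 : T -> T2) :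
  measurable_fun setT f -> measurable_fun setT f1 -> measurable_fun setT f2 ->
  measurable_fun setT (fun x => f (f1 x, f2 x)).
Proof.
move=> mf m1 m2; have mp := measurable_fun_pair m1 m2.
exact: (measurableT_comp mf mp).
Qed.

(** Dominated convergence at rate [e], on a domain of finite measure where a
    constant dominates. *)
Lemma scaled_dominated_cvg d (T : measurableType d) (R : realType)
    (m : {measure set T -> \bar R}) (D : set T) (f_ : nat -> T -> R) (f : T -> R)
    (e : R ^nat) (C : R) :
  measurable D -> (m D < +oo)%E ->
  (forall n, measurable_fun D (f_ n : T -> measurableTypeR R)) ->
  (forall n x, D x -> 0 <= f_ n x) ->
  (\forall n \near \oo, 0 < e n /\ forall x, D x -> f_ n x <= C * e n) ->
  (forall x, D x -> f_ n x / e n @[n --> \oo] --> f x) ->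
  fine (\int[m]_(x in D) (f_ n x)%:E) / e n @[n --> \oo] --> fine (\int[m]_(x in D) (f x)%:E).
Proof.
move=> mD mDoo mf f0 [N _ HN] ff; rewrite -(cvg_shiftn N).
have {}HN n : 0 < e (n + N)%N /\ forall x, D x -> f_ (n + N)%N x <= C * e (n + N)%N.
  by apply: HN => /=; exact: leq_addl.
have ratio0 n x : D x -> 0 <= f_ (n + N)%N x / e (n + N)%N <= C.
  move=> Dx; have [e0 fC] := HN n.
  by rewrite divr_ge0 ?f0 ?(ltW e0)//= ler_pdivrMr// fC.
have intE n : fine (\int[m]_(x in D) (f_ (n + N)%N x)%:E) / e (n + N)%N =
    fine (\int[m]_(x in D) (f_ (n + N)%N x / e (n + N)%N)%:E).
  have [e0 _] := HN n.
  under [in RHS]eq_integral do rewrite mulrC EFinM.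
  rewrite ge0_integralZl_EFin//; last by rewrite invr_ge0 ltW.
  - have [fin|] := boolP (\int[m]_(x in D) (f_ (n + N)%N x)%:E \is a fin_num)%E.
      by rewrite fineM// mulrC.
    rewrite ge0_fin_numE; last by apply: integral_ge0 => x Dx; rewrite lee_fin f0.
    rewrite ltey negbK => /eqP ->; rewrite gt0_muley ?lte_fin ?invr_gt0//= mul0r//.
  - by move=> x Dx; rewrite lee_fin f0.
  - by apply/measurable_EFinP; exact: mf.
under eq_fun do rewrite intE.
have C0 x : D x -> 0 <= C.
  by move=> Dx; have /andP[] := ratio0 0%N x Dx; exact: le_trans.
have lim0C x : D x -> 0 <= f x <= C.
  move=> Dx; have := ff x Dx; rewrite -(cvg_shiftn N) => fx.
  apply/andP; split.
    by apply: (cvgr_to_ge fx); apply: nearW => n; have /andP[] := ratio0 n x Dx.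
  by apply: (cvgr_to_le fx); apply: nearW => n; have /andP[] := ratio0 n x Dx.
have mr n : measurable_fun D (fun x => (f_ (n + N)%N x / e (n + N)%N)%:E).
  by apply/measurable_EFinP; apply: measurable_funM => //; exact: mf.
have ic : (\int[m]_(x in D) C%:E < +oo)%E.
  rewrite integral_cst//; have [->|] := eqVneq (m D) 0%E; first by rewrite mule0.
  move=> mD0; rewrite -[m D]fineK ?ge0_fin_numE// -EFinM; exact: ltry.
apply: fine_cvg; rewrite fineK.
  apply: (ge0_dominated_cvg (g := cst C%:E)) => //.
  - by move=> n x Dx; rewrite lee_fin; have /andP[] := ratio0 n x Dx.
  - by move=> n x Dx; rewrite lee_fin; have /andP[] := ratio0 n x Dx.
  - move=> x Dx; apply: cvg_EFin; first exact: nearW.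
    by have := ff x Dx; rewrite -(cvg_shiftn N).
have mlim : measurable_fun D (fun x => (f x)%:E).
  apply: (emeasurable_fun_cvg _ _ mr) => x Dx; apply: cvg_EFin; first exact: nearW.
  by have := ff x Dx; rewrite -(cvg_shiftn N).
rewrite ge0_fin_numE; last first.
  by apply: integral_ge0 => x Dx; rewrite lee_fin; have /andP[] := lim0C x Dx.
apply: le_lt_trans ic; apply: ge0_le_integral => //.
- by move=> x Dx; rewrite lee_fin; have /andP[] := lim0C x Dx.
- by move=> x Dx; rewrite lee_fin; have /andP[] := lim0C x Dx.
Qed.

Lemma expR_excess_ge0 (R : realType) (a b m : R) : 0 < a <= 1 -> 0 < b <= 1 -> 0 <= m ->
  0 <= a * b * (expR m - 1).
Proof.
move=> /andP[/ltW a0 _] /andP[/ltW b0 _] m0.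
by rewrite !mulr_ge0// subr_ge0 -expR0 ler_expR.
Qed.

Lemma expR_excess_between (R : realType) (m : R) : 0 <= m -> m <= expR m - 1 <= m * expR m.
Proof.
move=> m0; apply/andP; split; first by have := expR_ge1Dx m; lra.
have := expR_ge1Dx (- m); rewrite -(ler_pM2r (expR_gt0 m)) -expRD addNr expR0 mulrDl; lra.
Qed.

Lemma expR_excess_le (R : realType) (a b m : R) : 0 < a <= 1 -> 0 < b <= 1 -> 0 <= m ->
  a <= expR (- m) -> a * b * (expR m - 1) <= m.
Proof.
move=> /andP[/ltW a0 _] /andP[/ltW b0 b1] m0 am.
have e0 : 0 <= expR m - 1 by rewrite subr_ge0 -expR0 ler_expR.
apply: (@le_trans _ _ (expR (- m) * (expR m - 1))).
  by rewrite ler_wpM2r// -[leRHS]mulr1 ler_pM.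
rewrite mulrBr -expRD addNr expR0 mulr1.
have := expR_ge1Dx (- m); lra.
Qed.

Lemma measurable_expR_comp d (T : measurableType d) (R : realType) (f : T -> measurableTypeR R) :
  measurable_fun setT f -> measurable_fun setT (fun x => expR (f x) : measurableTypeR R).
Proof.
move=> mf; apply: (@measurableT_comp _ _ _ _ _ _ (expR : measurableTypeR R -> measurableTypeR R)) => //.
Qed.

Lemma integral_measure_preserving d (T : measurableType d) (R : realType)
    (m : {measure set T -> \bar R}) (phi : T -> T) (f : T -> \bar R) :
  measurable_fun setT phi ->
  (forall B, measurable B -> m [set x | B (phi x)] = m B) ->
  measurable_fun setT f -> (forall x, 0 <= f x)%E ->
  (\int[m]_x f (phi x) = \int[m]_x f x)%E.
Proof.
move=> mphi inv mf f0.
transitivity (\int[pushforward m phi]_x f x)%E.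
  by rewrite (ge0_integral_pushforward mphi)// preimage_setT.
by apply: eq_measure_integral => B mB _; exact: inv.
Qed.

Section asymptotics.
Context (R : realType) (d : nat) (lam : {nonneg R})
  (F : probability (measurableTypeR R) R) (alpha : R).
Local Notation mR := (measurableTypeR R).
Local Notation G := (grain R d).
Local Notation L := (@Lam R d lam F).
Local Notation rho := (rho d F).
Local Notation H := (hprob L).
Local Notation bal := (@balanced_set R d).
Implicit Types (g h : G) (x y z : Rd R d).

Definition shift z g : G := recenter (fun x => tadd x z) g.

Lemma measurable_shift z : measurable_fun setT (shift z).
Proof. exact: (measurable_recenter (measurable_translate z)). Qed.

Lemma Lam_shift z (B : set G) : measurable B -> L [set g | B (shift z g)] = L B.
Proof. exact: Lam_translate. Qed.

Lemma integral_shift z (f : G -> \bar R) : measurable_fun setT f -> (forall g, 0 <= f g)%E ->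
  (\int[L]_g f (shift z g) = \int[L]_g f g)%E.
Proof.
move=> mf f0.
exact: (integral_measure_preserving (measurable_shift z) (@Lam_shift z) mf f0).
Qed.

Lemma shiftK z g : shift (topp z) (shift z g) = g.
Proof. by case: g => [[x r] w]; rewrite /shift /recenter /Defs.center /= taddK. Qed.

Lemma kills_shift z g h : kills 0 (shift z g) (shift z h) <-> kills 0 g h.
Proof. by rewrite /kills /shift /recenter /Defs.center /Defs.radius /weight /= edist_taddr. Qed.

Lemma reach_shift a z x g : reach a (tadd x z) (shift z g) <-> reach a x g.
Proof. by rewrite /reach /shift /recenter /Defs.center /Defs.radius /= edist_taddr. Qed.

Lemma over_shift z x g : over (tadd x z) (shift z g) <-> over x g.
Proof. by rewrite /over /setI /= reach_shift. Qed.

Lemma origin_tadd z : tadd origin z = z.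
Proof. by rewrite taddC tadd0. Qed.

Lemma over_shift0 z g : over z (shift z g) <-> over origin g.
Proof. by rewrite -{1}(origin_tadd z) over_shift. Qed.

Lemma hprobE g : H g = expR (- fine (L (kills 0 g))).
Proof. by []. Qed.

Lemma hprob_shift z g : H (shift z g) = H g.
Proof.
rewrite !hprobE -(Lam_shift z (measurable_kills 0 (shift z g))).
rewrite (_ : [set h | _] = kills 0 g)//.
by apply/seteqP; split => h /= /(kills_shift z g).
Qed.

(** A reflection fixing the origin moves [z] onto the axis of [e1]. *)
Lemma lens_rot a b z : (1 <= d)%N ->
  L (reach a origin `&` reach b z) = L (reach a origin `&` reach b (scaled_e1 (enorm z))).
Proof.
move=> d1; set y := scaled_e1 _.
have yz : enorm y = enorm z.
  by rewrite /y scaled_e1E enorm_tscale ?edist_ge0// enorm_e1// mulr1.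
pose v := tadd y (topp z).
rewrite -(Lam_householder lam F v (measurableI _ _ (measurable_reach a origin) (measurable_reach b z))).
have swap t x0 y0 g : householder v x0 = y0 -> reach t y0 (recenter (householder v) g) <-> reach t x0 g.
  by move=> <-; rewrite /reach /recenter /Defs.center /Defs.radius /= edist_householder.
have ho := householder_origin v; have hz : householder v y = z := householder_swap yz.
congr (L _); apply/seteqP; split => g [].
  by move=> /(swap _ _ _ _ ho) ? /(swap _ _ _ _ hz).
by move=> /(swap _ _ _ _ ho) ? /(swap _ _ _ _ hz).
Qed.

Hypothesis d1 : (1 <= d)%N.
Hypothesis F_Rplus : F `[0%R, +oo[%classic = 1%E.
Hypothesis alpha_gt_d : d%:R < alpha.
Hypothesis tail_gt0 : \forall t \near +oo, 0 < tail F t.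
Hypothesis tail_lim : forall a, 0 < a ->
  tail F (a * t) / tail F t @[t --> +oo] --> a `^ (- alpha).

Local Notation c := (lam%:num * c_alpha alpha d).

Let L_reach : forall a x, (L (reach a x) < +oo)%E.
Proof. exact: (Lam_reach_lty lam F_Rplus alpha_gt_d tail_gt0 tail_lim). Qed.

Let measurable_lens a b z : measurable (reach a origin `&` reach b z : set G).
Proof. by apply: measurableI; exact: measurable_reach. Qed.

Lemma lens_lty a b z : (L (reach a origin `&` reach b z) < +oo)%E.
Proof.
apply: le_lt_trans (L_reach a origin); apply: le_measure; rewrite ?inE//.
exact: measurable_reach.
Qed.

Lemma fine_Lam_le (A B : set G) : measurable A -> measurable B -> A `<=` B -> (L B < +oo)%E ->
  fine (L A) <= fine (L B).
Proof.
move=> mA mB AB LB; have LAB : (L A <= L B)%E by apply: le_measure; rewrite ?inE.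
by apply: fine_le => //; rewrite ge0_fin_numE// (le_lt_trans LAB).
Qed.

Lemma Lam_balancedI (B : set G) : L (B `&` bal) = L B.
Proof. by apply: Lam_ext => x r; split => [[]|]. Qed.

Lemma wide_anti s t : s <= t -> wide t `<=` (wide s : set G).
Proof. by move=> st g; rewrite /wide /=; lra. Qed.

Lemma wide_lty : exists U, (L (wide U) < +oo)%E.
Proof.
have [C C0 HC] := Lam_wide lam F_Rplus alpha_gt_d tail_gt0 tail_lim.
by have [U HU] := filter_ex HC; exists U; apply: le_lt_trans HU (ltry _).
Qed.

Lemma wide_near_lty (v : R ^nat) : v n @[n --> \oo] --> +oo ->
  \forall n \near \oo, (L (wide (v n)) < +oo)%E.
Proof.
move=> voo; have [U LU] := wide_lty; near=> n; apply: le_lt_trans LU.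
apply: le_measure; rewrite ?inE; try exact: measurable_wide.
apply: wide_anti; apply: ltW; near: n.
exact: (voo _ (nbhs_pinfty_gt (num_real U))).
Unshelve. all: by end_near. Qed.

Lemma Lam_wide_cvg (v : R ^nat) : v n @[n --> \oo] --> +oo ->
  L (wide (v n)) @[n --> \oo] --> 0%E.
Proof.
move=> voo; have [U LU] := wide_lty; rewrite -(measure0 L).
have vgt M : \forall n \near \oo, M < v n by exact: (voo _ (nbhs_pinfty_gt (num_real M))).
apply: (set_cvg_measure (W := wide U)) => //.
- move=> g; near=> n; split => //; rewrite /wide /= => H1.
  have : 16 * radius g < v n by near: n; exact: vgt.
  have := edist_ge0 origin (center g); lra.
- by near=> n; apply: wide_anti; apply: ltW; near: n; exact: vgt.
- by move=> n; exact: measurable_wide.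
- exact: measurable_wide.
Unshelve. all: by end_near. Qed.

(** A killer of a grain of radius [r] at the origin has a radius [t >= r]
    and a center within [r + t] of the origin. *)
Lemma kills_wide (r : R) : kills 0 ((origin, r, r) : G) `&` bal `<=` (wide r : set G).
Proof.
move=> [[x t] w] [[]]; rewrite /balanced_set /wide /Defs.radius /Defs.center /weight /=.
by move=> r0 t0 xt rw E; lra.
Qed.

Lemma hprob_origin x r : H (x, r, r) = H (origin, r, r).
Proof.
rewrite -(hprob_shift x (origin, r, r)); congr (H _).
by rewrite /shift /recenter /Defs.center /Defs.radius /weight /= origin_tadd.
Qed.

Lemma hprob01 g : 0 < H g <= 1.
Proof. by rewrite hprobE expR_gt0 -expR0 ler_expR oppr_le0 fine_ge0. Qed.

Lemma hprob_ge x r : (L (wide r) < +oo)%E -> expR (- fine (L (wide r))) <= H (x, r, r).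
Proof.
move=> Lr; rewrite hprob_origin hprobE ler_expR lerN2 -(Lam_balancedI (kills 0 _)).
apply: fine_Lam_le => //.
- apply: measurableI; [exact: measurable_kills|exact: measurable_balanced_set].
- exact: measurable_wide.
- exact: kills_wide.
Qed.

Lemma hprob_wide_cvg (v : R ^nat) : v n @[n --> \oo] --> +oo ->
  expR (- fine (L (wide (v n)))) @[n --> \oo] --> (1 : R).
Proof.
move=> voo; rewrite -expR0 -oppr0.
apply: (@cvg_comp _ _ _ _ _ _ (nbhs (- 0 : R))); last exact: continuous_expR.
by apply: cvgN; apply: fine_cvg; exact: Lam_wide_cvg.
Qed.

Lemma measurable_kills_comp dT (T : measurableType dT) (f1 f2 : T -> G) :
  measurable_fun setT f1 -> measurable_fun setT f2 ->
  measurable [set x | kills 0 (f1 x) (f2 x)].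
Proof.
move=> m1 m2.
have mr1 : measurable_fun setT (fun x : T => radius (f1 x) : mR) by apply: (measurableT_comp measurable_radius).
have mr2 : measurable_fun setT (fun x : T => radius (f2 x) : mR) by apply: (measurableT_comp measurable_radius).
have mw1 : measurable_fun setT (fun x : T => weight (f1 x) : mR) by apply: (measurableT_comp measurable_weight).
have mw2 : measurable_fun setT (fun x : T => weight (f2 x) : mR) by apply: (measurableT_comp measurable_weight).
have mc1 : measurable_fun setT (fun x : T => center (f1 x)) by apply: (measurableT_comp measurable_center).
have mc2 : measurable_fun setT (fun x : T => center (f2 x)) by apply: (measurableT_comp measurable_center).
rewrite (_ : [set x | _] = [set x | 0 <= radius (f1 x)] `&` ([set x | 0 <= radius (f2 x)] `&`
  ([set x | edist (center (f1 x)) (center (f2 x)) <= radius (f1 x) + radius (f2 x)] `&`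
   [set x | weight (f1 x) <= weight (f2 x)]))).
  apply: measurableI; last apply: measurableI; last apply: measurableI; apply: measurable_le_set => //.
    exact: measurable_edist.
  exact: measurable_funD.
by apply/seteqP; split => p; rewrite /kills /setI /= !addr0; [move=> []|move=> [? [? [? ?]]]].
Qed.

(** Intensity of the common killers, the source of the dependence between
    two distant grains. *)
Definition overlap g h : R := fine (L (kills 0 g `&` kills 0 h)).

Lemma measurable_Lam_overlap :
  measurable_fun setT (fun p : G * G => L (kills 0 p.1 `&` kills 0 p.2)).
Proof.
pose E := [set q : (G * G) * G | kills 0 q.1.1 q.2] `&` [set q : (G * G) * G | kills 0 q.1.2 q.2].
apply: (@measurable_fun_section _ _ _ _ _ L E).
by apply: measurableI; apply: measurable_kills_comp => //;
  apply: (measurableT_comp _ measurable_fst).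
Qed.

Lemma measurable_overlap : measurable_fun setT (fun p : G * G => overlap p.1 p.2 : mR).
Proof. exact: (measurableT_comp (fine_measurable measurableT) measurable_Lam_overlap). Qed.

Lemma hprob_overlap g : H g = expR (- overlap g g).
Proof. by rewrite hprobE /overlap setIid. Qed.

Lemma measurable_hprob : measurable_fun setT (H : G -> mR).
Proof.
rewrite (_ : H = fun g => expR (- overlap g g)); last by apply/funext => g; exact: hprob_overlap.
apply: (measurable_expR_comp (f := fun g => - overlap g g)); apply: measurable_funN.
apply: (@measurableT_comp _ _ _ _ _ _ (fun p : G * G => overlap p.1 p.2 : mR) _ (fun g => (g, g))).
  exact: measurable_overlap.
exact: measurable_fun_pair.
Qed.

Definition meets g h := kills 0 g h \/ kills 0 h g.

(** Excess of the joint retention probability over the product for grains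
    that do not meet; by inclusion-exclusion their joint retention
    probability is [H g * H h * exp (overlap g h)]. *)
Definition gain g h : R :=
  if `[< meets g h >] then 0 else H g * H h * (expR (overlap g h) - 1).

Lemma measurable_meets : measurable [set p : G * G | meets p.1 p.2].
Proof.
rewrite (_ : [set p | _] = [set p : G * G | kills 0 p.1 p.2] `|` [set p : G * G | kills 0 p.2 p.1]).
  by apply: measurableU; apply: measurable_kills_comp.
by apply/seteqP; split.
Qed.

Lemma overlap_ge0 g h : 0 <= overlap g h.
Proof. by rewrite fine_ge0. Qed.

Lemma gain_ge0 g h : 0 <= gain g h.
Proof.
rewrite /gain; case: asboolP => // _.
exact: expR_excess_ge0 (hprob01 g) (hprob01 h) (overlap_ge0 g h).
Qed.

Lemma overlap_le_kills g h : overlap g h <= overlap g g.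
Proof.
rewrite /overlap setIid; apply: fine_Lam_le; try exact: measurable_kills.
- by apply: measurableI; exact: measurable_kills.
- exact: subIsetl.
- exact: (L_kills_lty L_reach).
Qed.

(** The factor [H g] compensates for the exponential, since the overlap is
    at most the intensity of the killers of [g]; this bound is uniform in
    the grains, which dominated convergence requires. *)
Lemma gain_le_overlap g h : gain g h <= overlap g h.
Proof.
rewrite /gain; case: asboolP => _; first exact: overlap_ge0.
apply: expR_excess_le (hprob01 g) (hprob01 h) (overlap_ge0 g h) _.
by rewrite hprob_overlap ler_expR lerN2; exact: overlap_le_kills.
Qed.

Lemma measurable_gain : measurable_fun setT (fun p : G * G => gain p.1 p.2 : mR).
Proof.
rewrite (_ : (fun p => _) = fun p => \1_(~` [set p : G * G | meets p.1 p.2]) p *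
    (H p.1 * H p.2 * (expR (overlap p.1 p.2) - 1))).
  apply: measurable_funM; first by apply: measurable_indic; apply: measurableC; exact: measurable_meets.
  apply: measurable_funM.
    apply: measurable_funM; first exact: (measurableT_comp measurable_hprob measurable_fst).
    exact: (measurableT_comp measurable_hprob measurable_snd).
  apply: measurable_funB => //; exact: (measurable_expR_comp measurable_overlap).
apply/funext => p; rewrite /gain indicE; case: asboolP => m.
  by rewrite memNset ?mul0r//; apply.
by rewrite mem_set ?mul1r.
Qed.

Lemma measurable_gain_comp dT (T : measurableType dT) (f1 f2 : T -> G) :
  measurable_fun setT f1 -> measurable_fun setT f2 ->
  measurable_fun setT (fun x : T => gain (f1 x) (f2 x) : mR).
Proof.
move=> m1 m2.
have := measurable_comp_pair measurable_gain m1 m2; exact.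
Qed.

Lemma over_radius_ge0 x g : over x g -> 0 <= radius g.
Proof. by move=> [H1 _]; have := edist_ge0 x (center g); move: H1; rewrite /reach /=; lra. Qed.

(** A grain that covers a point lies within twice its radius of that point,
    so a killer of it reaches the point up to that distance. *)
Lemma overlap_far y g h : over origin g -> over origin h ->
  kills 0 g `&` kills 0 (shift y h) `<=` reach (2 * radius g) origin `&` reach (2 * radius h) y.
Proof.
case: g h => [[x1 r1] w1] [[x2 r2] w2] [H1 _] [H2 _] [[x r] w] [[_ _ K1 _] [_ _ K2 _]].
move: H1 H2 K1 K2; rewrite /reach /shift /recenter /Defs.radius /Defs.center /= => H1 H2 K1 K2.
have T1 := edist_triangle x1 origin x.
have T2 := edist_triangle (tadd x2 y) y x.
have E : edist y (tadd x2 y) = edist origin x2 by rewrite -{1}(origin_tadd y) edist_taddr.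
by split; lra.
Qed.

(** Conversely, a balanced grain covering two points at a distance exceeding
    the diameters of [g] and [h] is larger than both, hence kills both. *)
Lemma overlap_near y g h : over origin g -> over origin h ->
  2 * radius g < enorm y -> 2 * radius h < enorm y ->
  reach 0 origin `&` reach 0 y `&` bal `<=` kills 0 g `&` kills 0 (shift y h).
Proof.
case: g h => [[x1 r1] w1] [[x2 r2] w2] [H1 E1] [H2 E2] y1 y2 [[x r] w] [[R1 R2] E].
move: H1 H2 E1 E2 y1 y2 R1 R2 E; rewrite /reach /kills /shift /recenter /enorm /balanced_set
  /Defs.radius /Defs.center /weight /= => H1 H2 E1 E2 y1 y2 R1 R2 E.
have T1 := edist_triangle origin x1 x; have := edistC x1 origin => C1.
have T2 := edist_triangle y (tadd x2 y) x.
have E' : edist (tadd x2 y) y = edist origin x2 by rewrite -{2}(origin_tadd y) edist_taddr edistC.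
have T3 := edist_triangle x y origin; have C3 := edistC x origin.
have := edist_ge0 origin x1; have := edist_ge0 origin x2; have := edist_ge0 origin x.
by split; split; lra.
Qed.

(** A common killer is larger than both grains, so it comes within three of
    its radii of each point, and its radius is at least a sixth of their
    distance. *)
Lemma overlap_wide y g h : over origin g -> over origin h ->
  kills 0 g `&` kills 0 (shift y h) `&` bal `<=` wide (enorm y).
Proof.
case: g h => [[x1 r1] w1] [[x2 r2] w2] [H1 E1] [H2 E2] [[x r] w] [[[a1 a2 K1 W1] [b1 b2 K2 W2]] E].
move: H1 H2 E1 E2 a1 a2 K1 W1 b1 b2 K2 W2 E; rewrite /reach /wide /shift /recenter /enorm /balanced_set
  /Defs.radius /Defs.center /weight /= => H1 H2 E1 E2 a1 a2 K1 W1 b1 b2 K2 W2 E.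
have T1 := edist_triangle x1 origin x.
have T2 := edist_triangle (tadd x2 y) y x.
have E' : edist y (tadd x2 y) = edist origin x2 by rewrite -{1}(origin_tadd y) edist_taddr.
have T3 := edist_triangle x y origin; have C3 := edistC x origin.
lra.
Qed.

Lemma not_meets_far y g h : over origin g -> over origin h ->
  2 * (radius g + radius h) < enorm y -> ~ meets g (shift y h).
Proof.
case: g h => [[x1 r1] w1] [[x2 r2] w2] [H1 _] [H2 _].
move: H1 H2; rewrite /reach /meets /kills /shift /recenter /enorm /Defs.radius /Defs.center /weight /=.
move=> H1 H2 y0.
have T1 := edist_triangle (tadd x2 y) y x1.
have E' : edist y (tadd x2 y) = edist origin x2 by rewrite -{1}(origin_tadd y) edist_taddr.
have T3 := edist_triangle x1 y origin; have C3 := edistC x1 origin.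
have C4 := edistC x1 (tadd x2 y).
have E'' := edistC y (tadd x2 y).
by move=> [] [_ _ K _]; have := edist_triangle (tadd x2 y) y x1;
  have := edistC y x1; have := edist_triangle x1 y (tadd x2 y); lra.
Qed.

(** Of two grains that meet, one is a killer of the other; when neither
    covers both points, the killer is an intruder for the grain it kills. *)
Definition intruders y g : set G := over y `&` kills 0 g `\` over origin.

Lemma measurable_intruders y g : measurable (intruders y g).
Proof.
apply: measurableD; last exact: measurable_over.
by apply: measurableI; [exact: measurable_over|exact: measurable_kills].
Qed.

Lemma measurable_Lam_intruders y : measurable_fun setT (fun g => L (intruders y g)).
Proof.
pose E := [set q : G * G | over y q.2] `&` [set q : G * G | kills 0 q.1 q.2] `\` [set q : G * G | over origin q.2].
apply: (@measurable_fun_section _ _ _ _ _ L E).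
apply: measurableD.
  apply: measurableI; last exact: measurable_kills_comp.
  exact: (measurable_setP measurable_snd (measurable_over y)).
exact: (measurable_setP measurable_snd (measurable_over origin)).
Qed.

Lemma intruders_lty y g : (L (intruders y g) < +oo)%E.
Proof.
apply: le_lt_trans (L_kills_lty L_reach 0 g); apply: le_measure; rewrite ?inE.
- exact: measurable_intruders.
- exact: measurable_kills.
- by move=> h [[]].
Qed.

(** Intruders lie between two lenses that have the same asymptotic
    intensity, hence are negligible. *)
Lemma intruders_sub y g : over origin g ->
  intruders y g `<=` (reach (2 * radius g) origin `&` reach 0 y) `\` (reach 0 origin `&` reach 0 y).
Proof.
case: g => [[x1 r1] w1] [H1 _] [[x r] w] [[[R1 E] [_ _ K _]] no].
split; last by move=> [ro _]; apply: no.
split => //; move: H1 K; rewrite /reach /Defs.radius /Defs.center /= => H1 K.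
have := edist_triangle x1 origin x; lra.
Qed.

Lemma intruders_wide y g : over origin g -> intruders y g `<=` wide (enorm y).
Proof.
case: g => [[x1 r1] w1] [H1 E1] [[x r] w] [[[R1 E] [a1 a2 K W]] _].
move: H1 E1 E R1 a1 a2 K W; rewrite /reach /wide /enorm /balanced_set /Defs.radius /Defs.center /weight /=.
move=> H1 E1 E R1 a1 a2 K W.
have := edist_triangle x1 origin x; have := edist_triangle x y origin; have := edistC x origin.
lra.
Qed.

Section along_sequence.
Variable z : nat -> Rd R d.
Hypothesis zoo : enorm (z n) @[n --> \oo] --> +oo.
Local Notation u := (fun n => enorm (z n)).

Let ugt M : \forall n \near \oo, M < enorm (z n).
Proof. exact: (zoo (nbhs_pinfty_gt (num_real M))). Qed.

Let rho_u : \forall n \near \oo, 0 < rho (enorm (z n)).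
Proof. exact: (zoo (rho_gt0 d tail_gt0)). Qed.

(** Squeezed between the lenses with equal enlargements [0] and [max a b]. *)
Lemma lens_cvg a b : 0 <= a -> 0 <= b ->
  fine (L (reach a origin `&` reach b (z n))) / rho (enorm (z n)) @[n --> \oo] --> c.
Proof.
move=> a0 b0; pose m := Num.max a b.
have m0 : 0 <= m by rewrite le_max a0.
have H t : 0 <= t ->
    fine (L (reach t origin `&` reach t (z n))) / rho (enorm (z n)) @[n --> \oo] --> c.
  move=> t0; under eq_fun do rewrite (lens_rot _ _ _ d1).
  exact: (Lam_lens_cvg d1 F_Rplus alpha_gt_d tail_gt0 tail_lim t0 zoo).
have sub s t x : s <= t -> reach s x `<=` reach t x.
  by move=> st; apply: reach_sub; rewrite edistxx addr0.
apply: squeeze_cvgr (H 0 (lexx _)) (H m m0).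
near=> n; have r0 : 0 < rho (enorm (z n)) by near: n.
apply/andP; split; rewrite ler_pM2r ?invr_gt0//; apply: fine_Lam_le => //;
  try (exact: lens_lty); by apply: setISS; apply: sub; rewrite // le_max lexx ?orbT.
Unshelve. all: by end_near. Qed.

Lemma wide_bound : exists2 C, 0 < C & \forall n \near \oo,
  (L (wide (enorm (z n))) <= (C * rho (enorm (z n)))%:E)%E.
Proof.
have [C C0 HC] := Lam_wide lam F_Rplus alpha_gt_d tail_gt0 tail_lim.
by exists C => //; exact: (zoo HC).
Qed.

Let wide_fin : \forall n \near \oo, (L (wide (enorm (z n))) < +oo)%E.
Proof. exact: wide_near_lty. Qed.

Let measurable_kills_meet g h : measurable (kills 0 g `&` kills 0 h).
Proof. by apply: measurableI; exact: measurable_kills. Qed.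

Lemma overlap_le_wide y g h : (L (wide (enorm y)) < +oo)%E ->
  over origin g -> over origin h -> overlap g (shift y h) <= fine (L (wide (enorm y))).
Proof.
move=> Ly og oh; rewrite /overlap -(Lam_balancedI (_ `&` _)).
apply: fine_Lam_le => //; last exact: overlap_wide.
- by apply: measurableI => //; exact: measurable_balanced_set.
- exact: measurable_wide.
Qed.

Lemma overlap_cvg g h : over origin g -> over origin h ->
  overlap g (shift (z n) h) / rho (enorm (z n)) @[n --> \oo] --> c.
Proof.
move=> og oh; have r1 := over_radius_ge0 og; have r2 := over_radius_ge0 oh.
have r1' : 0 <= 2 * radius g by rewrite mulr_ge0.
have r2' : 0 <= 2 * radius h by rewrite mulr_ge0.
apply: squeeze_cvgr (lens_cvg (lexx 0) (lexx 0)) (lens_cvg r1' r2').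
near=> n; have r0 : 0 < rho (enorm (z n)) by near: n.
apply/andP; split; rewrite ler_pM2r ?invr_gt0// /overlap.
  rewrite -(Lam_balancedI (_ `&` _)); apply: fine_Lam_le => //.
  - by apply: measurableI => //; exact: measurable_balanced_set.
  - by apply: overlap_near => //; near: n; exact: ugt.
  - apply: le_lt_trans (L_kills_lty L_reach 0 g).
    apply: le_measure; rewrite ?inE//; first exact: measurable_kills.
apply: fine_Lam_le => //; last exact: lens_lty.
exact: overlap_far.
Unshelve. all: by end_near. Qed.

Lemma overlap_cvg0 g h : over origin g -> over origin h ->
  overlap g (shift (z n) h) @[n --> \oo] --> (0 : R).
Proof.
move=> og oh.
have := Lam_wide_cvg zoo => /fine_cvg W.
apply: squeeze_cvgr (cvg_cst 0) W.
near=> n; rewrite overlap_ge0/=; apply: overlap_le_wide => //.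
by near: n.
Unshelve. all: by end_near. Qed.

(** The overlap tends to 0, so [exp M - 1] is equivalent to [M], and grains
    far apart do not meet. *)
Lemma gain_cvg g h : over origin g -> over origin h ->
  gain g (shift (z n) h) / rho (enorm (z n)) @[n --> \oo] --> c * (H g * H h).
Proof.
move=> og oh; rewrite [c * _]mulrC.
pose m n := overlap g (shift (z n) h).
have mc : m n / rho (enorm (z n)) @[n --> \oo] --> c by exact: overlap_cvg.
have m0 : m n @[n --> \oo] --> (0 : R) by exact: overlap_cvg0.
have ec : (expR (m n) - 1) / rho (enorm (z n)) @[n --> \oo] --> c.
  have e1 : expR (m n) @[n --> \oo] --> (1 : R).
    rewrite -expR0; apply: (@cvg_comp _ _ _ _ _ _ (nbhs (0 : R))) => //.
    exact: continuous_expR.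
  have mc' : (m n / rho (enorm (z n))) * expR (m n) @[n --> \oo] --> c * 1 by exact: cvgM.
  rewrite mulr1 in mc'.
  apply: squeeze_cvgr mc mc'.
  near=> n; have r0 : 0 < rho (enorm (z n)) by near: n.
  have /andP[a b] := expR_excess_between (overlap_ge0 g (shift (z n) h)).
  by rewrite mulrAC !ler_pM2r ?invr_gt0// a b.
have lim : (H g * H h) * ((expR (m n) - 1) / rho (enorm (z n))) @[n --> \oo] --> (H g * H h) * c.
  by apply: cvgM => //; exact: cvg_cst.
apply: cvg_trans lim; apply: near_eq_cvg; near=> n.
rewrite /gain asboolF; last by apply: not_meets_far => //; near: n; exact: ugt.
by rewrite hprob_shift mulrA.
Unshelve. all: by end_near. Qed.

Lemma gain_bound : exists2 C, 0 < C & \forall n \near \oo, forall g h,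
  over origin g -> over origin h -> 0 <= gain g (shift (z n) h) / rho (enorm (z n)) <= C.
Proof.
have [C C0 HC] := wide_bound; exists C => //; near=> n => g h og oh.
have r0 : 0 < rho (enorm (z n)) by near: n.
have LC : (L (wide (enorm (z n))) <= (C * rho (enorm (z n)))%:E)%E by near: n.
have Lw : (L (wide (enorm (z n))) < +oo)%E by near: n.
rewrite divr_ge0 ?gain_ge0 ?(ltW r0)//= ler_pdivrMr//.
apply: le_trans (gain_le_overlap _ _) _; apply: le_trans (overlap_le_wide Lw og oh) _.
by rewrite -lee_fin fineK// ge0_fin_numE.
Unshelve. all: by end_near. Qed.

(** Stated for an arbitrary parametrization of the two grains: the
    covariance of the cover integrates over grains covering the two points,
    the correlation of the centers over two radii. *)
Lemma gain_integral_cvg dX (X : measurableType dX) (m : {measure set X -> \bar R})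
    (D : set X) (f1 f2 : X -> G) : measurable D -> (m D < +oo)%E ->
  measurable_fun setT f1 -> measurable_fun setT f2 ->
  (forall t, D t -> over origin (f1 t) /\ over origin (f2 t)) ->
  fine (\int[m]_(t in D) (gain (f1 t) (shift (z n) (f2 t)))%:E) / rho (enorm (z n))
    @[n --> \oo] --> fine (\int[m]_(t in D) (c * (H (f1 t) * H (f2 t)))%:E).
Proof.
move=> mD mDoo m1 m2 Dov; have [C C0 HC] := gain_bound.
apply: (scaled_dominated_cvg (C := C)) => //.
- move=> n; apply: (measurable_funS measurableT (@subsetT _ D)).
  apply: measurable_gain_comp => //; exact: (measurableT_comp (measurable_shift (z n)) m2).
- by move=> n x _; exact: gain_ge0.
- near=> n; have r0 : 0 < rho (enorm (z n)) by near: n.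
  split => // x /Dov[p1 p2]; rewrite -ler_pdivrMr//.
  have nC : forall g h, over origin g -> over origin h ->
     0 <= gain g (shift (z n) h) / rho (enorm (z n)) <= C by near: n.
  by have /andP[] := nC _ _ p1 p2.
- by move=> x /Dov[p1 p2]; exact: gain_cvg.
Unshelve. all: by end_near. Qed.

(** Grains covering two points have a radius of at least half their
    distance, so their retention probability is close to 1 uniformly. *)
Lemma intersection_cvg :
  fine (\int[L]_(g in over origin `&` over (z n)) (H g)%:E) / rho (enorm (z n)) @[n --> \oo] --> c.
Proof.
have lensE n : L (over origin `&` over (z n)) = L (reach 0 origin `&` reach 0 (z n)).
  by apply: Lam_ext => x r; split => [[[? _] [? _]]|[? ?]].
have half : (enorm (z n) / 2) @[n --> \oo] --> +oo.
  apply/cvgryPge => A; near=> n; rewrite ler_pdivlMr//; apply: ltW; near: n; exact: ugt.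
have mo n : measurable (over origin `&` over (z n) : set G) by apply: measurableI; exact: measurable_over.
have Llo n : (L (over origin `&` over (z n)) < +oo)%E by rewrite lensE; exact: lens_lty.
have mH n : measurable_fun (over origin `&` over (z n)) (H : G -> mR).
  by apply: (measurable_funS measurableT (@subsetT _ _)); exact: measurable_hprob.
have low : expR (- fine (L (wide (enorm (z n) / 2)))) *
   (fine (L (reach 0 origin `&` reach 0 (z n))) / rho (enorm (z n))) @[n --> \oo] --> 1 * c.
  by apply: cvgM; [exact: (hprob_wide_cvg half)|exact: lens_cvg].
rewrite mul1r in low.
apply: squeeze_cvgr low (lens_cvg (lexx 0) (lexx 0)).
near=> n; have r0 : 0 < rho (enorm (z n)) by near: n.
rewrite mulrA !ler_pM2r ?invr_gt0// -lensE.
apply: integral_between => //; first exact: Llo.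
move=> [[x r] w] [[x0 E] [xz _]]; apply/andP; split; last by case/andP: (hprob01 (x, r, w)).
have {}E : w = r by move: E.
have rz : enorm (z n) / 2 <= r.
  move: x0 xz; rewrite /reach /Defs.center /Defs.radius /= => x0 xz.
  have := edist_triangle x (z n) origin; have := edistC x origin.
  rewrite /enorm; lra.
have Lw : (L (wide (enorm (z n) / 2)) < +oo)%E by near: n; exact: wide_near_lty.
have wr : wide r `<=` (wide (enorm (z n) / 2) : set G) by exact: wide_anti.
have Lr : (L (wide r) < +oo)%E.
  by apply: le_lt_trans Lw; apply: le_measure; rewrite ?inE//; exact: measurable_wide.
rewrite E; apply: le_trans (hprob_ge x Lr).
by rewrite ler_expR lerN2; apply: fine_Lam_le => //; exact: measurable_wide.
Unshelve. all: by end_near. Qed.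

Lemma intersection_cvg0 :
  fine (\int[L]_(g in over origin `&` over (z n)) (H g)%:E) @[n --> \oo] --> (0 : R).
Proof.
have := Lam_wide_cvg zoo => /fine_cvg W.
have mo n : measurable (over origin `&` over (z n) : set G) by apply: measurableI; exact: measurable_over.
apply: squeeze_cvgr (cvg_cst 0) W.
near=> n; have Lw : (L (wide (enorm (z n))) < +oo)%E by near: n.
have sub : over origin `&` over (z n) `<=` (wide (enorm (z n)) : set G).
  move=> [[x r] w] [[x0 _] [xz _]]; move: x0 xz; rewrite /reach /wide /enorm /Defs.center /Defs.radius /=.
  have := edist_triangle x (z n) origin; have := edistC x origin.
  by move=> E1 E2 x0 xz; have := edist_ge0 origin x; lra.
have Lo : (L (over origin `&` over (z n)) < +oo)%E.
  by apply: le_lt_trans Lw; apply: le_measure; rewrite ?inE//; exact: measurable_wide.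
have mH : measurable_fun (over origin `&` over (z n)) (H : G -> mR).
  by apply: (measurable_funS measurableT (@subsetT _ _)); exact: measurable_hprob.
have h01 g : (over origin `&` over (z n)) g -> 0 <= H g <= 1.
  by move=> _; have /andP[a ->] := hprob01 g; rewrite ltW.
have /andP[a b] := integral_between (mo n) Lo mH (lexx 0) h01.
rewrite mul0r in a; rewrite a; apply: le_trans b _.
by apply: fine_Lam_le => //; exact: measurable_wide.
Unshelve. all: by end_near. Qed.

Lemma intruders_bound : exists2 C, 0 < C & \forall n \near \oo, 0 < rho (enorm (z n)) /\
  forall g, over origin g -> fine (L (intruders (z n) g)) <= C * rho (enorm (z n)).
Proof.
have [C C0 HC] := wide_bound; exists C => //; near=> n.
split; first by near: n.
move=> g og.
have LC : (L (wide (enorm (z n))) <= (C * rho (enorm (z n)))%:E)%E by near: n.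
have Lw : (L (wide (enorm (z n))) < +oo)%E by near: n.
apply: (@le_trans _ _ (fine (L (wide (enorm (z n)))))).
  apply: fine_Lam_le => //; [exact: measurable_intruders|exact: measurable_wide|exact: intruders_wide].
by rewrite -lee_fin fineK// ge0_fin_numE.
Unshelve. all: by end_near. Qed.

(** Difference of two lenses with the same limit. *)
Lemma intruders_cvg g : over origin g ->
  fine (L (intruders (z n) g)) / rho (enorm (z n)) @[n --> \oo] --> (0 : R).
Proof.
move=> og; have r1 : 0 <= 2 * radius g by rewrite mulr_ge0//; exact: over_radius_ge0 og.
have lim : fine (L (reach (2 * radius g) origin `&` reach 0 (z n))) / rho (enorm (z n)) -
  fine (L (reach 0 origin `&` reach 0 (z n))) / rho (enorm (z n)) @[n --> \oo] --> c - c.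
  by apply: cvgB; exact: lens_cvg.
rewrite subrr in lim.
apply: squeeze_cvgr (cvg_cst 0) lim.
near=> n; have r0 : 0 < rho (enorm (z n)) by near: n.
rewrite divr_ge0 ?fine_ge0 ?(ltW r0)//= -mulrBl ler_pM2r ?invr_gt0//.
have sub0 : reach 0 origin `&` reach 0 (z n) `<=` (reach (2 * radius g) origin `&` reach 0 (z n) : set G).
  by apply: setISS => //; apply: reach_sub; rewrite edistxx addr0.
apply: fine_measure_setD => //; [exact: measurable_intruders|exact: lens_lty|exact: intruders_sub].
Unshelve. all: by end_near. Qed.

Lemma intruders_integral_cvg :
  fine (\int[L]_(g in over origin) (fine (L (intruders (z n) g)))%:E) / rho (enorm (z n))
   @[n --> \oo] --> (0 : R).
Proof.
have [C C0 HC] := intruders_bound.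
have mo : measurable (over origin : set G) := measurable_over origin.
have Lo : (L (over origin) < +oo)%E by rewrite L_over; exact: L_reach.
rewrite (_ : 0 = fine (\int[L]_(g in over origin) (0 : R)%:E)); last by rewrite integral0.
apply: (scaled_dominated_cvg (C := C) (f_ := fun n g => fine (L (intruders (z n) g)))) => //.
- move=> n; apply: (measurable_funS measurableT (@subsetT _ _)).
  exact: (measurableT_comp (fine_measurable measurableT) (measurable_Lam_intruders (z n))).
- by move=> n g _; rewrite fine_ge0.
- exact: intruders_cvg.
Unshelve. all: by end_near. Qed.

End along_sequence.
End asymptotics.

(** * Integrals of functions with values in the unit interval *)

Section bounded_integrals.
Context d (T : measurableType d) (R : realType) (m : {measure set T -> \bar R}) (D : set T).
Hypotheses (mD : measurable D) (mDoo : (m D < +oo)%E).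
Local Notation mR := (measurableTypeR R).

Lemma bounded_integrable (f : T -> R) : measurable_fun setT (f : T -> mR) ->
  (forall x, D x -> 0 <= f x <= 1) -> m.-integrable D (EFin \o f).
Proof.
move=> mf f01; apply: measurable_bounded_integrable => //.
  exact: (measurable_funS measurableT (@subsetT _ D)).
exists 1; split; first exact: num_real.
move=> M M1 x Dx; have /andP[a b] := f01 x Dx.
by rewrite /= ger0_norm// (le_trans b)// ltW.
Qed.

Definition unit_valued (f : T -> R) :=
  measurable_fun setT (f : T -> mR) /\ forall x, 0 <= f x <= 1.

Let int f : unit_valued f -> m.-integrable D (EFin \o f).
Proof. by move=> [mf f01]; apply: bounded_integrable. Qed.

Lemma Rintegral_addsub (f a b c : T -> R) :
  unit_valued a -> unit_valued b -> unit_valued c ->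
  (forall x, D x -> f x + c x = a x + b x) ->
  \int[m]_(x in D) f x =
  \int[m]_(x in D) a x + \int[m]_(x in D) b x - \int[m]_(x in D) c x.
Proof.
move=> ua ub uc E; rewrite -RintegralD//; [|exact: int|exact: int].
rewrite -RintegralB//; last exact: int.
  by apply: eq_Rintegral => x /set_mem Dx; rewrite -E// addrK.
rewrite (_ : _ \o _ = fun x => (a x)%:E + (b x)%:E)%E; last by apply/funext.
by apply: integrableD => //; exact: int.
Qed.

Lemma Rintegral_add23 (a b c e f : T -> R) :
  unit_valued a -> unit_valued b -> unit_valued c -> unit_valued e -> unit_valued f ->
  (forall x, D x -> a x + b x = c x + e x + f x) ->
  \int[m]_(x in D) a x + \int[m]_(x in D) b x =
  \int[m]_(x in D) c x + \int[m]_(x in D) e x + \int[m]_(x in D) f x.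
Proof.
move=> ua ub uc ue uf E; rewrite -RintegralD//; [|exact: int|exact: int].
rewrite -(RintegralD (f1 := c))//; [|exact: int|exact: int].
rewrite -RintegralD//; last exact: int.
  by apply: eq_Rintegral => x /set_mem Dx; rewrite E.
rewrite (_ : _ \o _ = fun x => (c x)%:E + (e x)%:E)%E; last by apply/funext.
by apply: integrableD => //; exact: int.
Qed.

Lemma Rintegral_indicM (B : set T) (f : T -> R) :
  \int[m]_(x in D) (\1_B x * f x) = \int[m]_(x in D `&` B) f x.
Proof.
rewrite Rintegral_mkcondr; apply: eq_Rintegral => x _.
by rewrite /patch indicE; case: ifP => _; rewrite ?mul1r ?mul0r.
Qed.

Lemma le_Rintegral_indic2 (E1 E2 : set T) (f : T -> R) : unit_valued f ->
  measurable E1 -> measurable E2 -> (forall x, D x -> 0 < f x -> E1 x \/ E2 x) ->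
  \int[m]_(x in D) f x <= \int[m]_(x in D) \1_E1 x + \int[m]_(x in D) \1_E2 x.
Proof.
move=> uf m1 m2 f12.
have u1 E : measurable E -> unit_valued \1_E.
  by move=> mE; split; [exact: measurable_indic|move=> x; rewrite indicE; case: (_ \in _); rewrite ?lexx ?ler01].
rewrite -RintegralD//; [|exact: int (u1 _ m1)|exact: int (u1 _ m2)].
apply: le_Rintegral => //; first exact: int.
  rewrite (_ : _ \o _ = fun x => (\1_E1 x)%:E + (\1_E2 x)%:E)%E; last by apply/funext.
  by apply: integrableD => //; [exact: int (u1 _ m1)|exact: int (u1 _ m2)].
move=> x Dx; have [_ /(_ x) /andP[f0 fle]] := uf.
rewrite !indicE; have [fx|] := ltP 0 (f x); last first.
  by move=> /le_trans; apply; rewrite addr_ge0.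
apply: le_trans fle _.
by have [/mem_set ->|/mem_set ->] := f12 x Dx fx; [rewrite lerDl|rewrite lerDr].
Qed.

End bounded_integrals.

Lemma unit_valuedM d (T : measurableType d) (R : realType) (f g : T -> R) :
  unit_valued f -> unit_valued g -> unit_valued (fun x => f x * g x).
Proof.
move=> [mf f01] [mg g01]; split; first exact: measurable_funM.
move=> x; have [/andP[a0 a1] /andP[b0 b1]] := (f01 x, g01 x).
by rewrite mulr_ge0//= mulr_ile1.
Qed.

Lemma unit_valued_indic d (T : measurableType d) (R : realType) (E : set T) :
  measurable E -> unit_valued (\1_E : T -> R).
Proof.
move=> mE; split; first exact: measurable_indic.
by move=> x; rewrite indicE; case: (_ \in _); rewrite ?lexx ?ler01.
Qed.

Lemma unit_valued_comp d d' (T : measurableType d) (T' : measurableType d') (R : realType)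
    (f : T' -> R) (h : T -> T') :
  measurable_fun setT h -> unit_valued f -> unit_valued (f \o h).
Proof. by move=> mh [mf f01]; split => [|x]; [exact: measurableT_comp|exact: f01]. Qed.

Section product_integrals.
Context d1 d2 (T1 : measurableType d1) (T2 : measurableType d2) (R : realType)
  (m1 : {sigma_finite_measure set T1 -> \bar R}) (m2 : {sigma_finite_measure set T2 -> \bar R})
  (A : set T1) (B : set T2).
Hypotheses (mA : measurable A) (mB : measurable B).

Lemma patch_setX (f : T1 * T2 -> \bar R) x y :
  (f \_ (A `*` B)) (x, y) = ((fun x => (fun y => f (x, y)) \_ B) \_ A) x y.
Proof.
rewrite /patch; have [xA|xA] := boolP (x \in A); have [yB|yB] := boolP (y \in B).
- by rewrite mem_set//; split; exact: set_mem.
- by rewrite memNset// => -[_ /mem_set]; rewrite (negbTE yB).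
- by rewrite memNset// => -[/mem_set]; rewrite (negbTE xA).
- by rewrite memNset// => -[/mem_set]; rewrite (negbTE xA).
Qed.

Lemma fubini_setX1 (f : T1 * T2 -> \bar R) : measurable_fun setT f -> (forall p, 0 <= f p)%E ->
  (\int[m1 \x m2]_(p in A `*` B) f p = \int[m1]_(x in A) \int[m2]_(y in B) f (x, y))%E.
Proof.
move=> mf f0; rewrite integral_mkcond fubini_tonelli1.
- rewrite [RHS]integral_mkcond; apply: eq_integral => x _; rewrite /fubini_F.
  under eq_integral do rewrite patch_setX.
  rewrite {1}/patch; case: ifPn => [xA|xA]; last by rewrite integral0// /patch (negbTE xA).
  by rewrite [in RHS]/patch xA [RHS]integral_mkcond.
- by apply/(measurable_restrictT f (measurableX mA mB)); exact: measurable_funTS.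
- by move=> p; exact: erestrict_ge0.
Qed.

Lemma fubini_setX2 (f : T1 * T2 -> \bar R) : measurable_fun setT f -> (forall p, 0 <= f p)%E ->
  (\int[m1 \x m2]_(p in A `*` B) f p = \int[m2]_(y in B) \int[m1]_(x in A) f (x, y))%E.
Proof.
move=> mf f0; rewrite integral_mkcond fubini_tonelli2.
- rewrite [RHS]integral_mkcond; apply: eq_integral => y _; rewrite /fubini_G.
  transitivity (\int[m1]_x ((fun x => ((fun y => f (x, y)) \_ B) y) \_ A) x)%E.
    by apply: eq_integral => x _; rewrite patch_setX /patch; case: ifPn.
  rewrite -integral_mkcond /patch; case: ifPn => [yB|yB]; first by [].
  by rewrite integral0.
- by apply/(measurable_restrictT f (measurableX mA mB)); exact: measurable_funTS.
- by move=> p; exact: erestrict_ge0.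
Qed.

Lemma Rintegral_prod (a : T1 -> R) (b : T2 -> R) :
  unit_valued a -> unit_valued b ->
  (m1 A < +oo)%E -> (m2 B < +oo)%E ->
  \int[(m1 \x m2)%E]_(p in A `*` B) (a p.1 * b p.2) =
  (\int[m1]_(x in A) a x) * (\int[m2]_(y in B) b y).
Proof.
move=> [ma a01] [mb b01] Aoo Boo.
have a0 x : 0 <= a x by case/andP: (a01 x).
have b0 y : 0 <= b y by case/andP: (b01 y).
have ia := bounded_integrable mA Aoo ma (fun x _ => a01 x).
have ib := bounded_integrable mB Boo mb (fun x _ => b01 x).
rewrite /Rintegral -fineM; [|exact: integrable_fin_num|exact: integrable_fin_num].
congr fine; rewrite fubini_setX1.
- rewrite -ge0_integralZr//; first last.
  + by apply: integral_ge0 => y _; rewrite lee_fin.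
  + by move=> x _; rewrite lee_fin.
  + apply: measurable_funTS; exact/measurable_EFinP.
  apply: eq_integral => x _ /=.
  under eq_integral do rewrite EFinM.
  rewrite ge0_integralZl//.
  + apply: measurable_funTS; exact/measurable_EFinP.
  + by move=> y _; rewrite lee_fin.
  + by rewrite lee_fin.
- apply/measurable_EFinP; apply: measurable_funM.
    exact: (measurableT_comp ma measurable_fst).
  exact: (measurableT_comp mb measurable_snd).
- by move=> p; rewrite lee_fin mulr_ge0.
Qed.

Lemma integral_indic_setX1 (E : set (T1 * T2)) : measurable E ->
  (\int[m1 \x m2]_(p in A `*` B) (\1_E p : R)%:E =
   \int[m1]_(x in A) m2 ([set y | E (x, y)] `&` B))%E.
Proof.
move=> mE; rewrite fubini_setX1.
- apply: eq_integral => x _.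
  transitivity (\int[m2]_(y in B) (\1_[set y | E (x, y)] y : R)%:E)%E; last first.
    by apply: integral_indic => //; exact: (measurable_setP (pair1_measurable x) mE).
  by apply: eq_integral => y _; rewrite !indicE; congr (_%:R%:E); congr nat_of_bool; apply/idP/idP => /set_mem/mem_set.
- by apply/measurable_EFinP; exact: measurable_indic.
- by move=> p; rewrite lee_fin.
Qed.

Lemma integral_indic_setX2 (E : set (T1 * T2)) : measurable E ->
  (\int[m1 \x m2]_(p in A `*` B) (\1_E p : R)%:E =
   \int[m2]_(y in B) m1 ([set x | E (x, y)] `&` A))%E.
Proof.
move=> mE; rewrite fubini_setX2.
- apply: eq_integral => y _.
  transitivity (\int[m1]_(x in A) (\1_[set x | E (x, y)] x : R)%:E)%E; last first.
    by apply: integral_indic => //; exact: (measurable_setP (pair2_measurable y) mE).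
  by apply: eq_integral => x _; rewrite !indicE; congr (_%:R%:E); congr nat_of_bool; apply/idP/idP => /set_mem/mem_set.
- by apply/measurable_EFinP; exact: measurable_indic.
- by move=> p; rewrite lee_fin.
Qed.

Lemma setX_lty : (m1 A < +oo)%E -> (m2 B < +oo)%E -> ((m1 \x m2) (A `*` B) < +oo)%E.
Proof.
move=> Aoo Boo; rewrite product_measure1E//.
by rewrite lte_mul_pinfty// ge0_fin_numE.
Qed.

End product_integrals.

(** * Exact decomposition of the two-point coverage probability *)

Lemma fine_measureU d (T : measurableType d) (R : realType) (m : {measure set T -> \bar R})
    (A B : set T) : measurable A -> measurable B -> (m A < +oo)%E -> (m B < +oo)%E ->
  fine (m (A `|` B)) = fine (m A) + fine (m B) - fine (m (A `&` B)).
Proof.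
move=> mA mB Aoo Boo.
have fin C : measurable C -> C `<=` A -> m C \is a fin_num.
  move=> mC CA; rewrite ge0_fin_numE// (le_lt_trans _ Aoo)//.
  by apply: le_measure; rewrite ?inE.
have mD : measurable (A `\` B) by exact: measurableD.
have mI : measurable (A `&` B) by exact: measurableI.
have finB : m B \is a fin_num by rewrite ge0_fin_numE.
have finD : m (A `\` B) \is a fin_num by apply: fin => //; exact: subDsetl.
have finI : m (A `&` B) \is a fin_num by apply: fin => //; exact: subIsetl.
have -> : m (A `|` B) = (m (A `\` B) + m B)%E.
  rewrite -measureU//; last by rewrite setDE -setIA setICl setI0.
  by congr (m _); rewrite setUC setUDl setDv setD0 setUC.
have -> : m A = (m (A `\` B) + m (A `&` B))%E by exact: measureDI.
rewrite !fineD//; ring.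
Qed.

Lemma split_excess (R : realType) (a b e : R) : a * b * e + 0 = a * b + a * b * (e - 1).
Proof. by ring. Qed.

Lemma unit_interval_mul (R : realType) (a b : R) :
  0 <= a <= 1 -> 0 <= b <= 1 -> 0 <= a * b <= 1.
Proof. by move=> /andP[a0 a1] /andP[b0 b1]; rewrite mulr_ge0//= mulr_ile1. Qed.

(** Inclusion-exclusion over the four cases, under the assumption that [B x]
    or [A y] alone forces [M]. *)
Lemma product_split (R : realType) (T : Type) (B A : set T) (x y : T) (M : Prop) (a b : R) :
  (B x -> M) -> (A y -> M) ->
  (if `[< M >] then a * b else 0) + (\1_B x * a) * (\1_A y * b) =
  (\1_B x * a) * b + a * (\1_A y * b) + (if `[< [/\ ~ B x, ~ A y & M] >] then a * b else 0).
Proof.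
move=> BM AM; rewrite !indicE.
have [Bx|Bx] := pselect (B x); have [Ay|Ay] := pselect (A y).
- rewrite !mem_set// asboolT; last exact: BM.
  by rewrite asboolF => [|[]//]; rewrite !mul1r addr0.
- rewrite mem_set// memNset// asboolT; last exact: BM.
  by rewrite asboolF => [|[]//]; rewrite !mul1r !mul0r !mulr0 !addr0.
- rewrite memNset// mem_set// asboolT; last exact: AM.
  by rewrite asboolF => [|[]//]; rewrite !mul1r !mul0r !addr0 add0r.
- rewrite !memNset// !mul0r !mulr0 addr0 add0r add0r; case: (asboolP M) => m.
    by rewrite asboolT.
  by rewrite asboolF => // -[].
Qed.

Section covariance.
Context (R : realType) (d : nat) (lam : {nonneg R})
  (F : probability (measurableTypeR R) R) (alpha : R).
Local Notation mR := (measurableTypeR R).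
Local Notation G := (grain R d).
Local Notation L := (@Lam R d lam F).
Local Notation H := (hprob L).
Local Notation gain := (gain lam F).
Local Notation overlap := (overlap lam F).
Implicit Types (g h : G) (y : Rd R d).
Hypothesis F_Rplus : F `[0%R, +oo[%classic = 1%E.
Hypothesis alpha_gt_d : d%:R < alpha.
Hypothesis tail_gt0 : \forall t \near +oo, 0 < tail F t.
Hypothesis tail_lim : forall a, 0 < a ->
  tail F (a * t) / tail F t @[t --> +oo] --> a `^ (- alpha).

Let L_reach : forall a x, (L (reach a x) < +oo)%E.
Proof. exact: (Lam_reach_lty lam F_Rplus alpha_gt_d tail_gt0 tail_lim). Qed.

(** The product of retention probabilities, on the pairs that meet: such
    pairs are never both retained although independence would allow it. *)
Definition clash g h : R := if `[< meets g h >] then H g * H h else 0.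

(** Inclusion-exclusion for the measure of the union of the killing sets. *)
Lemma hprob_kills_cup g h :
  expR (- fine (L (kills 0 g `|` kills 0 h))) = H g * H h * expR (overlap g h).
Proof.
rewrite /hprob /overlap -!expRD; congr expR.
have := fine_measureU (measurable_kills 0 g) (measurable_kills 0 h)
  (L_kills_lty L_reach 0 g) (L_kills_lty L_reach 0 h).
by move=> ->; ring.
Qed.

Local Opaque hprob.

Lemma meetsxx g : 0 <= radius g -> meets g g.
Proof. by move=> r0; left; split; rewrite ?addr0 ?edistxx ?addr_ge0. Qed.

(** Two balls with a common point meet, and one of two weights is the
    larger. *)
Lemma over_meets x g h : over x g -> over x h -> meets g h.
Proof.
move=> og oh; have gh := over_meet og oh; have hg := over_meet oh og.
by case/orP: (le_total (weight g) (weight h)) => ?; [left|right]; apply/kills0P.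
Qed.

(** A pair either meets, and then only [clash] and the product remain, or
    does not, and then the joint probability is the product plus [gain]. The
    side condition rules out a grain of negative radius paired with itself,
    which is not retained twice although it does not meet itself. *)
Lemma hprob2_split g h : g <> h \/ 0 <= radius g ->
  hprob2 L (g, h) + clash g h = H g * H h + gain g h.
Proof.
move=> gh; rewrite /hprob2 /clash /gain /=; case: (asboolP (meets g h)) => m.
  by rewrite asboolF ?add0r ?addr0// => -[_ k1 k2]; case: m.
rewrite asboolT; first by rewrite hprob_kills_cup; exact: split_excess.
split; [|by move=> k; apply: m; left|by move=> k; apply: m; right].
by case: gh => // r0 E; apply: m; rewrite -E; exact: meetsxx.
Qed.

Lemma gain_le1 g h : gain g h <= 1.
Proof.
rewrite /gain; case: asboolP => _ //.
apply: expR_excess_le1 (hprob01 lam F g) (hprob01 lam F h) _.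
by rewrite hprob_overlap ler_expR lerN2; exact: (overlap_le_kills lam F_Rplus alpha_gt_d tail_gt0 tail_lim).
Qed.

Lemma hprob_ge01 g : 0 <= H g <= 1.
Proof. by have /andP[a ->] := hprob01 lam F g; rewrite ltW. Qed.

Lemma hprobM01 g h : 0 <= H g * H h <= 1.
Proof. exact: unit_interval_mul (hprob_ge01 g) (hprob_ge01 h). Qed.

Lemma gain01 g h : 0 <= gain g h <= 1.
Proof. by rewrite gain_ge0 gain_le1. Qed.

Lemma unit_hprob : unit_valued (H : G -> R).
Proof. by split; [exact: measurable_hprob|exact: hprob_ge01]. Qed.

Lemma unit_hprob1 : unit_valued (fun p : G * G => H p.1).
Proof. exact: unit_valued_comp measurable_fst unit_hprob. Qed.

Lemma unit_hprob2 : unit_valued (fun p : G * G => H p.2).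
Proof. exact: unit_valued_comp measurable_snd unit_hprob. Qed.

Lemma unit_if (E : set (G * G)) : measurable E ->
  unit_valued (fun p => if `[< E p >] then H p.1 * H p.2 else 0).
Proof.
move=> mE; have := unit_valuedM (unit_valued_indic R mE) (unit_valuedM unit_hprob1 unit_hprob2).
congr unit_valued; apply/funext => p; rewrite indicE; case: asboolP => m.
  by rewrite mem_set// mul1r.
by rewrite memNset// mul0r.
Qed.

Lemma unit_clash : unit_valued (fun p : G * G => clash p.1 p.2).
Proof.
have u := @unit_if [set p : G * G | meets p.1 p.2]; apply: u.
exact: measurable_meets.
Qed.

Lemma unit_gain : unit_valued (fun p : G * G => gain p.1 p.2).
Proof. by split; [exact: measurable_gain|move=> p; exact: gain01]. Qed.

Section two_points.
Variable y : Rd R d.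
Local Notation A := (over (origin : Rd R d)).
Local Notation B := (over y).
Local Notation I f := (\int[(L \x L)%E]_(p in A `*` B) f p).

Let mA : measurable A. Proof. exact: measurable_over. Qed.
Let mB : measurable B. Proof. exact: measurable_over. Qed.
Let LA : (L A < +oo)%E. Proof. by rewrite L_over; exact: L_reach. Qed.
Let LB : (L B < +oo)%E. Proof. by rewrite L_over; exact: L_reach. Qed.
Let mAB : measurable (A `*` B). Proof. exact: measurableX. Qed.
Let LAB : ((L \x L)%E (A `*` B) < +oo)%E. Proof. exact: (setX_lty mA mB LA LB). Qed.

(** The pairs that meet without either grain covering both points. *)
Definition collision g h : R :=
  if `[< [/\ ~ B g, ~ A h & meets g h] >] then H g * H h else 0.

Lemma collision01 g h : 0 <= collision g h <= 1.
Proof. by rewrite /collision; case: asboolP => _; [exact: hprobM01|rewrite lexx ler01]. Qed.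

(** A grain covering both points meets every grain covering one of them. *)
Lemma clash_split g h : A g -> B h ->
  clash g h + (\1_B g * H g) * (\1_A h * H h) =
  (\1_B g * H g) * H h + H g * (\1_A h * H h) + collision g h.
Proof.
by move=> Ag Bh; apply: product_split => ?; [exact: over_meets Bh|exact: over_meets Ag _].
Qed.

Let p := \int[L]_(g in A) H g.
Let S := \int[L]_(g in A `&` B) H g.

Lemma integral_shift_over (f : G -> \bar R) : measurable_fun setT f -> (forall g, 0 <= f g)%E ->
  (\int[L]_(g in B) f (shift (topp y) g) = \int[L]_(g in A) f g)%E.
Proof.
move=> mf f0; rewrite integral_mkcond [RHS]integral_mkcond.
rewrite -[RHS](integral_shift lam F (topp y)).
- apply: eq_integral => g _; rewrite /patch.
  have AB : A (shift (topp y) g) <-> B g.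
    by rewrite -(over_shift (topp y) y g) (_ : tadd y (topp y) = origin)// -(taddK origin y) origin_tadd.
  by congr (if _ then _ else _); apply/idP/idP => /set_mem/AB/mem_set.
- by apply/(measurable_restrictT f mA); exact: measurable_funTS.
- by move=> g; exact: erestrict_ge0.
Qed.

Lemma Rintegral_hprob_over : \int[L]_(g in B) H g = p.
Proof.
have E g : (H (shift (topp y) g))%:E = (H g)%:E by rewrite hprob_shift.
have E1 : (\int[L]_(g in B) (H (shift (topp y) g))%:E = \int[L]_(g in B) (H g)%:E)%E.
  by apply: eq_integral => g _; exact: E.
have m0 : measurable_fun setT (fun g => (H g)%:E) by apply/measurable_EFinP; exact: measurable_hprob.
have h0 g : (0 <= (H g)%:E)%E by rewrite lee_fin; case/andP: (hprob_ge01 g).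
have E2 := integral_shift_over m0 h0.
by rewrite /p /Rintegral -E1 E2.
Qed.

Lemma unit_collision : unit_valued (fun q : G * G => collision q.1 q.2).
Proof.
have u := @unit_if [set q : G * G | [/\ ~ B q.1, ~ A q.2 & meets q.1 q.2]]; apply: u.
rewrite (_ : [set q | _] = ~` [set q : G * G | B q.1] `&` (~` [set q : G * G | A q.2] `&` [set q | meets q.1 q.2])).
  apply: measurableI; first by apply: measurableC; exact: (measurable_setP measurable_fst mB).
  apply: measurableI; first by apply: measurableC; exact: (measurable_setP measurable_snd mA).
  exact: measurable_meets.
by apply/seteqP; split => q; [move=> []|move=> [? []]].
Qed.

(** In the integrated form of [clash_split] all the terms but the collisions
    are products of functions of one grain, and factorize. *)
Lemma clash_integral : I (fun q => clash q.1 q.2) =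
  S * p + p * S + I (fun q => collision q.1 q.2) - S * S.
Proof.
apply/eqP; rewrite -subr_eq opprK; apply/eqP.
have uB := unit_valued_indic R mB; have uA := unit_valued_indic R mA.
have uBH := unit_valuedM uB unit_hprob; have uAH := unit_valuedM uA unit_hprob.
have uBH1 := unit_valued_comp (measurable_fst (T1 := G) (T2 := G)) uBH.
have uAH2 := unit_valued_comp (measurable_snd (T1 := G) (T2 := G)) uAH.
have SB : \int[L]_(g in A) (\1_B g * H g) = S by rewrite Rintegral_indicM.
have SA : \int[L]_(g in B) (\1_A g * H g) = S by rewrite Rintegral_indicM setIC.
have E1 : I (fun q => (\1_B q.1 * H q.1) * H q.2) = S * p.
  by rewrite (Rintegral_prod mA mB uBH unit_hprob LA LB) SB Rintegral_hprob_over.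
have E2 : I (fun q => H q.1 * (\1_A q.2 * H q.2)) = p * S.
  by rewrite (Rintegral_prod mA mB unit_hprob uAH LA LB) SA.
have E3 : I (fun q => (\1_B q.1 * H q.1) * (\1_A q.2 * H q.2)) = S * S.
  by rewrite (Rintegral_prod mA mB uBH uAH LA LB) SB SA.
have split_pair q : (A `*` B) q -> clash q.1 q.2 + (\1_B q.1 * H q.1) * (\1_A q.2 * H q.2) =
    (\1_B q.1 * H q.1) * H q.2 + H q.1 * (\1_A q.2 * H q.2) + collision q.1 q.2.
  by move=> [Aq Bq]; exact: clash_split.
have Z := Rintegral_add23 mAB LAB unit_clash (unit_valuedM uBH1 uAH2)
  (unit_valuedM uBH1 unit_hprob2) (unit_valuedM unit_hprob1 uAH2) unit_collision split_pair.
exact: etrans (congr1 (+%R _) (esym E3)) (etrans Z (congr1 (+%R^~ _) (congr2 +%R E1 E2))).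
Qed.

(** The product term factorizes into the square of the volume fraction. *)
Lemma hprob2_integral : I (hprob2 L) =
  p * p + I (fun q => gain q.1 q.2) - I (fun q => clash q.1 q.2).
Proof.
have E0 : I (fun q => H q.1 * H q.2) = p * p.
  by rewrite (Rintegral_prod mA mB unit_hprob unit_hprob LA LB) Rintegral_hprob_over.
have split_pair q : (A `*` B) q -> hprob2 L q + clash q.1 q.2 = H q.1 * H q.2 + gain q.1 q.2.
  move=> [Aq _]; rewrite [q in hprob2 L q]surjective_pairing.
  by apply: hprob2_split; right; exact: over_radius_ge0 Aq.
have Z := Rintegral_addsub mAB LAB (unit_valuedM unit_hprob1 unit_hprob2) unit_gain unit_clash split_pair.
exact: etrans Z (congr1 (fun t => t + _ - _) E0).
Qed.

Let shiftNK h : shift y (shift (topp y) h) = h.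
Proof. by rewrite -{1}(toppK y) shiftK. Qed.

(** Both grains are brought to the origin, so that the domain of integration
    no longer depends on [y]. *)
Lemma gain_integral_shift : I (fun q => gain q.1 q.2) =
  \int[(L \x L)%E]_(q in A `*` A) gain q.1 (shift y q.2).
Proof.
have ms2 : measurable_fun setT (fun q : G * G => shift y q.2).
  exact: (measurableT_comp (measurable_shift y) measurable_snd).
have m1 : measurable_fun setT (fun q : G * G => (gain q.1 q.2)%:E).
  by apply/measurable_EFinP; exact: measurable_gain.
have m2 : measurable_fun setT (fun q : G * G => (gain q.1 (shift y q.2))%:E).
  by apply/measurable_EFinP; apply: measurable_gain_comp => //; exact: measurable_fst.
have g0 g h : (0 <= (gain g h)%:E)%E by rewrite lee_fin; exact: gain_ge0.
have F1 := fubini_setX1 L L mA mB m1 (fun q => g0 q.1 q.2).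
have F2 := fubini_setX1 L L mA mA m2 (fun q => g0 q.1 (shift y q.2)).
apply: (congr1 fine); apply: (etrans F1); apply: esym; apply: (etrans F2).
apply: eq_integral => g _.
pose f h := (gain g (shift y h))%:E.
have mf : measurable_fun setT f.
  apply/measurable_EFinP; apply: measurable_gain_comp; first exact: measurable_cst.
  exact: measurable_shift.
apply: etrans (esym (integral_shift_over mf (fun h => g0 g _))) _.
by apply: eq_integral => h _; rewrite /f shiftNK.
Qed.

Let E1 := [set q : G * G | intruders y q.1 q.2].
Let E2 := [set q : G * G | intruders (topp y) (shift (topp y) q.2) (shift (topp y) q.1)].

(** The killer of a colliding pair is an intruder; when it is the first
    grain, translation by [- y] exchanges the roles of the two points. *)
Lemma collision_cases q : (A `*` B) q -> 0 < collision q.1 q.2 -> E1 q \/ E2 q.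
Proof.
move=> [Aq Bq]; rewrite /collision; case: asboolP => [[nB nA m] _|_]; last by rewrite ltxx.
have AB g : A (shift (topp y) g) <-> B g.
  by rewrite -(over_shift (topp y) y g) (_ : tadd y (topp y) = origin)// -(taddK origin y) origin_tadd.
case: m => k; [left|right]; first by split.
split; last by rewrite AB.
by split; [exact/over_shift0|exact/kills_shift].
Qed.

Lemma measurable_intruders2 z : measurable [set q : G * G | intruders z q.1 q.2].
Proof.
have H1 : measurable [set q : G * G | over z q.2] by exact: (measurable_setP measurable_snd (measurable_over z)).
have H2 : measurable [set q : G * G | over origin q.2] by exact: (measurable_setP measurable_snd mA).
exact: measurableD (measurableI _ _ H1 (measurable_kills_comp (f1 := fst) (f2 := snd) measurable_fst measurable_snd)) H2.
Qed.

Lemma collision_le : I (fun q => collision q.1 q.2) <=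
  \int[L]_(g in A) fine (L (intruders y g)) + \int[L]_(g in A) fine (L (intruders (topp y) g)).
Proof.
have mE1 : measurable E1 by exact: measurable_intruders2.
have mshift : measurable_fun setT (shift (topp y) : G -> G) by exact: measurable_shift.
have mE2 : measurable E2.
  apply: (measurable_setP (f := fun q : G * G => (shift (topp y) q.2, shift (topp y) q.1)) _
    (measurable_intruders2 (topp y))).
  apply: measurable_fun_pair; first exact: (measurableT_comp mshift measurable_snd).
  exact: (measurableT_comp mshift measurable_fst).
have fin z g : (fine (L (intruders z g)))%:E = L (intruders z g).
  rewrite fineK// ge0_fin_numE//.
  exact: (intruders_lty lam F_Rplus alpha_gt_d tail_gt0 tail_lim).
have R1 : I (fun q => \1_E1 q) = \int[L]_(g in A) fine (L (intruders y g)).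
  apply: (congr1 fine); apply: (etrans (integral_indic_setX1 L L mA mB mE1)).
  apply: eq_integral => g _; rewrite fin; congr (Lam lam F _).
  by apply/seteqP; split => h; [move=> []|move=> hh; split => //; case: hh => -[]].
have R2 : I (fun q => \1_E2 q) = \int[L]_(g in A) fine (L (intruders (topp y) g)).
  apply: (congr1 fine); apply: (etrans (integral_indic_setX2 L L mA mB mE2)).
  have mf : measurable_fun setT (fun g => (fine (L (intruders (topp y) g)))%:E).
    by apply/measurable_EFinP; apply: (measurableT_comp (fine_measurable measurableT));
      exact: measurable_Lam_intruders.
  have f0 g : (0 <= (fine (L (intruders (topp y) g)))%:E)%E by rewrite lee_fin fine_ge0.
  apply: etrans _ (integral_shift_over mf f0).
  apply: eq_integral => h _; rewrite fin.
  apply: etrans _ (Lam_shift lam F (topp y) (measurable_intruders (topp y) (shift (topp y) h))).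
  congr (Lam lam F _); apply/seteqP; split => g; first by move=> [].
  move=> hh; split => //; case: hh => -[og _] _; move: og.
  by move=> /over_shift0.
have Z := le_Rintegral_indic2 mAB LAB unit_collision mE1 mE2 collision_cases.
by apply: le_trans Z _; rewrite R1 R2.
Qed.

End two_points.

End covariance.

(** * Asymptotics of the covariance function *)

Section real_sequences.
Variable R : realType.
Implicit Types a b s t r : R ^nat.

Lemma ratio_squeeze0 a b t r : (\forall n \near \oo, 0 < r n) ->
  (forall n, 0 <= t n <= a n + b n) ->
  a n / r n @[n --> \oo] --> (0 : R) -> b n / r n @[n --> \oo] --> (0 : R) ->
  t n / r n @[n --> \oo] --> (0 : R).
Proof.
move=> r0 tab ar br.
have abr : a n / r n + b n / r n @[n --> \oo] --> (0 + 0 : R) by exact: cvgD.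
rewrite addr0 in abr.
apply: squeeze_cvgr (cvg_cst 0) abr.
near=> n; have rn : 0 < r n by near: n.
have /andP[t0 tle] := tab n.
by rewrite divr_ge0 ?(ltW rn)//= -mulrDl ler_pM2r ?invr_gt0.
Unshelve. all: by end_near. Qed.

(** The leading constants add up to [1 - 2 * p + p ^ 2]. *)
Lemma ratio_combination a b s t r (c p : R) :
  (forall n, t n = s n * (1 - 2 * p) + s n * s n - a n + b n) ->
  s n / r n @[n --> \oo] --> c -> s n @[n --> \oo] --> (0 : R) ->
  a n / r n @[n --> \oo] --> (0 : R) -> b n / r n @[n --> \oo] --> c * (p * p) ->
  t n / r n @[n --> \oo] --> c * (1 - p) ^+ 2.
Proof.
move=> tE sr s0 ar br.
have lim : s n / r n * (1 - 2 * p) + s n / r n * s n - a n / r n + b n / r n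
    @[n --> \oo] --> c * (1 - 2 * p) + c * 0 - 0 + c * (p * p).
  apply: cvgD br; apply: cvgB ar; apply: cvgD.
    by apply: cvgM sr _; exact: cvg_cst.
  exact: cvgM sr s0.
rewrite (_ : c * (1 - p) ^+ 2 = c * (1 - 2 * p) + c * 0 - 0 + c * (p * p)); last by ring.
apply: cvg_trans lim; apply: near_eq_cvg; apply: nearW => n.
by rewrite tE; ring.
Qed.

Lemma ratio_difference a b t r (l : R) :
  (\forall n \near \oo, t n = a n - b n) ->
  a n / r n @[n --> \oo] --> l -> b n / r n @[n --> \oo] --> (0 : R) ->
  t n / r n @[n --> \oo] --> l.
Proof.
move=> tE ar br.
have lim : a n / r n - b n / r n @[n --> \oo] --> l - 0 by exact: cvgB.
rewrite subr0 in lim; apply: cvg_trans lim; apply: near_eq_cvg.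
by apply: filterS tE => n ->; rewrite mulrBl.
Qed.

End real_sequences.

Section covariance_asymptotics.
Context (R : realType) (d : nat) (dO : measure_display) (Omega : measurableType dO)
  (P : probability Omega R) (Phi : Omega -> set (grain R d)) (lam : {nonneg R})
  (F : probability (measurableTypeR R) R) (alpha : R).
Local Notation mR := (measurableTypeR R).
Local Notation G := (grain R d).
Local Notation L := (@Lam R d lam F).
Local Notation H := (hprob L).
Local Notation rho := (rho d F).
Local Notation A := (over (origin : Rd R d)).
Local Notation c := (lam%:num * c_alpha alpha d).
Hypothesis d1 : (1 <= d)%N.
Hypothesis HPi : poisson_random_measure P Phi (intensity lam%:num F (radius_weight R)).
Hypothesis F_Rplus : F `[0%R, +oo[%classic = 1%E.
Hypothesis alpha_gt_d : d%:R < alpha.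
Hypothesis tail_gt0 : \forall t \near +oo, 0 < tail F t.
Hypothesis tail_lim : forall a, 0 < a ->
  tail F (a * t) / tail F t @[t --> +oo] --> a `^ (- alpha).

Let L_reach : forall a x, (L (reach a x) < +oo)%E.
Proof. exact: (Lam_reach_lty lam F_Rplus alpha_gt_d tail_gt0 tail_lim). Qed.
Let L_point g : L [set g] = 0%E. Proof. exact: Lam_set1. Qed.
Let HP : poisson_random_measure P Phi L. Proof. exact: poisson_Lam. Qed.
Let mo (y : Rd R d) : measurable (over y). Proof. exact: measurable_over. Qed.
Let Lo (y : Rd R d) : (L (over y) < +oo)%E. Proof. by rewrite L_over; exact: L_reach. Qed.

Local Notation p := (p_th P Phi).

Local Opaque hprob hprob2.

Lemma P_coveredE y : fine (P (covered Phi y)) = \int[L]_(g in over y) H g.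
Proof.
apply: (congr1 fine).
rewrite (P_covered HPi y).
exact: (P_hits HP L_reach L_point (mo y) (Lo y) (@over_meet R d y)).
Qed.

Lemma p_thE : p = \int[L]_(g in A) H g.
Proof. exact: P_coveredE. Qed.

Lemma P_covered_both y : fine (P (covered Phi origin `&` covered Phi y)) =
  \int[L]_(g in A `&` over y) H g + \int[(L \x L)%E]_(q in A `*` over y) hprob2 L q.
Proof.
rewrite (P_covered2 HPi).
have mI : measurable (A `&` over y) by exact: measurableI.
have LI : (L (A `&` over y) < +oo)%E.
  by apply: le_lt_trans (Lo y); apply: le_measure; rewrite ?inE.
have BI g g' : (A `&` over y) g -> (A `&` over y) g' -> gball g `&` gball g' !=set0.
  by move=> [_ a] [_ b]; exact: over_meet a b.
have H1 := P_hits HP L_reach L_point mI LI BI.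
have H2 := P_hits2 HP L_reach L_point (mo origin) (mo y) (Lo origin) (Lo y)
  (@over_meet R d origin) (@over_meet R d y).
have mh B : measurable B -> measurable (hits Phi B) by move=> mB; exact: (measurable_hits HP mB).
have mh2 : measurable (hits2 Phi A (over y)).
  rewrite (hits2E Phi (@over_meet R d origin) (@over_meet R d y)).
  by apply: measurableD; [apply: measurableI|]; apply: mh.
rewrite fineD; [|by apply: fin_num_measure; exact: mh|exact: fin_num_measure].
by congr (_ + _); apply: (congr1 fine).
Qed.

(** The two coverage probabilities are sums over one or two retained grains,
    and [hprob2_integral] and [clash_integral] express the latter through
    [S], [p] and the gain; the products [p * p] cancel. *)
Lemma k_thE y : k_th P Phi y =
  \int[L]_(g in A `&` over y) H g * (1 - 2 * p)
  + \int[L]_(g in A `&` over y) H g * \int[L]_(g in A `&` over y) H g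
  - \int[(L \x L)%E]_(q in A `*` over y) collision lam F y q.1 q.2
  + \int[(L \x L)%E]_(q in A `*` A) gain lam F q.1 (shift y q.2).
Proof.
have E1 := hprob2_integral lam F_Rplus alpha_gt_d tail_gt0 tail_lim y.
have E2 := clash_integral lam F_Rplus alpha_gt_d tail_gt0 tail_lim y.
rewrite /k_th P_covered_both E1 E2 (gain_integral_shift lam F y) !P_coveredE.
have E3 := Rintegral_hprob_over lam F y.
rewrite E3 p_thE; ring.
Qed.

(** With positive probability no grain at all covers the origin; this makes
    the limiting constant nonzero. *)
Lemma p_th_lt1 : p < 1.
Proof.
have mr : measurable (reach 0 origin : set G) by exact: measurable_reach.
have mv := measurable_npoints0 HP mr.
have PE := P_void HP mr (L_reach 0 origin).
have sub : covered Phi origin `<=` ~` [set w | npoints Phi (reach 0 origin) w = 0%E].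
  move=> w; rewrite coveredE => -[g [pg _] gr] /npoints_eq0.
  by rewrite -subset0 => /(_ g); apply; split.
have mc : measurable (covered Phi origin) by exact: (measurable_covered HPi).
have le : (P (covered Phi origin) <= P (~` [set w | npoints Phi (reach 0 origin) w = 0%E]))%E.
  by apply: le_measure; rewrite ?inE//; exact: measurableC.
rewrite probability_setC in le; last exact: mv.
have PE' : P [set w | npoints Phi (reach 0 origin) w = 0%E] = (expR (- fine (L (reach 0 origin))))%:E.
  exact: PE.
rewrite PE' -EFinB in le.
have fp : P (covered Phi origin) \is a fin_num by exact: fin_num_measure.
rewrite -(fineK fp) lee_fin in le.
apply: le_lt_trans le _.
by rewrite ltrBlDr ltrDl expR_gt0.
Qed.

Section along_sequence.
Variable z : nat -> Rd R d.
Hypothesis zoo : enorm (z n) @[n --> \oo] --> +oo.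
Local Notation u := (fun n => enorm (z n)).

Let uoo : u n @[n --> \oo] --> +oo. Proof. exact: zoo. Qed.
Let rho_u : \forall n \near \oo, 0 < rho (u n).
Proof. exact: (zoo (rho_gt0 d tail_gt0)). Qed.

Lemma collision_cvg :
  \int[(L \x L)%E]_(q in A `*` over (z n)) collision lam F (z n) q.1 q.2 / rho (u n)
  @[n --> \oo] --> (0 : R).
Proof.
have zoo' : enorm (topp (z n)) @[n --> \oo] --> +oo.
  by under eq_fun do rewrite enorm_topp.
have C1 := intruders_integral_cvg lam d1 F_Rplus alpha_gt_d tail_gt0 tail_lim zoo.
have C2 : fine (\int[L]_(g in A) (fine (L (intruders (topp (z n)) g)))%:E) / rho (u n)
    @[n --> \oo] --> (0 : R).
  have := intruders_integral_cvg lam d1 F_Rplus alpha_gt_d tail_gt0 tail_lim zoo'.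
  by under eq_fun do rewrite enorm_topp.
apply: (ratio_squeeze0 rho_u _ C1 C2) => n; apply/andP; split.
  apply: Rintegral_ge0 => q _.
  by have /andP[] := collision01 lam F (z n) q.1 q.2.
exact: (collision_le lam F_Rplus alpha_gt_d tail_gt0 tail_lim (z n)).
Qed.

Lemma gain_over_cvg :
  \int[(L \x L)%E]_(q in A `*` A) gain lam F q.1 (shift (z n) q.2) / rho (u n)
  @[n --> \oo] --> c * (p * p).
Proof.
have lo := Lo origin; have mA := mo origin.
have lim := gain_integral_cvg (lam := lam) d1 F_Rplus alpha_gt_d tail_gt0 tail_lim zoo
  (measurableX mA mA) (setX_lty mA mA lo lo) measurable_fst measurable_snd
  (fun q (Aq : (A `*` A) q) => Aq).
suff E : fine (\int[(L \x L)%E]_(q in A `*` A) (c * (H q.1 * H q.2))%:E)%E = c * (p * p).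
  by rewrite -E; exact: lim.
have uH := unit_hprob d lam F.
have Z := Rintegral_prod mA mA uH uH lo lo.
rewrite p_thE -Z; apply: RintegralZl; first exact: measurableX.
apply: (bounded_integrable (measurableX mA mA) (setX_lty mA mA lo lo)).
  by have [] := unit_valuedM (unit_hprob1 d lam F) (unit_hprob2 d lam F).
by move=> q _; exact: hprobM01.
Qed.

Lemma k_th_cvg : k_th P Phi (z n) / rho (u n) @[n --> \oo] --> c * (1 - p) ^+ 2.
Proof.
have S1 := intersection_cvg (lam := lam) d1 F_Rplus alpha_gt_d tail_gt0 tail_lim zoo.
have S0 := intersection_cvg0 lam F_Rplus alpha_gt_d tail_gt0 tail_lim zoo.
exact: (ratio_combination (fun n => k_thE (z n)) S1 S0 collision_cvg gain_over_cvg).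
Qed.

End along_sequence.

End covariance_asymptotics.

(** * Asymptotics of the retention covariance of centers *)

(** Measurability of the partial integrals of the difference is inherited
    from the two nonnegative parts. *)
Lemma Rintegral_iterated_sub d1 d2 (T1 : measurableType d1) (T2 : measurableType d2) (R : realType)
    (m1 : probability T1 R) (m2 : probability T2 R) (a b : T1 * T2 -> R) :
  unit_valued a -> unit_valued b ->
  \int[m1]_x \int[m2]_y (a (x, y) - b (x, y)) =
  \int[(m1 \x m2)%E]_p a p - \int[(m1 \x m2)%E]_p b p.
Proof.
move=> ua ub.
have m2T : (m2 setT < +oo)%E by rewrite probability_setT ltry.
have m1T : (m1 setT < +oo)%E by rewrite probability_setT ltry.
have sec (f : T1 * T2 -> R) x : unit_valued f -> unit_valued (fun y => f (x, y) : R).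
  by move=> uf; exact: (unit_valued_comp (pair1_measurable x) uf).
have int (f : T1 * T2 -> R) x : unit_valued f -> m2.-integrable setT (EFin \o (fun y => f (x, y) : R)).
  by move=> /(sec _ x)[mf f01]; apply: bounded_integrable.
have unit_int (f : T1 * T2 -> R) : unit_valued f -> unit_valued (fun x => \int[m2]_y (f (x, y) : R)).
  move=> uf; split.
    apply: (measurableT_comp (fine_measurable measurableT)).
    apply: (measurable_fun_fubini_tonelli_F (m2 := m2) (fun p => (f p)%:E)).
      by apply/measurable_EFinP; exact: uf.1.
    by move=> p; rewrite lee_fin; case/andP: (uf.2 p).
  move=> x; have [mf f01] := sec f x uf.
  have /andP[i0 i1] := integral_between (D := setT) measurableT m2T mf (lexx 0) (fun y _ => f01 y).
  have fT : fine (m2 setT) = 1 by rewrite probability_setT.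
  by rewrite mul0r in i0; rewrite fT in i1; apply/andP.
have dbl (f : T1 * T2 -> R) : unit_valued f -> \int[m1]_x \int[m2]_y (f (x, y) : R) = \int[(m1 \x m2)%E]_p f p.
  move=> uf; apply: (congr1 fine).
  rewrite fubini_tonelli1; first last.
  - by move=> p; rewrite lee_fin; case/andP: (uf.2 p).
  - by apply/measurable_EFinP; exact: uf.1.
  apply: eq_integral => x _; rewrite /fubini_F /Rintegral fineK//.
  by apply: integrable_fin_num => //; exact: int.
rewrite -(dbl _ ua) -(dbl _ ub) -RintegralB//.
- by apply: eq_Rintegral => x _; rewrite RintegralB//; exact: int.
- by have [mf f01] := unit_int _ ua; apply: bounded_integrable.
- by have [mf f01] := unit_int _ ub; apply: bounded_integrable.
Qed.

Lemma Rintegral_indic_fst d1 d2 (T1 : measurableType d1) (T2 : measurableType d2) (R : realType)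
    (m1 : probability T1 R) (m2 : probability T2 R) (I : set T1) : measurable I ->
  \int[(m1 \x m2)%E]_q \1_(I `*` [set: T2]) q = fine (m1 I).
Proof.
move=> mI; rewrite /Rintegral integral_indic//; last exact: measurableX.
rewrite setIT; apply: (congr1 fine).
apply: etrans (product_measure1E m1 m2 mI measurableT) _.
exact: etrans (congr1 (mule (m1 I)) (@probability_setT _ _ _ m2)) (mule1 _).
Qed.

Lemma Rintegral_indic_snd d1 d2 (T1 : measurableType d1) (T2 : measurableType d2) (R : realType)
    (m1 : probability T1 R) (m2 : probability T2 R) (I : set T2) : measurable I ->
  \int[(m1 \x m2)%E]_q \1_([set: T1] `*` I) q = fine (m2 I).
Proof.
move=> mI; rewrite /Rintegral integral_indic//; last exact: measurableX.
rewrite setIT; apply: (congr1 fine).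
apply: etrans (product_measure1E m1 m2 measurableT mI) _.
exact: etrans (congr1 (mule^~ (m2 I)) (@probability_setT _ _ _ m1)) (mul1e _).
Qed.

Lemma swap_sub (R : realType) (a b e g : R) : a + b = e + g -> a - e = g - b.
Proof. by move=> E; lra. Qed.

Section two_point_asymptotics.
Context (R : realType) (d : nat) (dO : measure_display) (Omega : measurableType dO)
  (P : probability Omega R) (Phi : Omega -> set (grain R d)) (lam : {nonneg R})
  (F : probability (measurableTypeR R) R) (alpha : R).
Local Notation mR := (measurableTypeR R).
Local Notation G := (grain R d).
Local Notation L := (@Lam R d lam F).
Local Notation H := (hprob L).
Local Notation rho := (rho d F).
Local Notation c := (lam%:num * c_alpha alpha d).
Local Notation FF := ((F \x F)%E).
Hypothesis d1 : (1 <= d)%N.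
Hypothesis HPi : poisson_random_measure P Phi (intensity lam%:num F (radius_weight R)).
Hypothesis F_Rplus : F `[0%R, +oo[%classic = 1%E.
Hypothesis alpha_gt_d : d%:R < alpha.
Hypothesis tail_gt0 : \forall t \near +oo, 0 < tail F t.
Hypothesis tail_lim : forall a, 0 < a ->
  tail F (a * t) / tail F t @[t --> +oo] --> a `^ (- alpha).

Let L_reach : forall a x, (L (reach a x) < +oo)%E.
Proof. exact: (Lam_reach_lty lam F_Rplus alpha_gt_d tail_gt0 tail_lim). Qed.

Local Opaque hprob hprob2 gain.

(** A reference grain of the model: its weight is its radius. *)
Definition central (r : R) : G := (origin, r, r).

Lemma measurable_central : measurable_fun setT (central : mR -> G).
Proof. by apply: measurable_fun_pair => //; apply: measurable_fun_pair. Qed.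

Local Notation hr := (fun r : mR => H (central r)).

Lemma unit_central : unit_valued hr.
Proof. exact: (unit_valued_comp measurable_central (unit_hprob d lam F)). Qed.

(** The centers differ, so the two reference grains are distinct and
    [hprob2_split] applies to all radii. *)
Lemma retention_covE u r1 r2 : 0 < u ->
  retention_cov P Phi (radius_weight R) u r1 r2 =
  gain lam F (central r1) (shift (scaled_e1 u) (central r2)) -
  clash lam F (central r1) (shift (scaled_e1 u) (central r2)).
Proof.
move=> u0; have neq : central r1 <> shift (scaled_e1 u) (central r2).
  move=> /(congr1 (fun g : G => enorm (center g))).
  rewrite /central /shift /recenter /Defs.center /= origin_tadd {1}/enorm edistxx.
  by rewrite scaled_e1E enorm_tscale ?(ltW u0)// enorm_e1// mulr1 => u00; rewrite -u00 ltxx in u0.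
have := hprob2_split lam F_Rplus alpha_gt_d tail_gt0 tail_lim (or_introl neq).
have sE : shift (scaled_e1 u) (central r2) = (scaled_e1 u, r2, r2).
  by rewrite /central /shift /recenter /Defs.center /Defs.radius /weight /= origin_tadd.
rewrite /retention_cov (mean_retention2E d1 HPi L_reach) !(mean_retentionE d1 HPi L_reach) -sE.
by rewrite hprob_shift; exact: swap_sub.
Qed.

Lemma lambda_thE : lambda_th P Phi lam%:num F (radius_weight R) = lam%:num * \int[F]_r hr r.
Proof.
rewrite /lambda_th; congr (_ * _); apply: eq_Rintegral => r _.
exact: (mean_retentionE d1 HPi L_reach).
Qed.

Let Rplus : set mR := `[0%R, +oo[%classic.

Let mRplus : measurable Rplus. Proof. exact: measurable_itv. Qed.

Let F_lty (B : set mR) : measurable B -> (F B < +oo)%E.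
Proof. by move=> mB; apply: le_lt_trans (probability_le1 F mB) (ltry 1). Qed.

Lemma Rintegral_Rplus (f : mR -> R) : unit_valued f -> \int[F]_(r in Rplus) f r = \int[F]_r f r.
Proof.
move=> [mf f01].
have FC : F (~` Rplus) = 0%E by rewrite probability_setC// F_Rplus subee.
rewrite -[in RHS](setUv Rplus) Rintegral_setU//.
- have /andP[a b] := integral_between (measurableC mRplus) (F_lty (measurableC mRplus)) (measurable_funTS mf) (lexx 0) (fun r _ => f01 r).
  suff -> : \int[F]_(r in ~` Rplus) f r = 0 by rewrite addr0.
  apply/eqP; rewrite eq_le; apply/andP; split.
    move: (congr1 fine FC) => /eqP; rewrite eq_le => /andP[h _].
    exact: le_trans b h.
  by move: a; rewrite mul0r.
- exact: measurableC.
- rewrite setUv; apply: (bounded_integrable measurableT (F_lty measurableT) mf).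
  by move=> r _; exact: f01.
- by apply/disj_setPS; rewrite setICr.
Qed.

Lemma over_central r : Rplus r -> over origin (central r).
Proof.
rewrite /Rplus /= in_itv/= andbT => r0; split => //.
by rewrite /reach /central /Defs.center /Defs.radius /= edistxx addr0.
Qed.

(** Grains of negative radius have no killers, hence no overlap. *)
Lemma gain_negative y r1 r2 : ~ (Rplus `*` Rplus) (r1, r2) ->
  gain lam F (central r1) (shift y (central r2)) = 0.
Proof.
move=> neg; apply/eqP; rewrite eq_le gain_ge0 andbT.
apply: le_trans (gain_le_overlap lam F_Rplus alpha_gt_d tail_gt0 tail_lim _ _) _.
rewrite /overlap (_ : _ `&` _ = set0) ?measure0// -subset0 => h [[a1 _ _ _] [b1 _ _ _]].
apply: neg; rewrite /Rplus; split; rewrite /= in_itv/= andbT.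
  by move: a1; rewrite addr0.
by move: b1; rewrite addr0.
Qed.

Section along_sequence.
Variable z : nat -> Rd R d.
Hypothesis zoo : enorm (z n) @[n --> \oo] --> +oo.
Let y n : Rd R d := scaled_e1 (enorm (z n)).

Let yE n : enorm (y n) = enorm (z n).
Proof. by rewrite /y scaled_e1E enorm_tscale ?edist_ge0// enorm_e1// mulr1. Qed.

Let yoo : enorm (y n) @[n --> \oo] --> +oo.
Proof. by under eq_fun do rewrite yE. Qed.

Let rho_u : \forall n \near \oo, 0 < rho (enorm (z n)).
Proof. exact: (zoo (rho_gt0 d tail_gt0)). Qed.

Let mc1 : measurable_fun setT (fun q : mR * mR => central q.1).
Proof. exact: (measurableT_comp measurable_central measurable_fst). Qed.
Let mc2 : measurable_fun setT (fun q : mR * mR => central q.2).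
Proof. exact: (measurableT_comp measurable_central measurable_snd). Qed.

Lemma gain_central_cvg :
  \int[FF]_q gain lam F (central q.1) (shift (y n) (central q.2)) / rho (enorm (z n))
  @[n --> \oo] --> c * ((\int[F]_r hr r) * (\int[F]_r hr r)).
Proof.
have FR := F_lty mRplus.
have mRR := measurableX mRplus mRplus.
have FRR := setX_lty mRplus mRplus FR FR.
have inD (q : mR * mR) : (Rplus `*` Rplus) q -> over origin (central q.1) /\ over origin (central q.2).
  by move=> [a b]; split; exact: over_central.
have lim := gain_integral_cvg (lam := lam) d1 F_Rplus alpha_gt_d tail_gt0 tail_lim yoo
  mRR FRR mc1 mc2 inD.
have E1 : fine (\int[FF]_(q in Rplus `*` Rplus) (c * (hr q.1 * hr q.2))%:E)%E =
    c * ((\int[F]_r hr r) * (\int[F]_r hr r)).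
  have Z := Rintegral_prod mRplus mRplus unit_central unit_central FR FR.
  rewrite -(Rintegral_Rplus unit_central) -Z; apply: RintegralZl => //.
  have [mp p01] := unit_valuedM (unit_valued_comp (measurable_fst (T1 := mR) (T2 := mR)) unit_central)
    (unit_valued_comp (measurable_snd (T1 := mR) (T2 := mR)) unit_central).
  exact: (bounded_integrable mRR FRR mp (fun q _ => p01 q)).
rewrite -E1.
have E2 n : \int[FF]_q gain lam F (central q.1) (shift (y n) (central q.2)) =
    \int[FF]_(q in Rplus `*` Rplus) gain lam F (central q.1) (shift (y n) (central q.2)).
  rewrite [RHS]Rintegral_mkcond; apply: eq_Rintegral => -[r1 r2] _.
  rewrite /patch; case: ifPn => // /negP nD; apply: gain_negative => D; apply: nD.
  exact/mem_set.
under eq_fun do rewrite E2 -yE.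
exact: lim.
Qed.

(** The tail at half the distance has the order of [tail u], which is
    smaller than [rho u] by the factor [u ^ d] with [d >= 1]. *)
Lemma ctail_rho_cvg : ctail F (enorm (z n) / 2) / rho (enorm (z n)) @[n --> \oo] --> (0 : R).
Proof.
have ugt M : \forall n \near \oo, M < enorm (z n) by exact: (zoo (nbhs_pinfty_gt (num_real M))).
have half : 0 < 2^-1 :> R by rewrite invr_gt0.
have tl := ctail_ratio_cvg F_Rplus tail_gt0 tail_lim half (lexx 0) zoo.
have uinv : (enorm (z n))^-1 @[n --> \oo] --> (0 : R).
  exact: (proj2 (gtr0_cvgV0 (ugt 0))).
have dinv : (enorm (z n) ^+ d)^-1 @[n --> \oo] --> (0 : R).
  apply: squeeze_cvgr (cvg_cst 0) uinv; near=> n.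
  have u1 : 1 < enorm (z n) by near: n; exact: ugt.
  have u0 : 0 < enorm (z n) by exact: lt_trans ltr01 u1.
  rewrite invr_ge0 exprn_ge0 ?(ltW u0)//= lef_pV2 ?posrE ?exprn_gt0//.
  by rewrite -{1}[enorm (z n)]expr1 ler_weXn2l// ltW.
have lim : ctail F (enorm (z n) / 2 - 0) / tail F (enorm (z n)) * (enorm (z n) ^+ d)^-1
  @[n --> \oo] --> 2^-1 `^ (- alpha) * 0 by exact: cvgM tl dinv.
rewrite mulr0 in lim; apply: cvg_trans lim; apply: near_eq_cvg; apply: nearW => n.
by rewrite subr0 /rho invfM mulrAC -mulrA.
Unshelve. all: by end_near. Qed.

Let unit_clash_central n : unit_valued (fun q : mR * mR =>
  clash lam F (central q.1) (shift (y n) (central q.2))).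
Proof.
have mp : measurable_fun setT (fun q : mR * mR => (central q.1, shift (y n) (central q.2))).
  apply: measurable_fun_pair; first exact: mc1.
  exact: (measurableT_comp (measurable_shift (y n)) mc2).
exact: (unit_valued_comp mp (unit_clash d lam F)).
Qed.

Let unit_gain_central n : unit_valued (fun q : mR * mR =>
  gain lam F (central q.1) (shift (y n) (central q.2))).
Proof.
have mp : measurable_fun setT (fun q : mR * mR => (central q.1, shift (y n) (central q.2))).
  apply: measurable_fun_pair; first exact: mc1.
  exact: (measurableT_comp (measurable_shift (y n)) mc2).
have u := unit_gain lam F_Rplus alpha_gt_d tail_gt0 tail_lim.
have v := unit_valued_comp mp u.
exact: v.
Qed.

Let FFT : (FF setT < +oo)%E.
Proof. by rewrite -setXTT; apply: setX_lty => //; apply: F_lty. Qed.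

(** Two grains centered at distance [u] that meet have radii of sum at least
    [u], so one of the radii is at least [u / 2]. *)
Lemma clash_central_le n : \int[FF]_q clash lam F (central q.1) (shift (y n) (central q.2)) <=
  ctail F (enorm (z n) / 2) + ctail F (enorm (z n) / 2).
Proof.
pose I : set mR := `[enorm (z n) / 2, +oo[%classic.
have mI : measurable I by exact: measurable_itv.
have m1 : measurable (I `*` [set: mR]) by exact: measurableX.
have m2 : measurable ([set: mR] `*` I) by exact: measurableX.
have large (q : mR * mR) : setT q -> 0 < clash lam F (central q.1) (shift (y n) (central q.2)) ->
    (I `*` setT) q \/ (setT `*` I) q.
  move=> _; rewrite /clash; case: asboolP => [m _|_]; last by rewrite ltxx.
  have : enorm (z n) <= q.1 + q.2.
    move: m; rewrite -yE /meets /kills /shift /recenter /central /Defs.center /Defs.radius /weight /=.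
    by rewrite origin_tadd /enorm => -[[_ _ + _]|[_ _ + _]]; rewrite addr0 1?edistC// addrC.
  have [q1|q1] := leP (enorm (z n) / 2) q.1; first by left; split => //; rewrite /I /= in_itv/= q1.
  by move=> q12; right; split => //; rewrite /I /= in_itv/= andbT; lra.
have Z := le_Rintegral_indic2 measurableT FFT (unit_clash_central n) m1 m2 large.
by rewrite (Rintegral_indic_fst F F mI) (Rintegral_indic_snd F F mI) in Z.
Qed.

Lemma clash_central_cvg :
  \int[FF]_q clash lam F (central q.1) (shift (y n) (central q.2)) / rho (enorm (z n))
  @[n --> \oo] --> (0 : R).
Proof.
apply: (ratio_squeeze0 rho_u _ ctail_rho_cvg ctail_rho_cvg) => n.
rewrite clash_central_le andbT; apply: Rintegral_ge0 => q _.
by case/andP: ((unit_clash_central n).2 q).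
Qed.

Lemma retention_cov_integral n : 0 < enorm (z n) ->
  \int[F]_r1 \int[F]_r2 retention_cov P Phi (radius_weight R) (enorm (z n)) r1 r2 =
  \int[FF]_q gain lam F (central q.1) (shift (y n) (central q.2)) -
  \int[FF]_q clash lam F (central q.1) (shift (y n) (central q.2)).
Proof.
move=> u0; rewrite -(Rintegral_iterated_sub F F (unit_gain_central n) (unit_clash_central n)).
apply: eq_Rintegral => r1 _; apply: eq_Rintegral => r2 _.
exact: retention_covE.
Qed.

Lemma retention_cov_cvg :
  (\int[F]_r1 \int[F]_r2 retention_cov P Phi (radius_weight R) (enorm (z n)) r1 r2)
    / rho (enorm (z n)) @[n --> \oo] --> c * ((\int[F]_r hr r) * (\int[F]_r hr r)).
Proof.
apply: (ratio_difference _ gain_central_cvg clash_central_cvg).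
near=> n; apply: retention_cov_integral; near: n.
exact: (zoo (nbhs_pinfty_gt (num_real 0))).
Unshelve. all: by end_near. Qed.

End along_sequence.

End two_point_asymptotics.

(** * Radius distribution and conclusion *)

(** The limit at infinity is tested along sequences, for which dominated
    convergence is available. *)
Lemma enorm_infty_cvg (R : realType) (d : nat) (f : Rd R d -> R) (l : R) :
  (forall z : nat -> Rd R d, enorm (z n) @[n --> \oo] --> +oo -> f (z n) @[n --> \oo] --> l) ->
  f z @[z --> enorm_infty] --> l.
Proof.
move=> seq; apply/cvgrPdist_lt => e e0; apply: contrapT => nf.
have far M : exists z : Rd R d, M < enorm z /\ e <= `|l - f z|.
  apply: contrapT => noz; apply: nf; exists M => // z /= Mz.
  by rewrite ltNge; apply/negP => ez; apply: noz; exists z.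
(* a sequence of counterexamples escaping to infinity *)
pose z n : Rd R d := xget origin [set z | n%:R < enorm z /\ e <= `|l - f z|].
have zP n : n%:R < enorm (z n) /\ e <= `|l - f (z n)|.
  by rewrite /z; case: xgetP => [x _ //|no]; have [x /no] := far n%:R.
have zoo : enorm (z n) @[n --> \oo] --> +oo.
  apply/cvgryPge => M; near=> n; apply: le_trans (ltW (zP n).1).
  by near: n; exact: nbhs_infty_ger.
have /cvgrPdist_lt/(_ _ e0)[N _ HN] := seq z zoo.
by have := HN N (leqnn N); rewrite /= ltNge (zP N).2.
Unshelve. all: by end_near. Qed.

Section tail_asymptotics.
Context (R : realType) (d : nat) (dO : measure_display) (Omega : measurableType dO)
  (P : probability Omega R) (Phi : Omega -> set (grain R d)) (lam : {nonneg R})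
  (F : probability (measurableTypeR R) R) (alpha : R).
Local Notation mR := (measurableTypeR R).
Local Notation G := (grain R d).
Local Notation L := (@Lam R d lam F).
Local Notation H := (hprob L).
Hypothesis d1 : (1 <= d)%N.
Hypothesis HPi : poisson_random_measure P Phi (intensity lam%:num F (radius_weight R)).
Hypothesis F_Rplus : F `[0%R, +oo[%classic = 1%E.
Hypothesis alpha_gt_d : d%:R < alpha.
Hypothesis tail_gt0 : \forall t \near +oo, 0 < tail F t.
Hypothesis tail_lim : forall a, 0 < a ->
  tail F (a * t) / tail F t @[t --> +oo] --> a `^ (- alpha).

Let L_reach : forall a x, (L (reach a x) < +oo)%E.
Proof. exact: (Lam_reach_lty lam F_Rplus alpha_gt_d tail_gt0 tail_lim). Qed.

Local Opaque hprob.
Local Notation hr := (fun r : mR => H (central d r)).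

(** Retention probability at radii above [r] is at least [exp (- Lam (wide
    r))], which tends to 1. *)
Lemma retained_tail_bounds r : 0 <= r -> (L (wide r) < +oo)%E ->
  expR (- fine (L (wide r))) * tail F r <= \int[F]_(s in `]r, +oo[) hr s <= tail F r.
Proof.
move=> r0 Lr; have tE : tail F r = fine (F `]r, +oo[%classic) by rewrite -tailE.
rewrite tE; apply: integral_between.
- exact: measurable_itv.
- exact: le_lt_trans (probability_le1 F (measurable_itv _)) (ltry 1).
- by apply: measurable_funTS; have [] := unit_central d lam F.
- exact: expR_ge0.
move=> s; rewrite /= in_itv/= andbT => rs.
have [_ h01] := unit_central d lam F; apply/andP; split; last by case/andP: (h01 s).
have ws : wide s `<=` (wide r : set G) by apply: wide_anti; exact: ltW.
have Ls : (L (wide s) < +oo)%E.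
  by apply: le_lt_trans Lr; apply: le_measure; rewrite ?inE//; exact: measurable_wide.
apply: le_trans (hprob_ge origin Ls).
by rewrite ler_expR lerN2; apply: fine_Lam_le => //; exact: measurable_wide.
Qed.

Lemma retained_tail_cvg (v : R ^nat) : v n @[n --> \oo] --> +oo ->
  (\int[F]_(s in `]v n, +oo[) hr s) / tail F (v n) @[n --> \oo] --> (1 : R).
Proof.
move=> voo.
have w1 := hprob_wide_cvg lam F_Rplus alpha_gt_d tail_gt0 tail_lim voo.
have w1' : (fun=> 1 : R) n @[n --> \oo] --> (1 : R) by exact: cvg_cst.
apply: squeeze_cvgr w1 w1'; near=> n.
have v0 : 0 <= v n.
  by apply: ltW; near: n; exact: (voo _ (nbhs_pinfty_gt (num_real 0))).
have t0 : 0 < tail F (v n) by near: n; exact: (voo _ tail_gt0).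
have Lw : (L (wide (v n)) < +oo)%E.
  by near: n; exact: (wide_near_lty lam F_Rplus alpha_gt_d tail_gt0 tail_lim voo).
have /andP[a b] := retained_tail_bounds v0 Lw.
by rewrite ler_pdivlMr// a ler_pdivrMr// mul1r b.
Unshelve. all: by end_near. Qed.

(** Large radii have positive probability and positive retention
    probability. *)
Lemma mean_hprob_gt0 : 0 < \int[F]_r hr r.
Proof.
have noo : n%:R @[n --> \oo] --> (+oo : set_system R).
  by apply/cvgryPge => M; exact: nbhs_infty_ger.
have [n [t0 Lw]] : exists n : nat, 0 < tail F n%:R /\ (L (wide n%:R) < +oo)%E.
  apply: (@filter_ex _ \oo); near=> n; split; near: n; first exact: (noo _ tail_gt0).
  exact: (wide_near_lty lam F_Rplus alpha_gt_d tail_gt0 tail_lim noo).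
have /andP[a _] := retained_tail_bounds (ler0n R n) Lw.
apply: (@lt_le_trans _ _ (expR (- fine (L (wide n%:R))) * tail F n%:R)).
  by rewrite mulr_gt0// expR_gt0.
apply: le_trans a _; have [mh h01] := unit_central d lam F.
have FT : (F setT < +oo)%E := le_lt_trans (probability_le1 F measurableT) (ltry 1).
rewrite Rintegral_mkcond; apply: le_Rintegral => //.
- apply: (bounded_integrable measurableT FT).
    apply/(measurable_restrictT _ (measurable_itv _)); exact: measurable_funTS.
  by move=> s _; rewrite /patch; case: ifP => _; [exact: h01|rewrite lexx ler01].
- exact: (bounded_integrable measurableT FT mh (fun s _ => h01 s)).
- by move=> s _; rewrite /patch; case: ifP => _ //; case/andP: (h01 s).
Unshelve. all: by end_near. Qed.

Lemma tail_thE r : tail_th P Phi lam%:num F (radius_weight R) r =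
  lam%:num / lambda_th P Phi lam%:num F (radius_weight R) * \int[F]_(s in `]r, +oo[) hr s.
Proof.
rewrite /tail_th /F_th opprB addrC subrK; congr (_ * _); apply: eq_Rintegral => s _.
exact: (mean_retentionE d1 HPi L_reach).
Qed.

End tail_asymptotics.

(** Reduces each of the three equivalences to the convergence of a ratio to
    an explicit nonzero constant. *)
Lemma asymp_equiv_ratio (R : realType) T (A : set_system T) {FA : Filter A} (f g e : T -> R) (k : R) :
  k != 0 -> f x / e x @[x --> A] --> k -> (\forall x \near A, g x = k * e x) ->
  asymp_equiv A f g.
Proof.
move=> k0 fe gE; rewrite /asymp_equiv -(divff k0).
have lim : f x / e x / k @[x --> A] --> k / k by apply: cvgM => //; exact: cvg_cst.
apply: cvg_trans lim; apply: near_eq_cvg.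
by apply: filterS gE => x ->; rewrite invfM mulrA mulrAC.
Qed.

Lemma cvg_proportional (R : realType) (f g : R ^nat) (k l l' : R) :
  (forall n, f n = k * g n) -> k * l' = l -> g n @[n --> \oo] --> l' -> f n @[n --> \oo] --> l.
Proof.
move=> fE <- gl; have lim : k * g n @[n --> \oo] --> k * l' by apply: cvgM => //; exact: cvg_cst.
by under eq_fun do rewrite fE.
Qed.

Theorem theorem7p1 (R : realType) (d : nat) (d_ge1 : (1 <= d)%N)
  (dO : measure_display) (Omega : measurableType dO) (P : probability Omega R)
  (Phi : Omega -> set (grain R d))
  (lambda alpha : R) (F : probability (measurableTypeR R) R) (ell : R -> R)
  (lambda_gt0 : 0 < lambda)
  (F_Rplus : F `[0, +oo[%classic = 1%E)
  (alpha_gt_d : d%:R < alpha)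
  (F_power_law : power_law F alpha)
  (ell_slow : slowly_varying ell)
  (F_ell : forall r, 0 < r -> tail F r = ell r * r `^ (- alpha))
  (Phi_poisson : poisson_random_measure P Phi
                   (intensity lambda F (radius_weight R))) :
  let G := radius_weight R in
  let p := p_th P Phi in
  let c := c_alpha alpha d in
  [/\ asymp_equiv +oo (tail_th P Phi lambda F G)
        (fun r => lambda / lambda_th P Phi lambda F G
                  * ell r * r `^ (- alpha)),
      asymp_equiv enorm_infty (k_th P Phi)
        (fun z => lambda * c * (1 - p) ^+ 2
                  * ell (enorm z) * enorm z `^ (- (alpha - d%:R))) &
      asymp_equiv enorm_infty (xi_th P Phi lambda F G)
        (fun z => lambda * c
                  * ell (enorm z) * enorm z `^ (- (alpha - d%:R)))].
Proof.
have [_ tail_gt0 tail_lim] := F_power_law.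
pose lam : {nonneg R} := NngNum (ltW lambda_gt0).
have HPi : poisson_random_measure P Phi (intensity lam%:num F (radius_weight R)) := Phi_poisson.
move=> G p c.
have p1 : p < 1 := p_th_lt1 HPi F_Rplus alpha_gt_d tail_gt0 tail_lim.
have c0 : 0 < c := c_alpha_gt0 d_ge1 alpha_gt_d.
have Il := lambda_thE d_ge1 HPi F_Rplus alpha_gt_d tail_gt0 tail_lim.
have I0 := mean_hprob_gt0 lam F_Rplus alpha_gt_d tail_gt0 tail_lim.
have lc0 : 0 < lambda * c by exact: mulr_gt0.
have q0 : 0 < (1 - p) ^+ 2 by rewrite exprn_gt0// subr_gt0.
set I := Rintegral _ _ _ in Il I0.
have {}Il : lambda_th P Phi lambda F G = lambda * I := Il.
have lth0 : 0 < lambda_th P Phi lambda F G by rewrite Il mulr_gt0.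
have rhoE (z : Rd R d) : 0 < enorm z ->
    ell (enorm z) * enorm z `^ (- (alpha - d%:R)) = rho d F (enorm z).
  move=> u0; rewrite /rho F_ell// opprB powRD; last by rewrite (gt_eqF u0) implybT.
  by rewrite powR_mulrn ?(ltW u0)// mulrCA.
have near0 : \forall z \near (enorm_infty : set_system (Rd R d)), 0 < enorm z.
  by exists 0.
split.
- apply: (asymp_equiv_ratio (e := tail F) (k := lambda / lambda_th P Phi lambda F G)).
  + by rewrite gt_eqF// divr_gt0.
  + apply/cvg_pinftyP => v voo.
    have lim := retained_tail_cvg lam F_Rplus alpha_gt_d tail_gt0 tail_lim voo.
    apply: (cvg_proportional _ (mulr1 _) lim) => n.
    by rewrite mulrA -(tail_thE d_ge1 HPi F_Rplus alpha_gt_d tail_gt0 tail_lim).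
  + near=> r; rewrite -mulrA -F_ell//; near: r; exact: nbhs_pinfty_gt.
- apply: (asymp_equiv_ratio (e := fun z => rho d F (enorm z)) (k := lambda * c * (1 - p) ^+ 2)).
  + by rewrite (gt_eqF (mulr_gt0 lc0 q0)).
  + apply: enorm_infty_cvg => z zoo.
    exact: (k_th_cvg d_ge1 HPi F_Rplus alpha_gt_d tail_gt0 tail_lim zoo).
  + by apply: filterS near0 => z u0; rewrite -mulrA rhoE.
- apply: (asymp_equiv_ratio (e := fun z => rho d F (enorm z)) (k := lambda * c)).
  + by rewrite (gt_eqF lc0).
  + apply: enorm_infty_cvg => z zoo.
    have lim := retention_cov_cvg d_ge1 HPi F_Rplus alpha_gt_d tail_gt0 tail_lim zoo.
    rewrite -/I in lim.
    have k_eq : lambda ^+ 2 / lambda_th P Phi lambda F G ^+ 2 * (lambda * c * (I * I)) = lambda * c.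
      by rewrite Il; field; rewrite !gt_eqF.
    by apply: (cvg_proportional _ k_eq lim) => n; rewrite mulrA.
  + by apply: filterS near0 => z u0; rewrite -mulrA rhoE.
Unshelve. all: by end_near. Qed.
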